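(* Let $0<\alpha<1$. There exists a nowhere linear real function $\varphi\in C^{1,\alpha}(\mathbb T)$ such that, as $|\lambda|\to\infty$, $\lambda\in\mathbb R$, (i) $$\|e^{i\lambda\varphi}\|_{A(\mathbb T)}=O\big(|\lambda|^{\frac{\alpha}{1+\alpha}}(\log|\lambda|)^{\frac{1-\alpha}{1+\alpha}}\big);$$ and (ii) $$\|e^{i\lambda\varphi}\|_{A_p(\mathbb T)}\simeq|\lambda|^{\frac1p-\frac1{1+\alpha}}\quad\text{for } 1<p<1+\alpha;$$ $$\|e^{i\lambda\varphi}\|_{A_p(\mathbb T)}\simeq 1\quad\text{for } 1+\alpha<p<2;$$ $$\|e^{i\lambda\varphi}\|_{A_p(\mathbb T)}=O\big((\log|\lambda|)^{1/p}\big)\quad\text{for } p=1+\alpha.$$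
   Context: A function is called nowhere linear if it is not linear (i.e. not of the form $at+b$) on any interval. The sign $\simeq$ means that for all sufficiently large $|\lambda|$ the ratio of the corresponding quantities is contained between two positive constants (independent of $\lambda$). $\mathbb T=\mathbb R/2\pi\mathbb Z$; functions on $\mathbb T$ are identified with $2\pi$-periodic functions on $\mathbb R$. Fourier coefficients: $\widehat f(k)=\frac1{2\pi}\int_0^{2\pi}f(t)e^{-ikt}\,dt$, $k\in\mathbb Z$. $A_1(\mathbb T)=A(\mathbb T)$ is the space of continuous functions $f$ on $\mathbb T$ with $\{\widehat f(k)\}\in l^1$; for $1<p\le 2$, $A_p(\mathbb T)$ is the space of integrable functions $f$ on $\mathbb T$ with $\{\widehat f(k)\}\in l^p$. The norm is $\|f\|_{A_p(\mathbb T)}=\big(\sum_{k\in\mathbb Z}|\widehat f(k)|^p\big)^{1/p}$. $C^{1,\alpha}(\mathbb T)$ is the class of $2\pi$-periodic differentiable functions $g$ on $\mathbb R$ such that $\sup_{|t_1-t_2|\le\delta}|g'(t_1)-g'(t_2)|=O(\delta^\alpha)$ as $\delta\to+0$. *)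

(* Defs.v *)
From HB Require Import structures.
From mathcomp Require Import all_boot all_order all_algebra.
From mathcomp Require Import all_classical all_reals all_analysis.
From mathcomp Require Import complex.

Set Implicit Arguments.
Unset Strict Implicit.
Unset Printing Implicit Defensive.

Import Order.TTheory GRing.Theory Num.Theory.
Import numFieldNormedType.Exports.

Local Open Scope classical_set_scope.
Local Open Scope ring_scope.
Local Open Scope complex_scope.

Definition cis (R : realType) (x : R) : R[i] := cos x +i* sin x.

(* The library has no topology or integral for R[i]-valued functions, so
   continuity, integrability and the integral are taken componentwise. *)
Definition ccontinuous (R : realType) (f : R -> R[i]) : Prop :=
  continuous (fun t => complex.Re (f t)) /\
  continuous (fun t => complex.Im (f t)).

Definition cintegrable (R : realType) (D : set R) (f : R -> R[i]) : Prop :=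
  lebesgue_measure.-integrable D (fun t => (complex.Re (f t))%:E) /\
  lebesgue_measure.-integrable D (fun t => (complex.Im (f t))%:E).

Definition cintegral (R : realType) (D : set R) (f : R -> R[i]) : R[i] :=
  (\int[lebesgue_measure]_(t in D) complex.Re (f t)) +i*
  (\int[lebesgue_measure]_(t in D) complex.Im (f t)).

Definition fourier_coef (R : realType) (f : R -> R[i]) (k : int) : R[i] :=
  ((2 * pi)^-1)%:C *
  cintegral `[0, 2 * pi] (fun t => f t * cis (- (k%:~R * t))).

Definition fourier_sum (R : realType) (p : R) (f : R -> R[i]) : \bar R :=
  \esum_(k in [set: int]) (ComplexField.Normc.normc (fourier_coef f k) `^ p)%:E.

(* The space A_p(T), for 1 <= p <= 2. *)
Definition in_A (R : realType) (p : R) (f : R -> R[i]) : Prop :=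
  [/\ periodic f (2 * pi),
      (if p == 1 then ccontinuous f else cintegrable `[0, 2 * pi] f)
    & (fourier_sum p f < +oo)%E].

(* The norm of A_p(T), set to +oo off A_p(T): a finite upper bound on
   [A_norm p f] therefore includes the assertion that f lies in A_p(T). *)
Definition A_norm (R : realType) (p : R) (f : R -> R[i]) : \bar R :=
  if `[< in_A p f >] then (fourier_sum p f `^ p^-1)%E else +oo%E.

Definition modulus_of_continuity (R : realType) (g : R -> R) (d : R) : \bar R :=
  ereal_sup [set y | exists t1 t2 : R,
    `|t1 - t2| <= d /\ y = (`|g t1 - g t2|)%:E].

Definition C1_alpha (R : realType) (alpha : R) (g : R -> R) : Prop :=
  [/\ periodic g (2 * pi),
      (forall t : R, derivable g t 1)
    & exists C : R, \forall d \near 0^'+,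
        (modulus_of_continuity (derive1 g) d <= (C * d `^ alpha)%:E)%E].

Definition nowhere_linear (R : realType) (g : R -> R) : Prop :=
  forall c d : R, c < d ->
    ~ exists a b : R, forall t : R, t \in `]c, d[ -> g t = a * t + b.

(* u(lam) = O(v(lam)) as |lam| -> oo, lam real. *)
Definition bigO_infty (R : realType) (u : R -> \bar R) (v : R -> R) : Prop :=
  exists C L : R, forall lam : R, L <= `|lam| -> (u lam <= (C * v lam)%:E)%E.

(* u(lam) and v(lam) are of the same order as |lam| -> oo; the ratio condition
   is cleared of denominators, and v is meant to be positive. *)
Definition same_order_infty (R : realType) (u : R -> \bar R) (v : R -> R) : Prop :=
  exists c C L : R, [/\ 0 < c, 0 < C & forall lam : R, L <= `|lam| ->
    ((c * v lam)%:E <= u lam /\ u lam <= (C * v lam)%:E)%E].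

(* Main.v *)
(* The phase is a lacunary sum of pulses [l ^ 2 * psi ((t - r) / l)], where [psi] is
   a combination of translates of the primitive [K] of a Cantor function of
   Hoelder exponent [alpha]; each pulse sits in an interval on which the previous
   sum is affine, so it affects the Fourier coefficients of [cis (lam * phi)] only
   through a frequency shift. On the gaps of the Cantor set [K] is affine too, and
   by self-similarity the part of a pulse at generation [m] has l1 norm
   O(2 ^ m) and squared l2 norm O((2 * xi) ^ m * l); interpolating between l1 and
   l2 and summing over the generations up to the one where the phase stops
   oscillating gives the upper bounds. For [p > 1 + alpha] the matching lower
   bound comes from the coefficient at 0. For [p < 1 + alpha] one localizes with
   a power of [(1 + cos (t - theta)) / 2] at width [|lam| ^ (- 1 / (1 + alpha))]
   around the point where [lam * phi' = k]: this gives a lower bound for averages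
   of the coefficients near each of the c * |lam| frequencies [k] in a range of
   the derivative, and averaging does not increase the l^p norm. *)

Require Import Defs.
From mathcomp Require Import all_boot all_order all_algebra.
From mathcomp Require Import all_classical all_reals all_analysis.
From mathcomp Require Import complex.
From mathcomp Require Import ring lra zify.

Set Implicit Arguments.
Unset Strict Implicit.
Unset Printing Implicit Defensive.

Import Order.TTheory GRing.Theory Num.Theory.
Import numFieldNormedType.Exports.

Local Open Scope ring_scope.
Local Open Scope classical_set_scope.
Local Open Scope complex_scope.

(** Hence lam * K stops oscillating at intervals of length about |lam|^(-1 / (1 + alpha)); there are
    about |lam|^(alpha / (1 + alpha)) of them, the growth in (i). Interpolation charges generation m
    about (2 * xi^(p - 1))^m in the p-th power of the norm. This ratio is above, equal to or below 1
    according as p is below, equal to or above 1 + alpha: this is the trichotomy in (ii), and the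
    logarithm counts generations. [K] alone is affine on every gap. Superposing pulses cures this
    provided that their contributions add up without loss in lam. Amplitude l^2 on length l leaves a
    positive power of l in every estimate (Hoelder seminorm of the slope, l1 and lp sums), so
    lacunary lengths give sums bounded uniformly in lam. Sites for new pulses are never exhausted,
    since the affine stretches of each partial sum are dense. *)

Lemma le_of_eq (R : realType) (x y : R) : x = y -> x <= y.
Proof. by move=> ->. Qed.

(** * Fourier integrals over a period *)

Section Integral.
Variable R : realType.
Local Notation mu := (@lebesgue_measure R).
Local Notation I := `[(0:R), 2 * pi].

Definition rint (f : R -> R) : R := \int[mu]_(t in `[(0:R), 2 * pi]) f t.

Lemma twopi_gt0 : 0 < 2 * pi :> R.
Proof. by rewrite mulr_gt0// pi_gt0. Qed.

Lemma continuous_integrableI (f : R -> R) : continuous f ->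
  mu.-integrable I (EFin \o f).
Proof.
move=> cf; apply: continuous_compact_integrable; first exact: segment_compact.
exact: continuous_subspaceT.
Qed.

Lemma rintD (f g : R -> R) : continuous f -> continuous g ->
  rint (fun t => f t + g t) = rint f + rint g.
Proof. by move=> cf cg; rewrite /rint RintegralD//; exact: continuous_integrableI. Qed.

Lemma rintB (f g : R -> R) : continuous f -> continuous g ->
  rint (fun t => f t - g t) = rint f - rint g.
Proof. by move=> cf cg; rewrite /rint RintegralB//; exact: continuous_integrableI. Qed.

Lemma rintZ (a : R) (f : R -> R) : continuous f ->
  rint (fun t => a * f t) = a * rint f.
Proof. by move=> cf; rewrite /rint RintegralZl//; exact: continuous_integrableI. Qed.

Lemma rint_cst (a : R) : rint (fun=> a) = a * (2 * pi).
Proof.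
rewrite /rint Rintegral_cst//= lebesgue_measure_itv/= lte_fin twopi_gt0/=.
by rewrite subr0.
Qed.

Lemma eq_rint (f g : R -> R) : f =1 g -> rint f = rint g.
Proof. by move=> fg; congr rint; apply/funext. Qed.

Lemma le_rint (f g : R -> R) : continuous f -> continuous g ->
  (forall t, 0 <= t <= 2 * pi -> f t <= g t) -> rint f <= rint g.
Proof.
move=> cf cg fg; apply: le_Rintegral => //; try exact: continuous_integrableI.
Qed.

Lemma rint_ge0 (f : R -> R) : (forall t, 0 <= f t) -> 0 <= rint f.
Proof. by move=> f0; apply: Rintegral_ge0. Qed.

Lemma rint_FTC (F f : R -> R) : (forall x : R, is_derive x 1 F (f x)) -> continuous f ->
  rint f = F (2 * pi) - F 0.
Proof.
move=> dF cf; rewrite /rint /Rintegral.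
rewrite (@continuous_FTC2 _ f F) ?twopi_gt0//.
- exact: continuous_subspaceT.
- have cF x : {for x, continuous F}.
    by apply: differentiable_continuous; apply/derivable1_diffP; case: (dF x).
  split.
  + by move=> x _; case: (dF x).
  + exact/cvg_at_right_filter/cF.
  + exact/cvg_at_left_filter/cF.
- by move=> x _; rewrite derive1E; case: (dF x).
Qed.

Lemma restrict_support (f : R -> R) (D E : set R) :
  (forall t, ~ D t -> f t = 0) -> D `<=` E -> f \_ E = f \_ D.
Proof.
move=> f0 DE; apply/funext => t; rewrite !patchE.
case: (boolP (t \in D)) => tD.
  by rewrite mem_set//; apply: DE; exact: set_mem.
have -> : f t = 0 by apply: f0 => Dt; move: tD; rewrite mem_set.
by case: ifP.
Qed.

Lemma rint_support_le (f : R -> R) (u v B : R) : continuous f -> 0 <= u -> u <= v ->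
  v <= 2 * pi -> (forall t, ~ (u <= t <= v) -> f t = 0) -> (forall t, f t <= B) ->
  rint f <= B * (v - u).
Proof.
move=> cf u0 uv v2 f0 fB.
have -> : rint f = \int[mu]_(t in `[u, v]) f t.
  rewrite /rint Rintegral_mkcond [RHS]Rintegral_mkcond.
  rewrite (@restrict_support f `[u, v])//.
  move=> t; rewrite /= !in_itv/= => /andP[ut tv].
  by rewrite (le_trans u0 ut) (le_trans tv v2).
apply: (@le_trans _ _ (\int[mu]_(t in `[u, v]) B)).
  apply: le_Rintegral => //; apply: continuous_compact_integrable;
    try exact: segment_compact; apply: continuous_subspaceT => //.
  by move=> x; exact: cvg_cst.
rewrite Rintegral_cst//= lebesgue_measure_itv/= lte_fin.
move: uv; rewrite le_eqVlt => /orP[/eqP ->|uv]; last by rewrite uv.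
by rewrite ltxx subrr.
Qed.

(** This stands in for periodicity: the support and its translate by [- h] both fit in the period,
    so the change of variables moves the domain of integration only where [f] vanishes. *)
Lemma rint_translate (f : R -> R) (u v h : R) : continuous f ->
  (forall t, ~ (u <= t <= v) -> f t = 0) ->
  0 <= u -> v <= 2 * pi -> h <= u -> v <= 2 * pi + h ->
  rint (fun t => f (t + h)) = rint f.
Proof.
move=> cf f0 u0 v2 hu vh.
have D1 (x : R) : is_derive x 1 (fun t : R => t + h) 1.
  by apply: is_derive_eq; rewrite addr0.
have d1 : (fun t : R => t + h)^`() = fun=> 1.
  by apply/funext => x; rewrite derive1E; case: (D1 x).
have cD : continuous (fun t : R => t + h).
  by move=> x; apply: cvgD => //; exact: cvg_cst.
have sub := @integration_by_substitution_increasing R (fun t : R => t + h) f 0 (2 * pi)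
  (ltW twopi_gt0).
have -> : rint (fun t => f (t + h)) = \int[mu]_(t in `[0 + h, 2 * pi + h]) f t.
  rewrite /rint /Rintegral sub//.
  - by congr fine; apply: eq_integral => x _; rewrite d1 /= mulr1.
  - by move=> x y _ _ xy; rewrite ltrD2r.
  - by rewrite d1 => x _; exact: cvg_cst.
  - by rewrite d1; exact: is_cvg_cst.
  - by rewrite d1; exact: is_cvg_cst.
  - split; first by move=> x _; case: (D1 x).
    + exact/cvg_at_right_filter/cD.
    + exact/cvg_at_left_filter/cD.
  - exact: continuous_subspaceT.
rewrite /rint Rintegral_mkcond [RHS]Rintegral_mkcond.
have f0' t : ~ `[u, v]%classic t -> f t = 0.
  by move=> tuv; apply: f0 => tuv'; apply: tuv; rewrite /= in_itv.
rewrite (@restrict_support f `[u, v])// 1?(@restrict_support f `[u, v] `[0, 2 * pi])//.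
- move=> t; rewrite /= !in_itv/= => /andP[ut tv].
  by rewrite (le_trans u0 ut) (le_trans tv v2).
- move=> t; rewrite /= !in_itv/= add0r => /andP[ut tv].
  by rewrite (le_trans hu ut) (le_trans tv vh).
Qed.

End Integral.

Local Notation normc := ComplexField.Normc.normc.

Section ComplexFourier.
Variable R : realType.
Implicit Types (f g : R -> R[i]) (z w : R[i]) (x y a : R).

Lemma normc_sqr z : normc z ^+ 2 = complex.Re z ^+ 2 + complex.Im z ^+ 2.
Proof. by case: z => u v; rewrite sqr_sqrtr// addr_ge0// sqr_ge0. Qed.

Lemma normc_ge0 z : 0 <= normc z.
Proof. by case: z => u v; exact: sqrtr_ge0. Qed.

Lemma normcC x : normc x%:C = `|x|.
Proof. by rewrite /= expr0n addr0 sqrtr_sqr. Qed.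

Lemma normc0 : normc (0 : R[i]) = 0.
Proof. exact: ComplexField.Normc.normc0. Qed.

Lemma normcM z w : normc (z * w) = normc z * normc w.
Proof. exact: ComplexField.Normc.normcM. Qed.

Lemma normcD z w : normc (z + w) <= normc z + normc w.
Proof. exact: complex.le_normcD. Qed.

Lemma normcN z : normc (- z) = normc z.
Proof. exact: complex.normcN. Qed.

Lemma normcB z w : normc (z - w) <= normc z + normc w.
Proof. by rewrite -(normcN w) normcD. Qed.

Lemma Re_le_normc z : complex.Re z <= normc z.
Proof.
case: z => u v /=; apply: (le_trans (ler_norm u)).
by rewrite -sqrtr_sqr ler_wsqrtr// lerDl sqr_ge0.
Qed.

Lemma cis0 : cis (0 : R) = 1.
Proof. by rewrite /cis cos0 sin0. Qed.

Lemma cisD x y : cis (x + y) = cis x * cis y.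
Proof.
apply/eqP; rewrite eq_complex /= cosD sinD eqxx/=; apply/eqP; ring.
Qed.

Lemma normc_cis x : normc (cis x) = 1.
Proof. by rewrite /= cos2Dsin2 sqrtr1. Qed.

Lemma cisNM x : cis (- x) * cis x = 1.
Proof. by rewrite -cisD addNr cis0. Qed.

Lemma cis_conj x : conjc (cis x) = cis (- x).
Proof. by rewrite /cis /= cosN sinN. Qed.

Lemma cis_2pi_int (n : int) : cis (n%:~R * (2 * pi)) = 1 :> R[i].
Proof.
have nat_case (m : nat) : cis (m%:R * (2 * pi)) = 1 :> R[i].
  elim: m => [|m IH]; first by rewrite mul0r cis0.
  rewrite -natr1 mulrDl mul1r cisD IH mul1r /cis.
  by rewrite mulr_natl cos2pi sin2pi.
case: n => m; first exact: nat_case.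
by rewrite NegzE mulrNz mulNr -[LHS]mulr1 -(nat_case m.+1) cisNM.
Qed.

Lemma ccontinuousD f g : ccontinuous f -> ccontinuous g ->
  ccontinuous (fun t => f t + g t).
Proof.
move=> [f1 f2] [g1 g2]; split.
  rewrite (_ : (fun t => _) = (fun t => complex.Re (f t) + complex.Re (g t))).
    by move=> t; apply: cvgD; [exact: f1|exact: g1].
  by apply/funext => t; case: (f t); case: (g t).
rewrite (_ : (fun t => _) = (fun t => complex.Im (f t) + complex.Im (g t))).
  by move=> t; apply: cvgD; [exact: f2|exact: g2].
by apply/funext => t; case: (f t); case: (g t).
Qed.

Lemma ccontinuousM f g : ccontinuous f -> ccontinuous g ->
  ccontinuous (fun t => f t * g t).
Proof.
move=> [f1 f2] [g1 g2]; split.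
  rewrite (_ : (fun t => _) = (fun t => complex.Re (f t) * complex.Re (g t)
    - complex.Im (f t) * complex.Im (g t))).
    by move=> t; apply: cvgB; apply: cvgM;
      [exact: f1|exact: g1|exact: f2|exact: g2].
  by apply/funext => t; case: (f t) => a b; case: (g t) => c d.
rewrite (_ : (fun t => _) = (fun t => complex.Re (f t) * complex.Im (g t)
    + complex.Im (f t) * complex.Re (g t))).
  by move=> t; apply: cvgD; apply: cvgM;
    [exact: f1|exact: g2|exact: f2|exact: g1].
by apply/funext => t; case: (f t) => a b; case: (g t) => c d.
Qed.

Lemma ccontinuous_cst z : ccontinuous (fun _ : R => z).
Proof. by split => t; exact: cvg_cst. Qed.

Lemma ccontinuous_real (h : R -> R) : continuous h -> ccontinuous (fun t => (h t)%:C).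
Proof. by move=> ch; split => // t; exact: cvg_cst. Qed.

Lemma ccontinuous_cis (h : R -> R) : continuous h -> ccontinuous (fun t => cis (h t)).
Proof.
move=> ch; split => t.
  by apply: (@continuous_comp _ _ _ h cos); [exact: ch|exact: continuous_cos].
by apply: (@continuous_comp _ _ _ h sin); [exact: ch|exact: continuous_sin].
Qed.

Lemma continuous_linear (y b : R) : continuous (fun t : R => y * t + b).
Proof.
move=> t; apply: cvgD; last exact: cvg_cst.
by apply: cvgM; [exact: cvg_cst|exact: cvg_id].
Qed.

Lemma continuous_scale (y : R) : continuous (fun t : R => y * t).
Proof. by move=> t; apply: cvgM; [exact: cvg_cst|exact: cvg_id]. Qed.

Lemma ccontinuous_char y : ccontinuous (fun t : R => cis (- (y * t))).
Proof. by apply: ccontinuous_cis => t; apply: cvgN; exact: continuous_scale. Qed.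

Lemma continuous_normc_sqr f : ccontinuous f -> continuous (fun t => normc (f t) ^+ 2).
Proof.
move=> [f1 f2].
rewrite (_ : (fun t => _) = fun t => complex.Re (f t) * complex.Re (f t) + complex.Im (f t) * complex.Im (f t)).
  by move=> t; apply: cvgD; apply: cvgM; [exact: f1|exact: f1|exact: f2|exact: f2].
by apply/funext => t; rewrite normc_sqr !expr2.
Qed.

Definition cint f : R[i] :=
  rint (fun t => complex.Re (f t)) +i* rint (fun t => complex.Im (f t)).

Lemma eq_cint f g : f =1 g -> cint f = cint g.
Proof. by move=> fg; congr cint; apply/funext. Qed.

Lemma cintD f g : ccontinuous f -> ccontinuous g ->
  cint (fun t => f t + g t) = cint f + cint g.
Proof.
move=> [f1 f2] [g1 g2]; apply/eqP; rewrite eq_complex /= -!rintD//.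
by apply/andP; split; apply/eqP/eq_rint => t; case: (f t); case: (g t).
Qed.

Lemma cintZ z f : ccontinuous f -> cint (fun t => z * f t) = z * cint f.
Proof.
case: z => a b [f1 f2]; apply/eqP; rewrite eq_complex /= -!rintZ//.
have cz (c : R) h : continuous h -> continuous (fun t : R => c * h t).
  by move=> ch t; apply: cvgM; [exact: cvg_cst|exact: ch].
rewrite -rintB -?rintD; try exact: cz.
by apply/andP; split; apply/eqP/eq_rint => t; case: (f t).
Qed.

(** The integral is componentwise, so the triangle inequality is recovered by a rotation:
    multiplying by the conjugate of the integral [z] turns |z|^2 into one real integral. *)
Lemma normc_cint_le f (h : R -> R) : ccontinuous f -> continuous h ->
  (forall t, 0 <= t <= 2 * pi -> normc (f t) <= h t) -> normc (cint f) <= rint h.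
Proof.
move=> cf ch fh; set z := cint f.
have [z0|z0] := eqVneq (normc z) 0.
  rewrite z0 -(mul0r (2 * pi)) -(rint_cst 0); apply: le_rint => //.
    by move=> ?; exact: cvg_cst.
  by move=> t tI; apply: le_trans (fh t tI); exact: normc_ge0.
have zp : 0 < normc z by rewrite lt_neqAle eq_sym z0 normc_ge0.
rewrite -(ler_pM2l zp) -expr2 -rintZ//.
have -> : normc z ^+ 2 = rint (fun t => complex.Re (conjc z * f t)).
  have <- : complex.Re (cint (fun t => conjc z * f t)) =
    rint (fun t => complex.Re (conjc z * f t)) by [].
  rewrite cintZ// -/z normc_sqr; case: (z) => u v /=; ring.
apply: le_rint.
- exact: (ccontinuousM (ccontinuous_cst _) cf).1.
- by move=> t; apply: cvgM; [exact: cvg_cst|exact: ch].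
- move=> t tI; apply: (le_trans (Re_le_normc _)); rewrite normcM.
  have -> : normc (conjc z) = normc z by case: (z) => u v /=; rewrite sqrrN.
  by rewrite ler_wpM2l ?normc_ge0// fh.
Qed.

(* Fourier integral at an arbitrary real frequency, so that modulating [f] by
   [cis (a * t)] amounts to shifting the frequency. *)
Definition fint f (y : R) : R[i] := cint (fun t => f t * cis (- (y * t))).
Arguments fint : simpl never.

Lemma fintD f g y : ccontinuous f -> ccontinuous g ->
  fint (fun t => f t + g t) y = fint f y + fint g y.
Proof.
move=> cf cg; rewrite /fint -cintD; first by apply: eq_cint => t; rewrite mulrDl.
- exact: ccontinuousM cf (ccontinuous_char y).
- exact: ccontinuousM cg (ccontinuous_char y).
Qed.

Lemma fintZ z f y : ccontinuous f -> fint (fun t => z * f t) y = z * fint f y.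
Proof.
move=> cf; rewrite /fint -cintZ; first by apply: eq_cint => t; rewrite mulrA.
exact: ccontinuousM cf (ccontinuous_char y).
Qed.

Lemma fintB f g y : ccontinuous f -> ccontinuous g ->
  fint (fun t => f t - g t) y = fint f y - fint g y.
Proof.
move=> cf cg; rewrite -mulN1r -fintZ// -fintD//; last first.
  exact: ccontinuousM (ccontinuous_cst _) cg.
by congr fint; apply/funext => t; rewrite mulN1r.
Qed.

Lemma fint_modulate f a b y : ccontinuous f ->
  fint (fun t => cis (a * t + b) * f t) y = cis b * fint f (y - a).
Proof.
move=> cf; rewrite /fint -cintZ; last exact: ccontinuousM cf (ccontinuous_char _).
apply: eq_cint => t; rewrite cisD.
have -> : - ((y - a) * t) = a * t + - (y * t) by ring.
rewrite cisD; ring.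
Qed.

Lemma normc_fint_modulate f a b y : ccontinuous f ->
  normc (fint (fun t => cis (a * t + b) * f t) y) = normc (fint f (y - a)).
Proof. by move=> cf; rewrite fint_modulate// normcM normc_cis mul1r. Qed.

Lemma normc_fint_le f (h : R -> R) y : ccontinuous f -> continuous h ->
  (forall t, 0 <= t <= 2 * pi -> normc (f t) <= h t) -> normc (fint f y) <= rint h.
Proof.
move=> cf ch fh; apply: normc_cint_le => //.
  exact: ccontinuousM cf (ccontinuous_char _).
by move=> t tI; rewrite normcM normc_cis mulr1 fh.
Qed.

Lemma cint_char (n : int) : n != 0 -> cint (fun t : R => cis (n%:~R * t)) = 0.
Proof.
move=> n0; have nR : n%:~R != 0 :> R by rewrite intr_eq0.
have := cis_2pi_int n; rewrite /cis => -[cn sn].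
apply/eqP; rewrite eq_complex /=.
have d1 (x : R) : is_derive x 1 (fun t => sin (n%:~R * t) / n%:~R) (cos (n%:~R * x)).
  apply: is_derive_eq; rewrite /GRing.scale/=; field.
  exact: nR.
have d2 (x : R) : is_derive x 1 (fun t => - (cos (n%:~R * t) / n%:~R)) (sin (n%:~R * x)).
  apply: is_derive_eq; rewrite /GRing.scale/=; field.
  exact: nR.
have [c1 c2] := ccontinuous_cis (@continuous_scale n%:~R).
rewrite (rint_FTC d1)// (rint_FTC d2)//.
by rewrite cn sn mulr0 cos0 sin0 !subrr eqxx.
Qed.

Lemma rint_normc_sqrB f z y : ccontinuous f ->
  rint (fun t => normc (f t - z * cis (y * t)) ^+ 2) =
  rint (fun t => normc (f t) ^+ 2) - 2 * complex.Re (conjc z * fint f y) +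
  normc z ^+ 2 * (2 * pi).
Proof.
move=> cf.
have cc : ccontinuous (fun t => conjc z * (f t * cis (- (y * t)))).
  apply: ccontinuousM; first exact: ccontinuous_cst.
  exact: ccontinuousM cf (ccontinuous_char _).
rewrite (@eq_rint _ _ (fun t => normc (f t) ^+ 2 -
   2 * complex.Re (conjc z * (f t * cis (- (y * t)))) + normc z ^+ 2)); last first.
  move=> t; rewrite !normc_sqr -cis_conj.
  have := cos2Dsin2 (y * t); rewrite /cis; set c := cos _; set s := sin _.
  case: (f t) => p q; case: z {cc} => u v /= cs.
  have -> : u ^+ 2 + v ^+ 2 = (u ^+ 2 + v ^+ 2) * (c ^+ 2 + s ^+ 2) by rewrite cs mulr1.
  ring.
have k1 := continuous_normc_sqr cf.
have k2 : continuous (fun t => 2 * complex.Re (conjc z * (f t * cis (- (y * t))))).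
  by move=> t; apply: cvgM; [exact: cvg_cst|exact: cc.1].
have kc : continuous (fun _ : R => normc z ^+ 2) by move=> t; exact: cvg_cst.
rewrite (rintD _ kc) ?rint_cst; last by move=> t; apply: cvgB; [exact: k1|exact: k2].
rewrite rintB// (rintZ 2); last exact: cc.1.
have -> : rint (fun t => complex.Re (conjc z * (f t * cis (- (y * t))))) =
  complex.Re (cint (fun t => conjc z * (f t * cis (- (y * t))))) by [].
by rewrite cintZ //; exact: ccontinuousM cf (ccontinuous_char _).
Qed.

(** Induction on [s]: subtracting the projection on one character lowers the l2 norm by exactly its
    term and leaves the other coefficients alone. The real shift [a] is harmless, as differences of
    frequencies remain integers. *)
Lemma bessel (s : seq int) f a : uniq s -> ccontinuous f ->
  \sum_(k <- s) normc (fint f (k%:~R - a)) ^+ 2 <=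
  2 * pi * rint (fun t => normc (f t) ^+ 2).
Proof.
elim: s f => [|k s IH] f.
  move=> _ cf; rewrite big_nil mulr_ge0// ?(ltW (twopi_gt0 R))//.
  by apply: rint_ge0 => t; exact: sqr_ge0.
rewrite cons_uniq => /andP[ks us] cf; rewrite big_cons.
set y := k%:~R - a; pose z := (2 * pi)^-1%:C * fint f y.
pose g t := f t - z * cis (y * t).
have ce : ccontinuous (fun t => z * cis (y * t)).
  apply: ccontinuousM; first exact: ccontinuous_cst.
  exact: ccontinuous_cis (@continuous_scale _).
have cg : ccontinuous g.
  rewrite /g; have := ccontinuousD cf (ccontinuousM (ccontinuous_cst (-1)) ce).
  by congr ccontinuous; apply/funext => t; rewrite mulN1r.
have -> : \sum_(j <- s) normc (fint f (j%:~R - a)) ^+ 2 =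
          \sum_(j <- s) normc (fint g (j%:~R - a)) ^+ 2.
  apply: eq_big_seq => j js; congr (normc _ ^+ 2).
  rewrite /g fintB// fintZ; last exact: ccontinuous_cis (@continuous_scale _).
  suff -> : fint (fun t => cis (y * t)) (j%:~R - a) = 0 by rewrite mulr0 subr0.
  rewrite -(@cint_char (k - j)); last by rewrite subr_eq0; apply: contraNneq ks => ->.
  apply: eq_cint => t; rewrite -cisD; congr cis; rewrite /y rmorphB/=; ring.
rewrite (le_trans (lerD (lexx _) (IH _ us cg)))//.
rewrite /g rint_normc_sqrB//; apply: le_of_eq.
have pi0 : pi != 0 :> R by rewrite gt_eqF// pi_gt0.
rewrite /z; move: (fint f y) => w; rewrite !normc_sqr.
by case: w => u v /=; move: (rint _) (pi : R) pi0 => I p p0; field.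
Qed.

End ComplexFourier.

(** * Sums of Fourier coefficients of Lipschitz bumps *)

Section Atoms.
Variable R : realType.
Implicit Types (f g : R -> R[i]).

Definition supported f (u v : R) := forall t, ~ (u <= t <= v) -> f t = 0.
Definition clipschitz (L : R) f := forall s t, normc (f s - f t) <= L * `|s - t|.

Lemma lipschitz_continuous (L : R) (h : R -> R) :
  (forall s t, `|h s - h t| <= L * `|s - t|) -> continuous h.
Proof.
move=> hL x; apply/cvgrPdist_lt => e e0.
have L0 : 0 <= L.
  by have := hL 1 0; rewrite subr0 normr1 mulr1; apply: le_trans; exact: normr_ge0.
have Lp : 0 < L + 1 by rewrite ltr_wpDl.
exists (e / (L + 1)); first by rewrite /= divr_gt0.
move=> t /= xt; apply: (le_lt_trans (hL _ _)).
apply: (@le_lt_trans _ _ ((L + 1) * `|x - t|)).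
  by rewrite ler_wpM2r// lerDl.
by rewrite mulrC -ltr_pdivlMr.
Qed.

Lemma normc_ge_Re_norm (z : R[i]) : `|complex.Re z| <= normc z.
Proof.
by case: z => u v /=; rewrite -sqrtr_sqr ler_wsqrtr// lerDl sqr_ge0.
Qed.

Lemma normc_ge_Im_norm (z : R[i]) : `|complex.Im z| <= normc z.
Proof.
by case: z => u v /=; rewrite -sqrtr_sqr ler_wsqrtr// lerDr sqr_ge0.
Qed.

Lemma clipschitz_ccontinuous (L : R) f : clipschitz L f -> ccontinuous f.
Proof.
move=> fL; split; apply: (@lipschitz_continuous L) => s t;
  apply: le_trans (fL s t).
  by rewrite (le_trans _ (normc_ge_Re_norm _))//; case: (f s); case: (f t).
by rewrite (le_trans _ (normc_ge_Im_norm _))//; case: (f s); case: (f t).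
Qed.

Lemma ler_sum_subseq (s t : seq int) (h : int -> R) : uniq s -> uniq t ->
  {subset s <= t} -> (forall k, 0 <= h k) -> \sum_(k <- s) h k <= \sum_(k <- t) h k.
Proof.
move=> us ut st h0; rewrite [leRHS](bigID (mem s))/=.
have -> : \sum_(k <- t | k \in s) h k = \sum_(k <- s) h k.
  rewrite -big_filter; apply: perm_big; apply: uniq_perm => //.
    exact: filter_uniq.
  by move=> k; rewrite mem_filter; case: (boolP (k \in s)) => // /st ->.
by rewrite lerDl sumr_ge0.
Qed.

Definition int_window (N : nat) : seq int := map (fun i : nat => i%:Z - N%:Z) (iota 0 (N.*2.+1)).

Lemma int_seq_window (s : seq int) : exists N : nat, {subset s <= int_window N}.
Proof.
have [N HN] : exists N : nat, forall k, k \in s -> (`|k| <= N)%N.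
  elim: s => [|k s [N IH]]; first by exists 0%N.
  exists (maxn N `|k|%N) => j; rewrite inE => /orP[/eqP ->|/IH jN].
    exact: leq_maxr.
  by rewrite leq_max jN.
exists N => j /HN jN; apply/(@mapP nat int).
exists (absz (j + N%:Z)%R); first by rewrite mem_iota; lia.
lia.
Qed.

(** Mean value theorem: the intermediate point is within 1/2 of r * y because r <= 1, so the
    derivative of [atan] loses at most a factor 2. The increments are made to telescope. *)
Lemma atan_increment (r y : R) : 0 < r -> r <= 1 ->
  r / (2 * (1 + (r * y) ^+ 2)) <= atan (r * (y + 2^-1)) - atan (r * (y - 2^-1)).
Proof.
move=> r0 r1.
have ab : r * (y - 2^-1) < r * (y + 2^-1).
  by rewrite ltr_pM2l// ltrD2l; have : 0 < 2^-1 :> R; [rewrite invr_gt0|lra].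
have [c /[!in_itv]/= /andP[c1 c2] ->] := MVT ab
  (fun x _ => is_derive1_atan x) (continuous_subspaceT (@continuous_atan R)).
have -> : r * (y + 2^-1) - r * (y - 2^-1) = r by field.
rewrite mulrC ler_pM2r// lef_pV2 ?posrE.
- set x := r * y in c1 c2 *.
  have d1 : c - x <= 2^-1 by move: c2; rewrite mulrDr -/x; lra.
  have d2 : - 2^-1 <= c - x by move: c1; rewrite mulrDr -/x; lra.
  have := sqr_ge0 (2 * x - c); nra.
- by rewrite mulr_gt0// ltr_wpDr// sqr_ge0.
- by rewrite ltr_wpDr// sqr_ge0.
Qed.

(** Enlarging [s] to a full window of integers makes the [atan] increments telescope; the total
    variation of [atan] is pi, whence [2 * pi / r]. *)
Lemma sum_inv_oneDsqr_le (s : seq int) (r a : R) : uniq s -> 0 < r -> r <= 1 ->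
  \sum_(k <- s) (1 + (r * (k%:~R - a)) ^+ 2)^-1 <= 2 * pi / r.
Proof.
move=> us r0 r1.
have [N sN] := int_seq_window s.
have h0 k : 0 <= (1 + (r * (k%:~R - a)) ^+ 2)^-1.
  by rewrite invr_ge0 addr_ge0// sqr_ge0.
apply: (le_trans (ler_sum_subseq us _ sN h0)).
  by rewrite map_inj_uniq ?iota_uniq// => i j; lia.
rewrite /int_window big_map.
pose G (i : nat) : R := atan (r * (i%:R - N%:R - a - 2^-1)).
apply: (@le_trans _ _ (\sum_(0 <= i < N.*2.+1) 2 / r * (G i.+1 - G i))).
  rewrite /index_iota subn0; apply: ler_sum => i _.
  have := atan_increment (i%:R - N%:R - a) r0 r1.
  rewrite /G -[i.+1%:R]natr1; set y := i%:R - N%:R - a.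
  have -> : (i%:Z - N%:Z)%:~R - a = y :> R by rewrite rmorphB.
  have -> : i%:R + 1 - N%:R - a - 2^-1 = y + 2^-1 by rewrite /y; field.
  set d := atan _ - _ => yd.
  rewrite mulrAC ler_pdivlMr//.
  have p : 0 < 1 + (r * y) ^+ 2 by rewrite ltr_wpDr// sqr_ge0.
  apply: le_trans (_ : 2 * (r / (2 * (1 + (r * y) ^+ 2))) <= _); last by rewrite ler_pM2l.
  apply: le_of_eq; field.
  by rewrite gt_eqF.
rewrite -mulr_sumr telescope_sumr// mulrAC ler_pM2r ?invr_gt0// ler_pM2l//.
have h1 : G N.*2.+1 < pi / 2 := atan_ltpi2 _.
have h2 : - (pi / 2) < G 0%N := atan_gtNpi2 _.
move: (G _) (G _) (pi : R) h1 h2 => x y p; lra.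
Qed.

Lemma sin_lower : exists2 eta : R, 0 < eta &
  forall y, `|y| <= eta -> `|y| <= 2 * `|sin y|.
Proof.
have /cvgrPdist_lt/(_ 2^-1) := @continuous_cos R 0.
rewrite cos0 invr_gt0 => /(_ (ltr0n _ 2)).
move=> [/= e e0 He]; exists (e / 2); first by rewrite divr_gt0.
have pos (y : R) : 0 < y -> y <= e / 2 -> y <= 2 * `|sin y|.
  move=> y0 ye.
  have [c /[!in_itv]/= /andP[c1 c2]] := MVT y0
    (fun x _ => is_derive_sin x) (continuous_subspaceT (@continuous_sin R)).
  rewrite sin0 !subr0 => ->; rewrite normrM (gtr0_norm y0) mulrA ler_peMl ?ltW//.
  have := He c; rewrite /= sub0r normrN gtr0_norm//.
  have ce : c < e by lra.
  move=> /(_ ce) h; have := ler_norm (cos c); have := ler_norm (1 - cos c); lra.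
move=> y; case: (ltrgtP y 0) => [y0|y0|->]; last by rewrite normr0 => _; exact: mulr_ge0.
  rewrite ltr0_norm// => ye; have := pos (- y); rewrite sinN normrN; apply => //.
  by rewrite oppr_gt0.
by rewrite gtr0_norm//; exact: pos.
Qed.

Lemma normc_cisB1 (x : R) : normc (cis x - 1) = 2 * `|sin (x / 2)|.
Proof.
apply/eqP; rewrite -(@eqrXn2 _ 2)// ?mulr_ge0// ?normc_ge0//.
rewrite normc_sqr exprMn -normrX ger0_norm ?sqr_ge0//.
have xE : x = x / 2 + x / 2 by field.
rewrite [in X in X == _]xE /cis /= cosD sinD; apply/eqP.
have := cos2Dsin2 (x / 2); set c := cos _; set s := sin _ => cs.
have c2 : c ^+ 2 = 1 - s ^+ 2 by rewrite -cs; ring.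
have -> : (c * c - s * s - 1) = - 2 * s ^+ 2 by rewrite -expr2 c2; ring.
have -> : (s * c + c * s - 0) ^+ 2 = 4 * s ^+ 2 * c ^+ 2 by ring.
rewrite c2; ring.
Qed.

Lemma supported_char f (u v y : R) : supported f u v ->
  supported (fun t => f t * cis (- (y * t))) u v.
Proof. by move=> fs t tuv; rewrite fs// mul0r. Qed.

Lemma ccontinuous_translate f (h : R) : ccontinuous f -> ccontinuous (fun t => f (t + h)).
Proof.
move=> [c1 c2].
have ct : continuous (fun t : R => t + h).
  by move=> t; apply: cvgD; [exact: cvg_id|exact: cvg_cst].
split => t.
  by apply: (@continuous_comp _ _ _ (fun t => t + h) (fun t => complex.Re (f t)));
    [exact: ct|exact: c1].
by apply: (@continuous_comp _ _ _ (fun t => t + h) (fun t => complex.Im (f t)));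
  [exact: ct|exact: c2].
Qed.

Lemma fint_translate f (u v h y : R) : ccontinuous f -> supported f u v ->
  0 <= u -> v <= 2 * pi -> h <= u -> v <= 2 * pi + h ->
  fint (fun t => f (t + h)) y = cis (y * h) * fint f y.
Proof.
move=> cf sf u0 v2 hu vh.
have cF := ccontinuousM cf (ccontinuous_char y).
have sF := supported_char y sf.
have -> : fint f y = cint (fun t => f (t + h) * cis (- (y * (t + h)))).
  apply/eqP; rewrite /fint eq_complex /= .
  rewrite -(@rint_translate _ (fun t => complex.Re (f t * cis (- (y * t)))) u v h)//;
    [|exact: cF.1|by move=> t tuv; rewrite sF].
  rewrite -(@rint_translate _ (fun t => complex.Im (f t * cis (- (y * t)))) u v h)//;
    [|exact: cF.2|by move=> t tuv; rewrite sF].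
  by rewrite !eqxx.
rewrite -cintZ; last exact: (ccontinuous_translate h cF).
apply: eq_cint => t; rewrite mulrCA -cisD; congr (_ * cis _); ring.
Qed.

(** Picks one translation step that is small with respect to all the finitely many frequencies under
    consideration. *)
Lemma exists_small (s : seq int) (F : int -> R) (eta : R) : 0 < eta ->
  exists2 h, 0 < h & forall k, k \in s -> `|F k| * h <= eta.
Proof.
move=> eta0; elim: s => [|k s [h h0 IH]]; first by exists 1.
have hk : 0 < eta / (`|F k| + 1) by rewrite divr_gt0// ltr_wpDl.
exists (Num.min h (eta / (`|F k| + 1))); first by rewrite lt_min h0.
move=> j; rewrite inE => /orP[/eqP ->|js].
  apply: (@le_trans _ _ (`|F k| * (eta / (`|F k| + 1)))).
    by rewrite ler_wpM2l// ge_min lexx orbT.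
  rewrite mulrCA -[leRHS]mulr1 ler_wpM2l ?(ltW eta0)//.
  by rewrite ler_pdivrMr ?ltr_wpDl// mul1r lerDl.
by apply: le_trans (IH j js); rewrite ler_wpM2l// ge_min lexx.
Qed.

Lemma normc_sqr_support_le f (u v B : R) : ccontinuous f -> supported f u v ->
  0 <= u -> u <= v -> v <= 2 * pi -> (forall t, normc (f t) <= B) ->
  rint (fun t => normc (f t) ^+ 2) <= B ^+ 2 * (v - u).
Proof.
move=> cf sf u0 uv v2 fB; apply: rint_support_le => //.
- exact: continuous_normc_sqr.
- by move=> t tuv; rewrite sf// normc0 expr0n.
- by move=> t; rewrite ler_sqr ?nnegrE ?normc_ge0// (le_trans _ (fB t))// normc_ge0.
Qed.

(** A Bessel inequality for the derivative, phrased with the difference f(t + h) - f(t) since [f] is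
    only Lipschitz. Its coefficient at y is multiplied by e^(i y h) - 1, comparable to y * h when h
    is small, and the powers of h cancel. *)
Lemma sum_freq_sqr_le (s : seq int) f (u v r L a : R) : uniq s ->
  clipschitz L f -> supported f u v -> 0 < u -> u <= v -> v < 2 * pi ->
  0 < r -> v - u <= r -> 0 <= L ->
  \sum_(k <- s) (k%:~R - a) ^+ 2 * normc (fint f (k%:~R - a)) ^+ 2 <=
  16 * pi * L ^+ 2 * r.
Proof.
move=> us Lf sf u0 uv v2 r0 vur L0.
have cf := clipschitz_ccontinuous Lf.
have [eta eta0 Heta] := sin_lower.
have [h0 h0p Hh0] := exists_small s (fun k => (k%:~R - a) / 2) eta0.
(* At most [h0] for the lower bound on the sine at every frequency of [s], at most [u] to stay in
   the period, and at most [r] so that the difference is supported on length 2 r. *)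
pose h := Num.min h0 (Num.min u r).
have hp : 0 < h by rewrite !lt_min h0p u0 r0.
have hu : h <= u by rewrite /h !ge_min lexx orbT.
have hr : h <= r by rewrite /h !ge_min lexx !orbT.
have hh0 : h <= h0 by rewrite /h ge_min lexx.
pose g t := f (t + h) - f t.
have cfh := ccontinuous_translate h cf.
have cg : ccontinuous g.
  rewrite /g; have := ccontinuousD cfh (ccontinuousM (ccontinuous_cst (-1)) cf).
  by congr ccontinuous; apply/funext => t; rewrite mulN1r.
have gE y : fint g y = (cis (y * h) - 1) * fint f y.
  rewrite /g fintB// (@fint_translate f u v)//; first by ring.
  - exact: ltW.
  - exact: ltW.
  - by rewrite (le_trans (ltW v2))// lerDl ltW.
have sg : supported g (u - h) v.
  move=> t tuv; rewrite /g !sf ?subr0//.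
    by move=> /andP[t1 t2]; apply: tuv; rewrite t2 andbT; lra.
  by move=> /andP[t1 t2]; apply: tuv; lra.
have gB t : normc (g t) <= L * h.
  by apply: (le_trans (Lf _ _)); rewrite addrAC subrr add0r gtr0_norm.
have B : \sum_(k <- s) normc (fint g (k%:~R - a)) ^+ 2 <= 2 * pi * ((L * h) ^+ 2 * (2 * r)).
  apply: (le_trans (bessel _ us cg)); rewrite ler_pM2l ?twopi_gt0//.
  apply: (le_trans (normc_sqr_support_le cg sg _ _ _ gB)); [lra|lra|lra|].
  rewrite ler_wpM2l ?sqr_ge0//; lra.
have hn0 : h != 0 by rewrite gt_eqF.
have -> : 16 * pi * L ^+ 2 * r = 4 / h ^+ 2 * (2 * pi * ((L * h) ^+ 2 * (2 * r))).
  by move: (pi : R) => p; field.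
apply: le_trans (_ : 4 / h ^+ 2 * \sum_(k <- s) normc (fint g (k%:~R - a)) ^+ 2 <= _); last first.
  by rewrite ler_wpM2l// divr_ge0// sqr_ge0.
rewrite mulr_sumr big_seq [leRHS]big_seq; apply: ler_sum => k ks.
set y := k%:~R - a; rewrite gE normcM normc_cisB1 exprMn.
have sy : `|y * h / 2| <= eta.
  apply: le_trans (Hh0 _ ks); rewrite -/y -mulrA (mulrC h) mulrA normrM.
  by rewrite ler_wpM2l// gtr0_norm.
have := Heta _ sy => sy2.
have key : y ^+ 2 <= 4 / h ^+ 2 * (2 * `|sin (y * h / 2)|) ^+ 2.
  have -> : y ^+ 2 = 4 / h ^+ 2 * (y * h / 2) ^+ 2 by field.
  rewrite ler_wpM2l ?divr_ge0 ?sqr_ge0// -[leLHS]real_normK ?num_real//.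
  by rewrite ler_sqr ?nnegrE// mulr_ge0.
by rewrite [leRHS]mulrA ler_wpM2r ?sqr_ge0.
Qed.

Lemma atom_sup f (u v r L : R) : clipschitz L f -> supported f u v ->
  v - u <= r -> 0 < r -> 0 <= L -> forall t, normc (f t) <= 2 * L * r.
Proof.
move=> Lf sf vur r0 L0 t.
have [/andP[ut tv]|tuv] := boolP (u <= t <= v); last first.
  by rewrite sf ?normc0 ?mulr_ge0 ?(ltW r0)//; exact/negP.
have : f (v + r) = 0 by apply: sf => /andP[_]; lra.
move=> z; have := Lf t (v + r); rewrite z subr0 => /le_trans; apply.
rewrite (mulrC 2) -mulrA ler_wpM2l// ler0_norm; lra.
Qed.

(* Each frequency is weighted by [w = 1 + (r y)^2] and split by AM-GM: the
   reciprocal weights sum to O(1/r), and [w] is controlled by Bessel's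
   inequality for the function and for its difference quotient. *)
Lemma sum_atom_le (s : seq int) f (u v r L a : R) : uniq s ->
  clipschitz L f -> supported f u v -> 0 < u -> u <= v -> v < 2 * pi ->
  0 < r -> r <= 1 -> v - u <= r -> 0 < L ->
  \sum_(k <- s) normc (fint f (k%:~R - a)) <= 13 * pi * (L * r).
Proof.
move=> us Lf sf u0 uv v2 r0 r1 vur L0.
have cf := clipschitz_ccontinuous Lf.
have S1 := sum_freq_sqr_le a us Lf sf u0 uv v2 r0 vur (ltW L0).
have S0 : \sum_(k <- s) normc (fint f (k%:~R - a)) ^+ 2 <= 2 * pi * ((2 * L * r) ^+ 2 * r).
  apply: (le_trans (bessel _ us cf)); rewrite ler_pM2l ?twopi_gt0//.
  apply: (le_trans (normc_sqr_support_le cf sf (ltW u0) uv (ltW v2) (atom_sup Lf sf vur r0 (ltW L0)))).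
  by rewrite ler_wpM2l// sqr_ge0.
have S2 := sum_inv_oneDsqr_le a us r0 r1.
(* The natural size of a coefficient, height L * r times length r; with it both halves of the AM-GM
   split have the same order. *)
pose T := L * r ^+ 2.
have T0 : 0 < T by rewrite mulr_gt0// exprn_gt0.
pose W (k : int) : R := 1 + (r * (k%:~R - a)) ^+ 2.
have W0 k : 0 < W k by rewrite /W ltr_wpDr// sqr_ge0.
apply: (@le_trans _ _ (\sum_(k <- s) (T / 2 * (W k)^-1 + (2 * T)^-1 * (normc (fint f (k%:~R - a)) ^+ 2 +
   r ^+ 2 * ((k%:~R - a) ^+ 2 * normc (fint f (k%:~R - a)) ^+ 2))))).
  apply: ler_sum => k _; set n := normc _; set y := k%:~R - a.
  have -> : n ^+ 2 + r ^+ 2 * (y ^+ 2 * n ^+ 2) = W k * n ^+ 2 by rewrite /W -/y; ring.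
  rewrite -subr_ge0.
  have -> : T / 2 / W k + (2 * T)^-1 * (W k * n ^+ 2) - n = (2 * T * W k)^-1 * (T - W k * n) ^+ 2.
    by field; rewrite !gt_eqF.
  by rewrite mulr_ge0 ?sqr_ge0// invr_ge0 !mulr_ge0// ltW.
rewrite big_split/= -!mulr_sumr big_split/= -mulr_sumr.
apply: (@le_trans _ _ (T / 2 * (2 * pi / r) + (2 * T)^-1 * (2 * pi * ((2 * L * r) ^+ 2 * r) + r ^+ 2 * (16 * pi * L ^+ 2 * r)))).
  apply: lerD; first by rewrite ler_wpM2l// divr_ge0// ltW.
  apply: ler_wpM2l; first by rewrite invr_ge0 mulr_ge0// ltW.
  apply: lerD; first exact: S0.
  by apply: ler_wpM2l; [exact: sqr_ge0|exact: S1].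
rewrite /T; apply: le_of_eq.
move: (pi : R) => p; field.
by rewrite !gt_eqF.
Qed.

End Atoms.

(** * The Cantor function and its primitive *)

Section Cantor.
Variable R : realType.

(** Convergence with an explicit rate: the intervals [u n - b n, u n + b n] are nested, and the
    supremum of their left ends lies in all of them. *)
Lemma limit_of_summable (u b : nat -> R) : (forall n, 0 <= b n) ->
  (forall n, `|u n.+1 - u n| <= b n - b n.+1) ->
  exists l, forall n, `|l - u n| <= b n.
Proof.
move=> b0 ub.
have lo n : u n - b n <= u n.+1 - b n.+1.
  by have := ler_norm (- (u n.+1 - u n)); rewrite normrN; have := ub n; lra.
have hi n : u n.+1 + b n.+1 <= u n + b n.
  by have := ler_norm (u n.+1 - u n); have := ub n; lra.
have loD n k : u n - b n <= u (k + n)%N - b (k + n)%N.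
  by elim: k => // k IH; rewrite addSn (le_trans IH)// lo.
have hiD n k : u (k + n)%N + b (k + n)%N <= u n + b n.
  by elim: k => // k IH; rewrite addSn (le_trans _ IH)// hi.
have lohi n m : u n - b n <= u m + b m.
  apply: (le_trans (loD n m)); rewrite addnC.
  by apply: (le_trans _ (hiD m n)); have := b0 (n + m)%N; lra.
pose S : set R := range (fun n => u n - b n).
have S0 : S !=set0 by exists (u 0%N - b 0%N), 0%N.
have Sub m : ubound S (u m + b m) by move=> _ [n _ <-]; exact: lohi.
exists (sup S) => n; rewrite ler_distl; apply/andP; split.
  apply: ub_le_sup; first by exists (u 0%N + b 0%N).
  by exists n.
by apply: ge_sup.
Qed.

Lemma geometric_small (q c e : R) : 0 <= q -> q < 1 -> 0 < e ->
  exists n, c * q ^+ n < e.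
Proof.
move=> q0 q1 e0.
have [c0|c0] := leP c 0.
  by exists 0%N; rewrite expr0 mulr1 (le_lt_trans c0).
have := @cvg_expr R q; rewrite ger0_norm// => /(_ q1)/cvgrPdist_lt/(_ (e / c)).
move=> /(_ (divr_gt0 e0 c0))[n _ /(_ n)/=]; rewrite leqnn => /(_ isT).
rewrite sub0r normrN ger0_norm ?exprn_ge0// => h.
by exists n; rewrite mulrC -ltr_pdivlMr.
Qed.

(** The device for passing to the limit: a defect bounded by every term of a geometric sequence is
    nonpositive. *)
Lemma le0_of_geometric (q c x : R) : 0 <= q -> q < 1 ->
  (forall n, x <= c * q ^+ n) -> x <= 0.
Proof.
move=> q0 q1 H; rewrite leNgt; apply/negP => x0.
have [n hn] := geometric_small c q0 q1 x0.
by have := H n; rewrite leNgt hn.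
Qed.

Implicit Types (s t : R).
Variable xi : R.
Hypotheses (xi0 : 0 < xi) (xi2 : 2 * xi < 1).
Ltac xlra := have := xi0; have := xi2; lra.

(** [sig1] and [sig2] are the inverses of the two contractions that generate the Cantor set. *)
Definition sig1 (t : R) := t / xi.
Definition sig2 (t : R) := (t - 1 + xi) / xi.

Lemma sig1_le0 t : t <= 0 -> sig1 t <= 0.
Proof. by move=> t0; rewrite /sig1 ler_pdivrMr// mul0r. Qed.
Lemma sig1_ge0 t : 0 <= t -> 0 <= sig1 t.
Proof. by move=> t0; rewrite /sig1 ler_pdivlMr// mul0r. Qed.
Lemma sig1_ge1 t : xi <= t -> 1 <= sig1 t.
Proof. by move=> t0; rewrite /sig1 ler_pdivlMr// mul1r. Qed.
Lemma sig1_le1 t : t <= xi -> sig1 t <= 1.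
Proof. by move=> t0; rewrite /sig1 ler_pdivrMr// mul1r. Qed.
Lemma sig2_le0 t : t <= 1 - xi -> sig2 t <= 0.
Proof. by move=> t0; rewrite /sig2 ler_pdivrMr// mul0r; xlra. Qed.
Lemma sig2_ge0 t : 1 - xi <= t -> 0 <= sig2 t.
Proof. by move=> t0; rewrite /sig2 ler_pdivlMr// mul0r; xlra. Qed.
Lemma sig2_ge1 t : 1 <= t -> 1 <= sig2 t.
Proof. by move=> t0; rewrite /sig2 ler_pdivlMr// mul1r; xlra. Qed.
Lemma sig2_le1 t : t <= 1 -> sig2 t <= 1.
Proof. by move=> t0; rewrite /sig2 ler_pdivrMr// mul1r; xlra. Qed.
Lemma sig1B s t : sig1 s - sig1 t = (s - t) / xi.
Proof. by rewrite /sig1 -mulrBl. Qed.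
Lemma sig2B s t : sig2 s - sig2 t = (s - t) / xi.
Proof. by rewrite /sig2 -mulrBl; congr (_ / _); ring. Qed.

(** The self-similarity operator: q = 1/2 produces the Cantor function, q = xi / 2 its primitive,
    and q = 1 the cutoffs of the successive generations. *)
Definition refine (q : R) (f : R -> R) (t : R) := q * (f (sig1 t) + f (sig2 t)).
Definition framed (up f : R -> R) := (forall t, t <= 0 -> f t = 0) /\
  (forall t, 1 <= t -> f t = up t).

Lemma refine_framed (q : R) (up f : R -> R) :
  (forall t, 1 <= t -> q * (up (sig1 t) + up (sig2 t)) = up t) ->
  framed up f -> framed up (refine q f).
Proof.
move=> Hup [f0 f1]; split => t ht; rewrite /refine.
  have t1 : sig1 t <= 0 by exact: sig1_le0.
  have t2 : sig2 t <= 0 by apply: sig2_le0; xlra.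
  by rewrite (f0 _ t1) (f0 _ t2) addr0 mulr0.
have t1 : 1 <= sig1 t by apply: sig1_ge1; xlra.
by rewrite (f1 _ t1) (f1 _ (sig2_ge1 ht)) Hup.
Qed.

(** At every point one of the two branches lands outside (0, 1), where [f] and [g] agree by
    [framed]. So the factor is q and not 2 q, which would be no contraction for q = 1/2. *)
Lemma refine_contract (q B : R) (up f g : R -> R) : 0 <= q ->
  framed up f -> framed up g -> (forall t, `|f t - g t| <= B) ->
  forall t, `|refine q f t - refine q g t| <= q * B.
Proof.
move=> q0 [f0 f1] [g0 g1] fg t; rewrite /refine -mulrBr normrM ger0_norm//.
rewrite ler_wpM2l//; have [t1|t1] := leP t (1 - xi).
  by rewrite (f0 _ (sig2_le0 t1)) (g0 _ (sig2_le0 t1)) !addr0.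
have s1 : 1 <= sig1 t by apply: sig1_ge1; xlra.
by rewrite (f1 _ s1) (g1 _ s1) opprD addrACA subrr add0r.
Qed.

Lemma refine_fixpoint (q B : R) (up f0 : R -> R) : 0 < q -> q < 1 ->
  (forall t, 1 <= t -> q * (up (sig1 t) + up (sig2 t)) = up t) ->
  framed up f0 -> (forall t, `|refine q f0 t - f0 t| <= B) ->
  exists f, [/\ framed up f, forall t, f t = refine q f t &
    forall n t, `|f t - iter n (refine q) f0 t| <= B / (1 - q) * q ^+ n].
Proof.
move=> q0 q1 Hup fr0 HB.
pose F n := iter n (refine q) f0.
have B0 : 0 <= B by apply: le_trans (HB 0); exact: normr_ge0.
have frF n : framed up (F n) by elim: n => // n IH; exact: refine_framed.
have stepF n : forall t, `|F n.+1 t - F n t| <= B * q ^+ n.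
  elim: n => [|n IH] t; first by rewrite expr0 mulr1; exact: HB.
  rewrite exprS mulrCA; exact: (refine_contract (ltW q0) (frF n.+1) (frF n)).
have q1' : 0 < 1 - q by rewrite subr_gt0.
have lim t : exists l, forall n, `|l - F n t| <= B / (1 - q) * q ^+ n.
  apply: limit_of_summable => n.
    by apply: mulr_ge0; [exact: divr_ge0 (ltW q1')|exact: exprn_ge0 (ltW q0)].
  apply: (le_trans (stepF n t)); rewrite le_eqVlt exprS; apply/orP; left.
  by apply/eqP; field; rewrite gt_eqF.
have [f fP] := choice lim.
have frf : framed up f.
  have bnd t c : (forall n, F n t = c) -> f t = c.
    move=> Fc; apply/eqP; rewrite -subr_eq0 -normr_le0.
    apply: (@le0_of_geometric q (B / (1 - q)) _ (ltW q0) q1) => n.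
    by rewrite -(Fc n).
  split => t ht; apply: bnd => n; first exact: (frF n).1.
  exact: (frF n).2.
exists f; split => //; last by move=> n t; exact: fP.
move=> t; apply/eqP; rewrite -subr_eq0 -normr_le0.
apply: (@le0_of_geometric q (2 * q * (B / (1 - q))) _ (ltW q0) q1) => n.
have -> : f t - refine q f t = (f t - F n.+1 t) + (F n.+1 t - refine q f t) by ring.
apply: (le_trans (ler_normD _ _)).
have h1 := fP t n.+1.
have fFn s : `|F n s - f s| <= B / (1 - q) * q ^+ n by rewrite distrC.
have h2 := refine_contract (ltW q0) (frF n) frf fFn t.
apply: (le_trans (lerD h1 h2)); rewrite exprS le_eqVlt; apply/orP; left.
by apply/eqP; ring.
Qed.

Section Functions.
Variable alpha : R.
Hypotheses (al0 : 0 < alpha) (xia : 2 * xi `^ alpha = 1).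

Lemma exists_cantor : exists C : R -> R,
  [/\ framed (fun=> 1) C, forall t, C t = refine 2^-1 C t & forall t, `|C t| <= 1].
Proof.
pose C0 (t : R) : R := (0 < t)%R%:R.
have C01 t : `|C0 t| <= 1 by rewrite /C0; case: (0 < t)%R; rewrite ?normr1 ?normr0.
have half0 : 0 < 2^-1 :> R by rewrite invr_gt0.
have half1 : 2^-1 < 1 :> R by rewrite invf_lt1// ltr1n.
have ref1 f : (forall t, `|f t| <= 1) -> forall t, `|refine 2^-1 f t| <= 1.
  move=> f1 t; rewrite /refine normrM (gtr0_norm half0).
  have := ler_normD (f (sig1 t)) (f (sig2 t)).
  have := f1 (sig1 t); have := f1 (sig2 t); xlra.
have [|||f [frf fE fP]] := @refine_fixpoint 2^-1 2 (fun=> 1) C0 half0 half1.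
- by move=> t _; field.
- split => t ht; rewrite /C0; first by rewrite ltNge ht.
  by rewrite (lt_le_trans _ ht).
- move=> t; apply: (le_trans (ler_normB _ _)).
  by have := ref1 _ C01 t; have := C01 t; xlra.
exists f; split => // t.
have itn n s : `|iter n (refine 2^-1) C0 s| <= 1.
  by elim: n s => // n IH s; exact: ref1.
rewrite -subr_le0; apply: (@le0_of_geometric 2^-1 (2 / (1 - 2^-1)) _ (ltW half0) half1) => n.
have := fP n t; have := itn n t.
have := ler_normD (f t - iter n (refine 2^-1) C0 t) (iter n (refine 2^-1) C0 t).
rewrite subrK; xlra.
Qed.

(** [K] is built as a fixed point rather than by integrating [C]; [taylor_K] provides the link.
    Lipschitz constant 1 survives refinement, as two branches stretched by 1 / xi are weighted by xi
    / 2. The frame t - 1/2 reflects the mean 1/2 of the Cantor function. *)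
Lemma exists_cantor_primitive : exists K : R -> R,
  [/\ framed (fun t => t - 2^-1) K, forall t, K t = refine (xi / 2) K t &
     forall s t, `|K s - K t| <= `|s - t|].
Proof.
pose K0 (t : R) : R := Num.max 0 (t - 2^-1).
have K0L s t : `|K0 s - K0 t| <= `|s - t|.
  rewrite /K0; wlog st : s t / s <= t.
    move=> W; have [/W//|/ltW/W] := leP s t.
    by rewrite distrC (distrC t).
  rewrite (ler0_norm (_ : s - t <= 0)) ?subr_le0// ler_norml.
  by case: (leP 0 (s - 2^-1)); case: (leP 0 (t - 2^-1)); xlra.
have q0 : 0 < xi / 2 by rewrite divr_gt0.
have q1 : xi / 2 < 1 by xlra.
have refL f : (forall s t, `|f s - f t| <= `|s - t|) ->
    forall s t, `|refine (xi / 2) f s - refine (xi / 2) f t| <= `|s - t|.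
  move=> fL s t; rewrite /refine -mulrBr normrM (gtr0_norm q0) opprD addrACA.
  apply: (@le_trans _ _ (xi / 2 * (`|s - t| / xi + `|s - t| / xi))).
    rewrite ler_pM2l// (le_trans (ler_normD _ _))//.
    apply: lerD; apply: (le_trans (fL _ _)).
      by rewrite sig1B normrM normfV (gtr0_norm xi0).
    by rewrite sig2B normrM normfV (gtr0_norm xi0).
  by apply: le_of_eq; field; rewrite gt_eqF.
have Hup t : 1 <= t -> xi / 2 * (sig1 t - 2^-1 + (sig2 t - 2^-1)) = t - 2^-1.
  by move=> _; rewrite /sig1 /sig2; field; rewrite gt_eqF.
have fr0 : framed (fun t => t - 2^-1) K0.
  by split => t ht; rewrite /K0; case: (leP 0 (t - 2^-1)); xlra.
have [|f [frf fE fP]] := @refine_fixpoint (xi / 2) 2 _ K0 q0 q1 Hup fr0.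
  move=> t; have fr1 := refine_framed Hup fr0.
  have [t0|t0] := leP t 0; first by rewrite (fr1.1 _ t0) (fr0.1 _ t0) subrr normr0.
  have [t1|t1] := leP 1 t; first by rewrite (fr1.2 _ t1) (fr0.2 _ t1) subrr normr0.
  have := refL _ K0L t 0; have := K0L t 0.
  rewrite (fr1.1 _ (lexx 0)) (fr0.1 _ (lexx 0)) !subr0 (gtr0_norm t0).
  by have := ler_normB (refine (xi / 2) K0 t) (K0 t); xlra.
exists f; split => // s t.
have itn n : forall s t, `|iter n (refine (xi / 2)) K0 s - iter n (refine (xi / 2)) K0 t| <= `|s - t|.
  by elim: n => // n IH; exact: refL.
rewrite -subr_le0; apply: (@le0_of_geometric (xi / 2) (2 * (2 / (1 - (xi / 2)))) _ (ltW q0) q1) => n.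
have := fP n s; have := fP n t; have := itn n s t.
set Ks := iter _ _ _ s; set Kt := iter _ _ _ t.
have -> : f s - f t = (f s - Ks) + (Ks - Kt) - (f t - Kt) by ring.
have := ler_normB ((f s - Ks) + (Ks - Kt)) (f t - Kt).
have := ler_normD (f s - Ks) (Ks - Kt); xlra.
Qed.

Variables (C K : R -> R).
Hypotheses (frC : framed (fun=> 1) C) (CE : forall t, C t = refine 2^-1 C t)
  (C1 : forall t, `|C t| <= 1).
Hypotheses (frK : framed (fun t => t - 2^-1) K) (KE : forall t, K t = refine (xi / 2) K t)
  (K1 : forall s t, `|K s - K t| <= `|s - t|).

Lemma K_left t : t <= 1 - xi -> K t = xi / 2 * K (sig1 t).
Proof. by move=> t1; rewrite KE /refine (frK.1 _ (sig2_le0 t1)) addr0. Qed.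

Lemma K_right t : xi <= t -> K t = xi / 2 * (sig1 t - 2^-1 + K (sig2 t)).
Proof. by move=> t1; rewrite KE /refine (frK.2 _ (sig1_ge1 t1)). Qed.

Lemma C_left t : t <= 1 - xi -> C t = 2^-1 * C (sig1 t).
Proof. by move=> t1; rewrite CE /refine (frC.1 _ (sig2_le0 t1)) addr0. Qed.

Lemma C_right t : xi <= t -> C t = 2^-1 * (1 + C (sig2 t)).
Proof. by move=> t1; rewrite CE /refine (frC.2 _ (sig1_ge1 t1)). Qed.

Lemma K_gap t : xi <= t <= 1 - xi -> K t = t / 2 - xi / 4.
Proof.
move=> /andP[t1 t2]; rewrite K_right// (frK.1 _ (sig2_le0 t2)) /sig1.
by field; rewrite gt_eqF.
Qed.

(** Chosen so that for points at least the gap length [1 - 2 * xi] apart the trivial bound 2 |t - s|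
    is already enough. *)
Definition taylor_cst : R := 2 * (1 - 2 * xi) `^ (- alpha).

Lemma taylor_far s t : 1 - 2 * xi <= `|t - s| ->
  `|K t - K s - C s * (t - s)| <= taylor_cst * `|t - s| `^ (1 + alpha).
Proof.
set d := 1 - 2 * xi => dts.
have d0 : 0 < d by rewrite /d; xlra.
have ts0 : 0 < `|t - s| by rewrite (lt_le_trans d0).
apply: (@le_trans _ _ (2 * `|t - s|)).
  apply: (le_trans (ler_normB _ _)); rewrite normrM.
  have h1 := K1 t s.
  have : `|C s| * `|t - s| <= 1 * `|t - s| by apply: ler_wpM2r.
  xlra.
rewrite /taylor_cst -mulrA ler_pM2l//.
rewrite powRD; last by apply/implyP => _; rewrite gt_eqF.
rewrite (powRr1 (ltW ts0)) [leRHS]mulrCA; apply: ler_peMr; first exact: ltW.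
rewrite powRN mulrC ler_pdivlMr ?powR_gt0// mul1r.
by apply: (ge0_ler_powR (ltW al0)) => //; rewrite nnegrE ltW.
Qed.

(** Since xi / 2 = xi^(1 + alpha), the remainder bound scales exactly as [K] does, so that no
    constant is lost in magnification. *)
Lemma scale_taylor (x : R) : 0 <= x ->
  xi / 2 * (x / xi) `^ (1 + alpha) = x `^ (1 + alpha).
Proof.
move=> x0; rewrite powRM// ?invr_ge0 ?(ltW xi0)//.
have -> : xi^-1 `^ (1 + alpha) = 2 / xi.
  rewrite -[in LHS]powR_inv1 ?(ltW xi0)// -powRrM mulN1r powRN powRD; last by apply/implyP => _; rewrite gt_eqF.
  rewrite powRr1 ?ltW// invfM.
  have a0 : xi `^ alpha != 0 by rewrite gt_eqF// powR_gt0.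
  have -> : (xi `^ alpha)^-1 = 2 by apply: (mulIf a0); rewrite mulVf// xia.
  by rewrite mulrC.
by field; rewrite gt_eqF.
Qed.

(** Two points closer than the gap length are both at most 1 - xi or both at least xi. There one
    branch describes [K] and [C] up to affine terms, and the remainder is a rescaled remainder at
    the magnified points. *)
Lemma taylor_step s t :
  (`|sig1 t - sig1 s| = `|t - s| / xi -> forall u v, `|v - u| = `|t - s| / xi ->
    `|K v - K u - C u * (v - u)| <= taylor_cst * `|v - u| `^ (1 + alpha)) ->
  `|K t - K s - C s * (t - s)| <= taylor_cst * `|t - s| `^ (1 + alpha).
Proof.
have e1 : `|sig1 t - sig1 s| = `|t - s| / xi.
  by rewrite sig1B normrM normfV (gtr0_norm xi0).
have e2 : `|sig2 t - sig2 s| = `|t - s| / xi.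
  by rewrite sig2B normrM normfV (gtr0_norm xi0).
have q0 : 0 < xi / 2 by rewrite divr_gt0.
have xin : xi != 0 by rewrite gt_eqF.
move=> /(_ e1) IH.
have fin D u v : `|v - u| = `|t - s| / xi ->
    D = xi / 2 * (K v - K u - C u * (v - u)) ->
    `|D| <= taylor_cst * `|t - s| `^ (1 + alpha).
  move=> e ->; rewrite normrM (gtr0_norm q0).
  apply: (@le_trans _ _ (xi / 2 * (taylor_cst * `|v - u| `^ (1 + alpha)))).
    by rewrite ler_pM2l// IH.
  by rewrite e mulrCA scale_taylor.
have [far|near] := leP (1 - 2 * xi) `|t - s|; first exact: taylor_far.
have := near; rewrite ltr_norml => /andP[n1 n2].
have [/andP[s1 t1]|] := boolP ((s <= 1 - xi) && (t <= 1 - xi)).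
  apply: (fin _ (sig1 s) (sig1 t)) => //.
  by rewrite (K_left s1) (K_left t1) (C_left s1) sig1B; field.
rewrite negb_and -!ltNge => st.
have [s1 t1] : xi <= s /\ xi <= t by case/orP: st => ?; split; xlra.
apply: (fin _ (sig2 s) (sig2 t)) => //.
by rewrite (K_right s1) (K_right t1) (C_right s1) sig2B /sig1; field.
Qed.

(** Each magnification stretches the distance by 1 / xi, so distinct points become far apart after
    finitely many steps, and [taylor_far] applies. *)
Lemma taylor_K s t :
  `|K t - K s - C s * (t - s)| <= taylor_cst * `|t - s| `^ (1 + alpha).
Proof.
have d0 : 0 < 1 - 2 * xi by xlra.
have key n : forall s t, (1 - 2 * xi) * xi ^+ n <= `|t - s| ->
    `|K t - K s - C s * (t - s)| <= taylor_cst * `|t - s| `^ (1 + alpha).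
  elim: n => [|n IH] {}s {}t; first by rewrite expr0 mulr1; exact: taylor_far.
  move=> ts; apply: taylor_step => _ u v uv; apply: IH.
  by rewrite uv ler_pdivlMr// -mulrA -exprSr.
have [->|ts] := eqVneq t s.
  by rewrite !subrr mulr0 subrr normr0 mulr_ge0// ?powR_ge0// mulr_ge0// powR_ge0.
have ts0 : 0 < `|t - s| by rewrite normr_gt0 subr_eq0.
have xi1 : xi < 1 by xlra.
have [n hn] := geometric_small (1 - 2 * xi) (ltW xi0) xi1 ts0.
by apply: (key n); exact: ltW.
Qed.

(** Density of the affine stretches: the property, stable under sums, that lets a further pulse be
    inserted inside any prescribed interval. *)
Definition somewhere_affine (f : R -> R) := forall c d, c < d ->
  exists c' d', [/\ c <= c', c' < d', d' <= d &
    exists a b, forall t, c' <= t <= d' -> f t = a * t + b].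

(** Induction on the magnifications needed to reach length 2. An interval that long leaves [0, 1],
    where [K] is affine. A shorter one leaves [0, 1], lies in an end interval of length xi and is
    magnified, or meets the gap. *)
Lemma K_somewhere_affine : somewhere_affine K.
Proof.
have key n : forall c d, 2 * xi ^+ n <= d - c -> exists c' d', [/\ c <= c', c' < d', d' <= d &
    exists a b, forall t, c' <= t <= d' -> K t = a * t + b].
  elim: n => [|n IH] c d ncd.
    have [c0|c0] := ltP c 0.
      exists c, (Num.min d 0); rewrite expr0 mulr1 in ncd.
      split => //; [by rewrite lt_min c0 andbT; xlra|by rewrite ge_min lexx|].
      exists 0, 0 => t; rewrite le_min => /andP[_ /andP[_ t0]].
      by rewrite frK.1// mul0r addr0.
    rewrite expr0 mulr1 in ncd; exists (Num.max c 1), d; split => //.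
    - by rewrite le_max lexx.
    - by rewrite gt_max; apply/andP; split; xlra.
    - exists 1, (- 2^-1) => t; rewrite ge_max => /andP[/andP[_ t1] _].
      by rewrite frK.2// mul1r.
  have cd : c < d by have := exprn_gt0 n.+1 xi0; xlra.
  have [c0|c0] := ltP c 0.
    exists c, (Num.min d 0).
    split => //; [by rewrite lt_min c0 andbT; xlra|by rewrite ge_min lexx|].
    exists 0, 0 => t; rewrite le_min => /andP[_ /andP[_ t0]].
    by rewrite frK.1// mul0r addr0.
  have [d1|d1] := ltP 1 d.
    exists (Num.max c 1), d; split => //.
    - by rewrite le_max lexx.
    - by rewrite gt_max; apply/andP; split; xlra.
    - exists 1, (- 2^-1) => t; rewrite ge_max => /andP[/andP[_ t1] _].
      by rewrite frK.2// mul1r.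
  have sc : 2 * xi ^+ n <= (d - c) / xi by rewrite ler_pdivlMr// -mulrA -exprSr.
  have [dx|dx] := leP d xi.
    have [|c' [d' [cc cd' dd [a [b Kab]]]]] := IH (sig1 c) (sig1 d); first by rewrite sig1B.
    exists (xi * c'), (xi * d'); split.
    - by move: cc; rewrite /sig1 ler_pdivrMr// mulrC.
    - by rewrite ltr_pM2l.
    - by move: dd; rewrite /sig1 ler_pdivlMr// mulrC.
    - exists (a / 2), (xi / 2 * b) => t /andP[t1 t2].
      have t2' : t <= 1 - xi.
        by move: dd t2; rewrite /sig1 ler_pdivlMr// => dd t2; xlra.
      rewrite K_left// Kab; first by rewrite /sig1; field; rewrite gt_eqF.
      by rewrite /sig1 ler_pdivlMr// ler_pdivrMr// mulrC t1 mulrC.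
  have [cx|cx] := leP (1 - xi) c.
    have [|c' [d' [cc cd' dd [a [b Kab]]]]] := IH (sig2 c) (sig2 d); first by rewrite sig2B.
    exists (xi * c' + 1 - xi), (xi * d' + 1 - xi).
    have lec : c <= xi * c' + 1 - xi.
      by move: cc; rewrite /sig2 ler_pdivrMr//; xlra.
    split.
    - exact: lec.
    - by rewrite ltrD2r ltrD2r ltr_pM2l.
    - by move: dd; rewrite /sig2 ler_pdivlMr//; xlra.
    - exists (2^-1 + a / 2), (xi / 2 * (b - 2^-1) - a / 2 * (1 - xi)) => t /andP[t1 t2].
      have t1' : xi <= t by xlra.
      rewrite K_right// Kab; first by rewrite /sig1 /sig2; field; rewrite gt_eqF.
      by rewrite /sig2 ler_pdivlMr// ler_pdivrMr//; apply/andP; split; xlra.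
  exists (Num.max c xi), (Num.min d (1 - xi)); split.
  - by rewrite le_max lexx.
  - by rewrite gt_max !lt_min cd dx cx/=; xlra.
  - by rewrite ge_min lexx.
  - exists 2^-1, (- (xi / 4)) => t; rewrite ge_max le_min => /andP[/andP[_ t1] /andP[_ t2]].
    by rewrite K_gap ?t1// mulrC.
move=> c d cd.
have xi1 : xi < 1 by xlra.
have dc : 0 < d - c by rewrite subr_gt0.
have [n hn] := geometric_small 2 (ltW xi0) xi1 dc.
by apply: (key n); exact: ltW.
Qed.

End Functions.
End Cantor.

(* [C] is the Cantor function of the set with ratio [xi], extended by 0 and 1,
   and [K] its primitive vanishing on the left; [2 * xi `^ alpha = 1] makes [C]
   Hoelder of exponent [alpha]. *)
Record cantor_spec (R : realType) (alpha xi : R) (C K : R -> R) : Prop := CantorSpec {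
  cs_alpha_gt0 : 0 < alpha;
  cs_xi_gt0 : 0 < xi;
  cs_xi_lt : 2 * xi < 1;
  cs_xi_alpha : 2 * xi `^ alpha = 1;
  cs_C_framed : framed (fun=> 1) C;
  cs_C_refine : forall t, C t = refine xi 2^-1 C t;
  cs_C_le1 : forall t, `|C t| <= 1;
  cs_K_framed : framed (fun t => t - 2^-1) K;
  cs_K_refine : forall t, K t = refine xi (xi / 2) K t;
  cs_K_lipschitz : forall s t, `|K s - K t| <= `|s - t|
}.

(** With xi = 2^(-1 / alpha), the condition alpha < 1 is what makes xi < 1/2, that is, leaves a
    central gap. *)
Lemma exists_cantor_spec (R : realType) (alpha : R) : 0 < alpha -> alpha < 1 ->
  exists xi C K, cantor_spec alpha xi C K.
Proof.
move=> al0 al1; pose xi : R := 2 `^ (- alpha^-1).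
have xi0 : 0 < xi by apply: powR_gt0.
have xi2 : 2 * xi < 1.
  rewrite /xi powRN -ltr_pdivlMl// mulr1 ltf_pV2 ?posrE ?powR_gt0//.
  rewrite -[ltLHS]powRr1// /powR gt_eqF// ltr_expR ltr_pM2r ?ln_gt0 ?ltr1n//.
  by rewrite invf_gt1.
have xia : 2 * xi `^ alpha = 1.
  by rewrite /xi -powRrM mulNr mulVf ?gt_eqF// powRN powRr1// divff.
have [C [C1 C2 C3]] := exists_cantor xi0 xi2.
have [K [K1 K2 K3]] := exists_cantor_primitive xi0 xi2.
by exists xi, C, K; split.
Qed.

(** * The phase *)

Section Profile.
Variable R : realType.
Implicit Types (s t : R).

(** Membership in C^(1, alpha) expressed by the remainder alone, which passes to sums, rescalings
    and pointwise limits. [taylor_bound_is_derive] and [taylor_holder] recover the derivative and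
    its Hoelder continuity. *)
Definition taylor_bound (alpha H : R) (f df : R -> R) := forall s t,
  `|f t - f s - df s * (t - s)| <= H * `|t - s| `^ (1 + alpha).

Lemma taylor_boundD (alpha H1 H2 : R) f1 df1 f2 df2 :
  taylor_bound alpha H1 f1 df1 -> taylor_bound alpha H2 f2 df2 ->
  taylor_bound alpha (H1 + H2) (fun t => f1 t + f2 t) (fun t => df1 t + df2 t).
Proof.
move=> h1 h2 s t; rewrite [leRHS]mulrDl.
have := lerD (h1 s t) (h2 s t); apply: le_trans.
have := ler_normD (f1 t - f1 s - df1 s * (t - s)) (f2 t - f2 s - df2 s * (t - s)).
apply: le_trans.
by apply: le_of_eq; congr `|_|; ring.
Qed.

Lemma taylor_bound_shift (alpha H c : R) f df : taylor_bound alpha H f df ->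
  taylor_bound alpha H (fun t => f (t - c)) (fun t => df (t - c)).
Proof.
move=> h s t; have -> : t - s = (t - c) - (s - c) by ring.
exact: h.
Qed.

Lemma taylor_boundZ (alpha H c : R) f df : taylor_bound alpha H f df ->
  taylor_bound alpha (`|c| * H) (fun t => c * f t) (fun t => c * df t).
Proof.
move=> h s t; have -> : c * f t - c * f s - c * df s * (t - s) = c * (f t - f s - df s * (t - s)) by ring.
by rewrite normrM -mulrA ler_wpM2l.
Qed.

Lemma somewhere_affineD (f g : R -> R) : somewhere_affine f -> somewhere_affine g ->
  somewhere_affine (fun t => f t + g t).
Proof.
move=> af ag c d cd.
have [c1 [d1 [h1 h2 h3 [a1 [b1 e1]]]]] := af c d cd.
have [c2 [d2 [k1 k2 k3 [a2 [b2 e2]]]]] := ag c1 d1 h2.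
exists c2, d2; split => //; [exact: le_trans h1 k1|exact: le_trans k3 h3|].
exists (a1 + a2), (b1 + b2) => t /andP[t1 t2].
rewrite e2 ?t1// e1; first by ring.
by rewrite (le_trans k1 t1) (le_trans t2 k3).
Qed.

Lemma somewhere_affine_rescale (f : R -> R) (c r l : R) : 0 < l -> somewhere_affine f ->
  somewhere_affine (fun t => c * f ((t - r) / l)).
Proof.
move=> l0 af p q pq.
have [|c1 [d1 [h1 h2 h3 [a1 [b1 e1]]]]] := af ((p - r) / l) ((q - r) / l).
  by rewrite ltr_pM2r ?invr_gt0// ltrD2r.
exists (l * c1 + r), (l * d1 + r); split.
- by move: h1; rewrite ler_pdivrMr//; lra.
- by rewrite ltrD2r ltr_pM2l.
- by move: h3; rewrite ler_pdivlMr//; lra.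
- exists (c * a1 / l), (c * (b1 - a1 * r / l)) => t /andP[t1 t2].
  rewrite e1; first by field; rewrite gt_eqF.
  by rewrite ler_pdivlMr// ler_pdivrMr//; apply/andP; split; lra.
Qed.

(** In [pf_values], the slopes at 0 and 1 show that a pulse breaks affinity, and those at 1 and 3
    give slopes of both signs for the lower bound. *)
Record profile_spec (alpha H : R) (psi dpsi : R -> R) : Prop := ProfileSpec {
  pf_H_ge0 : 0 <= H;
  pf_taylor : taylor_bound alpha H psi dpsi;
  pf_supp : forall t, ~ (0 <= t <= 5) -> psi t = 0 /\ dpsi t = 0;
  pf_lipschitz : forall s t, `|psi s - psi t| <= 4 * `|s - t|;
  pf_bound : forall t, `|psi t| <= 20;
  pf_dbound : forall t, `|dpsi t| <= 4;
  pf_affine : somewhere_affine psi;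
  pf_values : [/\ dpsi 0 = 0, dpsi 1 = 1 & dpsi 3 = -1];
  pf_end : psi 0 = 0 /\ psi 5 = 0
}.

(* The combination cancels the affine tail of the primitive, which leaves a
   function supported in [0, 5]. *)
Definition triple (f : R -> R) (t : R) := f t - 2 * f (t - 2) + f (t - 4).

(** The weights 1, -2, 1 at equally spaced points form a second difference, which annihilates affine
    functions. *)
Lemma triple_framed_support (C : R -> R) (b : R) (up : R -> R) :
  (forall t, up t = b * t + up 0) -> framed up C -> forall t, ~ (0 < t < 5) -> triple C t = 0.
Proof.
move=> upE [C0 C1] t /negP; rewrite negb_and -!leNgt => /orP[t0|t5]; rewrite /triple.
  by rewrite !C0; [ring|lra|lra|lra].
rewrite !C1; [|lra|lra|lra].
by rewrite upE (upE (t - 2)) (upE (t - 4)); ring.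
Qed.

Lemma cantor_profile (alpha xi : R) (C K : R -> R) : cantor_spec alpha xi C K ->
  exists H, profile_spec alpha H (triple K) (triple C).
Proof.
case=> al0 xi0 xi2 xia frC CE C1 frK KE K1.
have H0 : 0 <= taylor_cst xi alpha by rewrite mulr_ge0// powR_ge0.
have tK : taylor_bound alpha (taylor_cst xi alpha) K C.
  by move=> s t; exact: (taylor_K xi0 xi2 al0 xia frC CE C1 frK KE K1).
have sC := @triple_framed_support C 0 (fun=> 1) (fun t => esym (etrans (congr1 (fun x => x + 1) (mul0r t)) (add0r 1))) frC.
have sK : forall t, ~ (0 < t < 5) -> triple K t = 0.
  by apply: (@triple_framed_support K 1 (fun t => t - 2^-1)) => // t; ring.
have LK s t : `|triple K s - triple K t| <= 4 * `|s - t|.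
  have := K1 s t; have := K1 (s - 2) (t - 2); have := K1 (s - 4) (t - 4).
  have -> : s - 4 - (t - 4) = s - t by ring.
  have -> : s - 2 - (t - 2) = s - t by ring.
  set A := _ - _; set B := K (s - 2) - _; set D := K s - _; set E := `|s - t| => a b d.
  have -> : triple K s - triple K t = D - 2 * B + A by rewrite /triple /D /B /A; ring.
  have := ler_normD (D - 2 * B) A; have := ler_normB D (2 * B).
  by rewrite normrM (ger0_norm (ler0n R 2)); lra.
have sub t : ~ (0 <= t <= 5) -> ~ (0 < t < 5).
  by move=> t05 /andP[/ltW t0 /ltW t5]; apply: t05; rewrite t0 t5.
exists (4 * taylor_cst xi alpha); split.
- by rewrite mulr_ge0.
- have := taylor_boundD (taylor_boundD tK (taylor_boundZ (-2) (taylor_bound_shift 2 tK)))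
    (taylor_bound_shift 4 tK).
  rewrite normrN (ger0_norm (ler0n R 2)).
  have -> : taylor_cst xi alpha + 2 * taylor_cst xi alpha + taylor_cst xi alpha = 4 * taylor_cst xi alpha by ring.
  by move=> h s t; have := h s t; rewrite /triple !mulNr.
- by move=> t /sub t05; rewrite sC// sK.
- exact: LK.
- move=> t; have [t05|/negP t05] := boolP (0 < t < 5); last by rewrite sK// normr0.
  have := LK t 0; rewrite (sK 0) ?ltxx// !subr0 => /le_trans; apply.
  by move/andP: t05 => [t0 t5]; rewrite gtr0_norm//; lra.
- move=> t; rewrite /triple.
  have := ler_normD (C t - 2 * C (t - 2)) (C (t - 4)); have := ler_normB (C t) (2 * C (t - 2)).
  rewrite normrM (ger0_norm (ler0n R 2)).
  by have := C1 t; have := C1 (t - 2); have := C1 (t - 4); lra.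
- have aK := K_somewhere_affine xi0 xi2 frK KE.
  have a1 := somewhere_affine_rescale (-2) 2 ltr01 aK.
  have a2 := somewhere_affine_rescale 1 4 ltr01 aK.
  have := somewhere_affineD (somewhere_affineD aK a1) a2.
  congr somewhere_affine; apply/funext => t.
  by rewrite /triple !invr1 !mulr1 mul1r mulNr.
- split.
  + by rewrite sC// ltxx.
  + by rewrite /triple frC.2// (frC.1 (1 - 2)) ?(frC.1 (1 - 4)); [ring|lra|lra].
  + by rewrite /triple (frC.2 3) ?(frC.2 (3 - 2)) ?(frC.1 (3 - 4)); [ring|lra|lra|lra].
- by rewrite !sK ?ltxx// ?andbF.
Qed.

(** Height l^2 on length l makes the slope O(l) and its Hoelder seminorm O(l^(1 - alpha)), both
    summable along lacunary lengths. *)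
Definition pulse (psi : R -> R) (r l t : R) := l ^+ 2 * psi ((t - r) / l).
Definition dpulse (dpsi : R -> R) (r l t : R) := l * dpsi ((t - r) / l).

Definition partial (w : R -> R -> R -> R) (r l : nat -> R) (n : nat) (t : R) :=
  \sum_(j < n) w (r j) (l j) t.

(* Each pulse is inserted where the preceding partial sum is affine, and every
   subinterval of [0, 2 * pi] contains one: the sum is then affine on none of them. *)
Record placement (psi : R -> R) (r l : nat -> R) : Prop := Placement {
  pl_l0 : l 0%N <= 100^-1;
  pl_l_gt0 : forall n, 0 < l n;
  pl_l_step : forall n, l n.+1 <= l n / 100;
  pl_r_gt : forall n, l n < r n;
  pl_r_lt : forall n, r n + 6 * l n < 2 * pi;
  pl_affine : forall n, exists a b, forall t, r n <= t <= r n + 5 * l n ->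
    partial (pulse psi) r l n t = a * t + b;
  pl_dense : forall c d, 0 <= c -> c < d -> d <= 2 * pi ->
    exists n, c <= r n /\ r n + 5 * l n <= d
}.

(** Enumerates the rational intervals inside the period. Indices that code no such interval get the
    filler (1, 2), admissible since pi >= 2. *)
Lemma rational_targets : exists e : nat -> R * R,
  (forall n, 0 < (e n).1 /\ (e n).1 < (e n).2 /\ (e n).2 < 2 * pi) /\
  (forall c d, 0 <= c -> c < d -> d <= 2 * pi ->
     exists n, c <= (e n).1 /\ (e n).2 <= d).
Proof.
pose ok (x : rat * rat) := [&& (0 : R) < ratr x.1, (ratr x.1 : R) < ratr x.2 & ratr x.2 < 2 * pi :> R].
pose e (n : nat) : R * R := if unpickle n is Some x then
  if ok x then (ratr x.1, ratr x.2) else (1, 2) else (1, 2).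
exists e; split.
  have d : 0 < 1 :> R /\ 1 < 2 :> R /\ 2 < 2 * pi :> R.
    by have := @pi_ge2 R; move: (pi : R) => p p2; split; [|split]; lra.
  by move=> n; rewrite /e; case: unpickle => [x|//]; case: ifP => [/and3P[]|].
move=> c d c0 cd d2.
have [q1] := rat_in_itvoo cd; rewrite in_itv/= => /andP[cq1 q1d].
have [q2] := rat_in_itvoo q1d; rewrite in_itv/= => /andP[q12 q2d].
exists (pickle (q1, q2)); rewrite /e pickleK.
have -> : ok (q1, q2) by rewrite /ok/= (le_lt_trans c0 cq1) q12 (lt_le_trans q2d d2).
by rewrite /= !ltW.
Qed.

Lemma exists_placement (alpha H : R) (psi dpsi : R -> R) :
  profile_spec alpha H psi dpsi -> exists r l, placement psi r l.
Proof.
move=> pf.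
have [e [e1 e2]] := rational_targets.
(* Stated for all data, with the conditions as premises, so that choice yields one total function
   [G]; data that violate them get the dummy site (0, 0). *)
have ex (x : (R -> R) * R * (R * R)) : exists rl : R * R,
  somewhere_affine x.1.1 -> 0 < x.1.2 -> x.2.1 < x.2.2 ->
  [/\ 0 < rl.2, rl.2 <= x.1.2, x.2.1 + rl.2 <= rl.1, rl.1 + 6 * rl.2 <= x.2.2 &
     exists a b, forall t, rl.1 <= t <= rl.1 + 5 * rl.2 -> x.1.1 t = a * t + b].
  case: x => [[f L] [c d]] /=.
  have [af|?] := pselect (somewhere_affine f); last by exists (0, 0).
  have [L0|?] := ltP 0 L; last by exists (0, 0).
  have [cd|?] := ltP c d; last by exists (0, 0).
  have [c1 [d1 [h1 h2 h3 [a [b fab]]]]] := af c d cd.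
  (* One seventh is left free on the left, and the remaining six hold the five lengths of the pulse
     and a margin of one on the right. *)
  have dc : 0 < (d1 - c1) / 7 by rewrite divr_gt0// subr_gt0.
  pose m := Num.min L ((d1 - c1) / 7).
  have m7 : m <= (d1 - c1) / 7 by rewrite ge_min lexx orbT.
  exists (c1 + (d1 - c1) / 7, m) => _ _ _ /=; split.
  - by rewrite lt_min L0.
  - by rewrite ge_min lexx.
  - lra.
  - lra.
  - by exists a, b => t /andP[t1 t2]; apply: fab; apply/andP; split; lra.
have [G GP] := choice ex.
(* The state is the current partial sum together with the largest length allowed to the next
   pulse. *)
pose step (n : nat) (st : (R -> R) * R) := let rl := G (st, e n) in
  (fun t => st.1 t + pulse psi rl.1 rl.2 t, rl.2 / 100).
pose st := fix st n : (R -> R) * R := if n is m.+1 then step m (st m) else (fun=> 0, 100^-1).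
pose r n := (G (st n, e n)).1; pose l n := (G (st n, e n)).2.
have inv n : somewhere_affine (st n).1 /\ 0 < (st n).2.
  elim: n => [|n [af L0]] /=.
    split; last by rewrite invr_gt0.
    by move=> c d cd; exists c, d; split => //; exists 0, 0 => t _; ring.
  have [l0 _ _ _ _] := GP (st n, e n) af L0 (e1 n).2.1.
  split; last by rewrite divr_gt0.
  by apply: somewhere_affineD => //; exact: somewhere_affine_rescale (pf_affine pf).
have P n := GP (st n, e n) (inv n).1 (inv n).2 (e1 n).2.1.
have stE n : (st n).1 = partial (pulse psi) r l n.
  elim: n => [|n IH]; first by apply/funext => t; rewrite /partial big_ord0.
  by apply/funext => t; rewrite /partial big_ord_recr/= -/(partial _ r l n t) -IH.
exists r, l; split.
- by have [_ + _ _ _] := P 0%N.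
- by move=> n; have [] := P n.
- by move=> n; have [_ + _ _ _] := P n.+1.
- by move=> n; have [_ _ h _ _] := P n; have [e0 _] := e1 n; rewrite /r /l; lra.
- by move=> n; have [_ _ _ h _] := P n; exact: le_lt_trans h (e1 n).2.2.
- by move=> n; have [_ _ _ _ h] := P n; rewrite -stE.
- move=> c d c0 cd d2; have [n [cn dn]] := e2 c d c0 cd d2.
  by exists n; have [h0 _ h1 h2 _] := P n; rewrite /r /l; split; lra.
Qed.

End Profile.

(** * Convergence and regularity of the lacunary sum *)

Section Phase.
Variable R : realType.
Implicit Types (s t : R).

Lemma one_powR (x : R) : 1 `^ x = 1.
Proof. by rewrite powR1. Qed.

Lemma powR_exprn (x e : R) n : 0 <= x -> (x ^+ n) `^ e = (x `^ e) ^+ n.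
Proof. by move=> x0; rewrite -(powR_mulrn n x0) -(powR_mulrn n (powR_ge0 x e)) powRAC. Qed.

Lemma geometric_sum_le (x : R) n : 0 <= x -> x < 1 -> \sum_(j < n) x ^+ j <= (1 - x)^-1.
Proof.
move=> x0 x1; have x1' : 0 < 1 - x by rewrite subr_gt0.
rewrite -(ler_pM2l x1') divff ?gt_eqF//.
suff -> : (1 - x) * \sum_(j < n) x ^+ j = 1 - x ^+ n by rewrite gerBl exprn_ge0.
elim: n => [|n IH]; first by rewrite big_ord0 mulr0 expr0 subrr.
by rewrite big_ord_recr/= mulrDr IH exprS; ring.
Qed.

Lemma sum_powR_geometric (q beta : R) (l : nat -> R) : 0 < q -> q < 1 -> 0 < beta ->
  (forall n, 0 <= l n) -> l 0%N <= 1 -> (forall n, l n.+1 <= q * l n) ->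
  forall n, \sum_(j < n) l j `^ beta <= (1 - q `^ beta)^-1.
Proof.
move=> q0 q1 b0 l0 l01 lS n.
have lq j : l j `^ beta <= (q `^ beta) ^+ j.
  elim: j => [|j IH].
    by rewrite expr0 -(one_powR beta); apply: (ge0_ler_powR (ltW b0)); rewrite ?nnegrE.
  rewrite exprS; apply: (@le_trans _ _ ((q * l j) `^ beta)).
    by apply: (ge0_ler_powR (ltW b0)); rewrite ?nnegrE// mulr_ge0// ltW.
  by rewrite powRM ?(ltW q0)// ler_wpM2l// powR_ge0.
apply: le_trans (geometric_sum_le n (powR_ge0 _ _) _).
  by apply: ler_sum => j _; exact: lq.
by rewrite -(one_powR beta); apply: gt0_ltr_powR; rewrite ?nnegrE// ltW.
Qed.

(** A wrong slope would leave a remainder linear in h, too large for h^(1 + alpha). Only increments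
    to the right are used, because a stretch known to be affine may begin at [x]. *)
Lemma taylor_slope (alpha H : R) f df x a d : 0 < alpha -> 0 <= H ->
  taylor_bound alpha H f df -> 0 < d ->
  (forall h, 0 < h <= d -> f (x + h) = f x + a * h) -> df x = a.
Proof.
move=> al0 H0 tf d0 fa; apply/eqP; rewrite -subr_eq0 -normr_le0 leNgt; apply/negP => e0.
set e := `|df x - a| in e0.
(* Small enough that H * h^alpha < e. *)
pose h := Num.min d ((e / (2 * (H + 1))) `^ alpha^-1).
have H1 : 0 < H + 1 by rewrite ltr_wpDl.
have e1 : 0 < e / (2 * (H + 1)) by rewrite divr_gt0// mulr_gt0.
have h0 : 0 < h by rewrite lt_min d0 powR_gt0.
have ha : h `^ alpha <= e / (2 * (H + 1)).
  apply: (@le_trans _ _ (((e / (2 * (H + 1))) `^ alpha^-1) `^ alpha)).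
    apply: (ge0_ler_powR (ltW al0)); rewrite ?nnegrE ?powR_ge0 ?(ltW h0)//.
    by rewrite ge_min lexx orbT.
  by rewrite -powRrM mulVf ?gt_eqF// powRr1// ltW.
have := tf x (x + h); rewrite fa ?h0 ?ge_min ?lexx//.
have -> : f x + a * h - f x - df x * (x + h - x) = - (h * (df x - a)) by ring.
have -> : x + h - x = h by ring.
rewrite normrN normrM -/e (gtr0_norm h0).
rewrite powRD; last by apply/implyP => _; rewrite gt_eqF.
rewrite powRr1 ?(ltW h0)// mulrCA ler_pM2l// => eH.
have : e <= H * (e / (2 * (H + 1))) by rewrite (le_trans eH)// ler_wpM2l.
rewrite mulrA ler_pdivlMr ?mulr_gt0//; nra.
Qed.

Lemma pulse_taylor (alpha H : R) psi dpsi (r l : R) : 0 < l ->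
  taylor_bound alpha H psi dpsi ->
  taylor_bound alpha (H * l `^ (1 - alpha)) (pulse psi r l) (dpulse dpsi r l).
Proof.
move=> l0 tp s t; rewrite /pulse /dpulse.
have l2 : 0 < l ^+ 2 by rewrite exprn_gt0.
have -> : l ^+ 2 * psi ((t - r) / l) - l ^+ 2 * psi ((s - r) / l) - l * dpsi ((s - r) / l) * (t - s) =
  l ^+ 2 * (psi ((t - r) / l) - psi ((s - r) / l) - dpsi ((s - r) / l) * ((t - r) / l - (s - r) / l)).
  by field; rewrite gt_eqF.
rewrite normrM (gtr0_norm l2).
apply: (@le_trans _ _ (l ^+ 2 * (H * `|(t - r) / l - (s - r) / l| `^ (1 + alpha)))).
  by rewrite ler_pM2l.
have -> : (t - r) / l - (s - r) / l = (t - s) / l by field; rewrite gt_eqF.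
rewrite normrM normfV (gtr0_norm l0) powRM ?invr_ge0 ?(ltW l0)//.
apply: le_of_eq.
have -> : l `^ (1 - alpha) = l ^+ 2 * l^-1 `^ (1 + alpha).
  rewrite -powR_mulrn ?(ltW l0)// -[in RHS](powR_inv1 (ltW l0)) -powRrM -powRD.
    by congr (_ `^ _); ring.
  by apply/implyP => _; rewrite gt_eqF.
ring.
Qed.

(** [ph_zero] allows periodization by gluing translates. [ph_slopes] puts the whole interval [-s, s]
    in the range of the slope by continuity, which supplies the resonant frequencies. *)
Record phase_spec (alpha H : R) (psi : R -> R) (r l : nat -> R) (phi dphi : R -> R) : Prop :=
  PhaseSpec {
  ph_H_ge0 : 0 <= H;
  ph_taylor : taylor_bound alpha H phi dphi;
  ph_approx : forall n t, `|phi t - partial (pulse psi) r l n t| <= 40 * l n;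
  ph_lipschitz : forall s t, `|phi s - phi t| <= `|s - t|;
  ph_zero : forall t, (t <= 0) || (2 * pi <= t) -> phi t = 0;
  ph_not_affine : forall c d, 0 <= c -> c < d -> d <= 2 * pi ->
    ~ exists a b, forall t, c < t < d -> phi t = a * t + b;
  ph_slopes : exists s u v, [/\ 0 < s, 0 < u < v, v < 2 * pi, s <= dphi u & dphi v <= - s]
}.

Lemma partialS w r l n t :
  partial w r l n.+1 t = partial w r l n t + w (r n) (l n) t :> R.
Proof. by rewrite /partial big_ord_recr. Qed.

Lemma exists_phase (alpha H : R) psi dpsi r l : 0 < alpha -> alpha < 1 ->
  profile_spec alpha H psi dpsi -> placement psi r l ->
  exists H' phi dphi, phase_spec alpha H' psi r l phi dphi.
Proof.
move=> al0 al1 [H0 tp supp pL pb pdb _ [dp0 dp1 dp3] [p0 p5]] [l0 lp lS rp rl aff dense].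
pose q : R := 100^-1.
have q0 : 0 < q by rewrite invr_gt0.
have q1 : q < 1 by rewrite invf_lt1// ltr1n.
have qh : q = 100^-1 by [].
have lS' n : l n.+1 <= q * l n by rewrite mulrC; exact: lS.
have lle n : l n <= 100^-1.
  elim: n => // n IH; apply: (le_trans (lS n)); rewrite ler_pdivrMr//.
  by apply: (le_trans IH); rewrite ler_peMr// ler1n.
have l01 : l 0%N <= 1 by rewrite (le_trans l0)// invf_le1// ler1n.
pose f := partial (pulse psi) r l; pose df := partial (dpulse dpsi) r l.
(* The rate 2 c l n dominates the tail, since each length is at most half of the preceding one. *)
have lim (g : nat -> R) (c : R) : 0 <= c -> (forall n, `|g n.+1 - g n| <= c * l n) ->
    exists x, forall n, `|x - g n| <= 2 * c * l n.
  move=> c0 gc; apply: limit_of_summable => n; first by rewrite !mulr_ge0// ltW.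
  apply: (le_trans (gc n)); rewrite -mulrBr -mulrA [leRHS]mulrCA ler_wpM2l//.
  by have := lS n; have := lp n; lra.
have ex t : exists x, forall n, `|x - f n t| <= 40 * l n.
  have [|x xP] := lim (f ^~ t) 20 (ler0n _ 20); last by exists x => n; have := xP n; lra.
  move=> n; rewrite /f partialS addrAC subrr add0r /pulse normrM (ger0_norm (sqr_ge0 _)) expr2.
  have := pb ((t - r n) / l n) => /(ler_wpM2l (sqr_ge0 (l n))).
  rewrite expr2; have := lle n; have := lp n; nra.
have dex t : exists x, forall n, `|x - df n t| <= 8 * l n.
  have [|x xP] := lim (df ^~ t) 4 (ler0n _ 4); last by exists x => n; have := xP n; lra.
  move=> n; rewrite /df partialS addrAC subrr add0r /dpulse normrM (gtr0_norm (lp n)) mulrC.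
  by rewrite ler_pM2r.
have [phi phiP] := choice ex; have [dphi dphiP] := choice dex.
pose S := (1 - q `^ (1 - alpha))^-1.
have al1' : 0 < 1 - alpha by rewrite subr_gt0.
have Ssum n : \sum_(j < n) l j `^ (1 - alpha) <= S.
  by apply: sum_powR_geometric => // j; exact: ltW.
have S0 : 0 <= S by have := Ssum 0%N; rewrite big_ord0.
have tf n : taylor_bound alpha (H * \sum_(j < n) l j `^ (1 - alpha)) (f n) (df n).
  elim: n => [|n IH].
    move=> s t; rewrite /f /df /partial !big_ord0 mulr0 !mul0r !subrr; by rewrite normr0.
  rewrite big_ord_recr/= mulrDr => s t.
  by rewrite /f /df !partialS; exact: (taylor_boundD IH (pulse_taylor (r n) (lp n) tp)).
have tfS n : taylor_bound alpha (H * S) (f n) (df n).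
  move=> s t; apply: (le_trans (tf n s t)); rewrite ler_wpM2r ?powR_ge0// ler_wpM2l//.
have HS0 : 0 <= H * S by rewrite mulr_ge0.
have lq n : l n <= q ^+ n.
  elim: n => [|n IH]; first by rewrite expr0.
  by rewrite exprS (le_trans (lS' n))// ler_pM2l.
have tphi : taylor_bound alpha (H * S) phi dphi.
  move=> s t; rewrite -subr_le0.
  apply: (@le0_of_geometric _ q (80 + 8 * `|t - s|) _ (ltW q0) q1) => n.
  rewrite lerBlDl.
  have -> : phi t - phi s - dphi s * (t - s) = (f n t - f n s - df n s * (t - s)) +
     ((phi t - f n t) - (phi s - f n s) - (dphi s - df n s) * (t - s)) by ring.
  apply: (le_trans (ler_normD _ _)); apply: lerD; first exact: tfS.
  apply: (le_trans (ler_normB _ _)); rewrite normrM.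
  have h1 := ler_normB (phi t - f n t) (phi s - f n s).
  have h2 := phiP t n; have h3 := phiP s n; have h4 := lq n.
  have : `|dphi s - df n s| * `|t - s| <= 8 * q ^+ n * `|t - s|.
    by apply: ler_wpM2r => //; apply: (le_trans (dphiP s n)); rewrite ler_pM2l.
  rewrite mulrDl; lra.
(* The preceding partial sum is affine under the n-th pulse, so its slope is the same at the points
   0, 1 and 3 of the pulse. *)
have dfr n x : x = 1 \/ x = 3 -> df n (r n + x * l n) = df n (r n).
  have [a [b ab]] := aff n; have ln0 := lp n.
  move=> x13; have x0 : 0 <= x <= 4 by case: x13 => ->; lra.
  have slope y : 0 <= y <= 4 -> df n (r n + y * l n) = a.
    move=> /andP[y0 y4]; apply: (taylor_slope al0 HS0 (tfS n) ln0) => h /andP[h0 h1].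
    rewrite /f !ab; [ring| |].
      by apply/andP; split; nra.
    by apply/andP; split; nra.
  have e0 : df n (r n + 0 * l n) = a by apply: slope; apply/andP; split; lra.
  by rewrite (slope _ x0) -e0 mul0r addr0.
have dbr n x : dpulse dpsi (r n) (l n) (r n + x * l n) = l n * dpsi x.
  rewrite /dpulse; congr (_ * dpsi _); have ln0 := lp n; by field; rewrite gt_eqF.
(* All later pulses together change the slope by less than a tenth of what the n-th pulse
   contributes at its points 1 and 3. *)
have near n x : `|dphi x - (df n x + dpulse dpsi (r n) (l n) x)| <= 8 / 100 * l n.
  by rewrite -partialS; apply: (le_trans (dphiP x n.+1)); have := lS n; lra.
(* The n-th pulse has Lipschitz constant 4 l n <= 8 (l n - l n.+1), which telescopes; the total is
   at most 8 l 0 <= 8 / 100. *)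
have Lf n s t : `|f n s - f n t| <= 8 * (l 0%N - l n) * `|s - t|.
  elim: n => [|n IH]; first by rewrite /f /partial !big_ord0 !subrr normr0 mulr0 mul0r.
  rewrite /f !partialS -/(f n); have ln0 := lp n; have lSn := lS n.
  have -> : f n s + pulse psi (r n) (l n) s - (f n t + pulse psi (r n) (l n) t) =
    (f n s - f n t) + l n ^+ 2 * (psi ((s - r n) / l n) - psi ((t - r n) / l n)).
    by rewrite /pulse; ring.
  apply: (le_trans (ler_normD _ _)); rewrite normrM (ger0_norm (sqr_ge0 _)).
  have h : l n ^+ 2 * `|psi ((s - r n) / l n) - psi ((t - r n) / l n)| <= 4 * l n * `|s - t|.
    apply: (le_trans (ler_wpM2l (sqr_ge0 _) (pL _ _))).
    have -> : (s - r n) / l n - (t - r n) / l n = (s - t) / l n by field; rewrite gt_eqF.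
    rewrite normrM normfV (gtr0_norm ln0); apply: le_of_eq.
    by field; rewrite gt_eqF.
  apply: (le_trans (lerD IH h)); rewrite -mulrDl ler_wpM2r//; lra.
exists (H * S), phi, dphi; split => //.
- move=> s t; rewrite -subr_le0.
  apply: (@le0_of_geometric _ q 80 _ (ltW q0) q1) => n.
  have -> : phi s - phi t = (f n s - f n t) + ((phi s - f n s) - (phi t - f n t)) by ring.
  have h1 := ler_normD (f n s - f n t) ((phi s - f n s) - (phi t - f n t)).
  have h2 := ler_normB (phi s - f n s) (phi t - f n t).
  have h3 := phiP s n; have h4 := phiP t n; have h5 := lq n; have h6 := Lf n s t.
  have h7 : 8 * (l 0%N - l n) * `|s - t| <= 1 * `|s - t|.
    by rewrite ler_wpM2r//; have := lp n; have := l0; lra.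
  lra.
- move=> t t02; apply/eqP; rewrite -normr_le0.
  apply: (@le0_of_geometric _ q 40 _ (ltW q0) q1) => n.
  have -> : phi t = phi t - f n t; last by apply: (le_trans (phiP t n)); rewrite ler_pM2l.
  rewrite /f /partial big1 ?subr0// => j _; rewrite /pulse.
  have lj := lp j; have rj := rp j; have rlj := rl j.
  rewrite (supp _ _).1 ?mulr0// => /andP[h1 h2].
  move: h1 h2; rewrite ler_pdivlMr// ler_pdivrMr// mul0r => h1 h2.
  by case/orP: t02 => t02; lra.
- move=> c d c0 cd d2 [a [b ab]].
  (* The middle third: a pulse carried by [c', d'] lies in the open interval (c, d). If [phi] were
     affine there, its slopes at r n and r n + l n would agree, yet they differ by l n up to 16 /
     100 l n. *)
  pose c' := (2 * c + d) / 3; pose d' := (c + 2 * d) / 3.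
  have [|||n [rn rn']] := dense c' d'; rewrite /c' /d'; try lra.
  have ln0 := lp n.
  have slope y : 0 <= y <= 4 -> dphi (r n + y * l n) = a.
    move=> /andP[y0 y4]; apply: (taylor_slope al0 HS0 tphi ln0) => h /andP[h0 h1].
    rewrite !ab; [ring| |].
      by apply/andP; split; rewrite /c' /d' in rn rn'; nra.
    by apply/andP; split; rewrite /c' /d' in rn rn'; nra.
  have n1 := near n (r n + 1 * l n); have n2 := near n (r n + 0 * l n).
  have s1 : dphi (r n + 1 * l n) = a by apply: slope; apply/andP; split; lra.
  have s0 : dphi (r n + 0 * l n) = a by apply: slope; apply/andP; split; lra.
  move: n1 n2; rewrite !dbr s1 s0.
  rewrite dfr; last by left.
  rewrite dp0 dp1 mul0r addr0 mulr0 mulr1 addr0 => n1 n2.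
  have := ler_norm (a - (df n (r n) + l n)); have := ler_norm (- (a - (df n (r n) + l n))).
  have := ler_norm (a - df n (r n)); have := ler_norm (- (a - df n (r n))); rewrite !normrN; lra.
(* The first pulse alone has slopes l 0 and - l 0 at these points; half of them survives the later
   pulses. *)
- exists (l 0%N / 2), (r 0%N + 1 * l 0%N), (r 0%N + 3 * l 0%N).
  have ln0 := lp 0%N; have rn0 := rp 0%N; have rln := rl 0%N.
  have n1 := near 0%N (r 0%N + 1 * l 0%N); have n2 := near 0%N (r 0%N + 3 * l 0%N).
  move: n1 n2; rewrite !dbr dp1 dp3 /df /partial !big_ord0 !add0r mulr1 mulrN1 => n1 n2.
  split; [lra|apply/andP; split; lra|lra| |].
    by have := ler_norm (- (dphi (r 0%N + 1 * l 0%N) - l 0%N)); rewrite normrN; lra.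
  by have := ler_norm (dphi (r 0%N + 3 * l 0%N) + l 0%N); rewrite opprK in n2; lra.
Qed.

End Phase.

(** * Waves at the scales of the Cantor set *)

Section CisBounds.
Variable R : realType.

Lemma sin_le_id (y : R) : `|sin y| <= `|y|.
Proof.
have pos (z : R) : 0 < z -> `|sin z| <= z.
  move=> z0; have [c _] := MVT z0 (fun x _ => is_derive_sin x)
    (continuous_subspaceT (@continuous_sin R)).
  rewrite sin0 !subr0 => ->; rewrite normrM (gtr0_norm z0).
  by rewrite ler_piMl ?(ltW z0)// cos_max.
case: (ltrgtP y 0) => [y0|y0|->]; last by rewrite sin0 normr0.
  by rewrite (ltr0_norm y0) -normrN -sinN; apply: pos; rewrite oppr_gt0.
by rewrite (gtr0_norm y0); exact: pos.
Qed.

Lemma normc_cisB (x y : R) : normc (cis x - cis y) <= `|x - y|.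
Proof.
have -> : cis x - cis y = cis y * (cis (x - y) - 1).
  by rewrite mulrBr mulr1 -cisD; congr (cis _ - _); ring.
rewrite normcM normc_cis mul1r normc_cisB1.
have := sin_le_id ((x - y) / 2); rewrite normrM (ger0_norm (_ : 0 <= 2^-1)) ?invr_ge0//.
lra.
Qed.

Lemma one_sub_le_cos (y : R) : 1 - `|y| <= cos y.
Proof.
have := normc_cisB y 0; rewrite cis0 subr0 => /(le_trans (normc_ge_Re_norm _)).
by rewrite /= => h; have := ler_norm (- (cos y - 1)); rewrite normrN; lra.
Qed.

Lemma normc_amplitude (A B : R) (x y : R) :
  normc (A%:C * cis x - B%:C * cis y) <= `|A - B| + `|B| * `|x - y|.
Proof.
have -> : A%:C * cis x - B%:C * cis y = (A - B)%:C * cis x + B%:C * (cis x - cis y).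
  by rewrite rmorphB/=; ring.
apply: (le_trans (normcD _ _)); rewrite !normcM !normcC normc_cis mulr1 lerD2l.
by apply: ler_wpM2l => //; exact: normc_cisB.
Qed.

End CisBounds.

Section Levels.
Variable R : realType.
Implicit Types (s t r l x a : R).

(** The base interval enlarged by half its length on each side stays inside the period, and its
    length 2 l is at most 1, as [sum_atom_le] requires. *)
Definition room r l := [/\ 0 < l, l <= 2^-1, 0 < r - l / 2 & r + 3 / 2 * l < 2 * pi :> R].

Definition wave (K A : R -> R) x r l t : R[i] :=
  (A ((t - r) / l))%:C * cis (x * K ((t - r) / l)).

Definition core_supported (A : R -> R) := forall s, ~ (- 2^-1 <= s <= 3 / 2) -> A s = 0.

Definition lip_by (L : R) (A : R -> R) := forall s t, `|A s - A t| <= L * `|s - t|.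

Lemma core_rescale (A : R -> R) r l : 0 < l -> core_supported A ->
  forall t, ~ (r - l / 2 <= t <= r + 3 / 2 * l) -> A ((t - r) / l) = 0.
Proof.
move=> l0 sA t tn; apply: sA => /andP[h1 h2]; apply: tn.
by move: h1 h2; rewrite ler_pdivlMr// ler_pdivrMr// => h1 h2; apply/andP; split; lra.
Qed.

Lemma wave_supported K A x r l : 0 < l -> core_supported A ->
  supported (wave K A x r l) (r - l / 2) (r + 3 / 2 * l).
Proof. by move=> l0 sA t tn; rewrite /wave (core_rescale l0 sA tn) mul0r. Qed.

Lemma wave_clipschitz (L : R) K A x r l : 0 < l -> (forall s, `|A s| <= 1) ->
  lip_by L A -> lip_by 1 K ->
  clipschitz ((L + `|x|) / l) (wave K A x r l).
Proof.
move=> l0 A1 LA LK s t; apply: (le_trans (normc_amplitude _ _ _ _)).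
set u := (s - r) / l; set v := (t - r) / l.
have uv : `|u - v| = `|s - t| / l.
  rewrite -[in RHS](gtr0_norm l0) -normfV -normrM; congr `|_|.
  by rewrite /u /v; field; rewrite gt_eqF.
rewrite mulrAC -mulrA -uv mulrDl; apply: lerD; first exact: LA.
rewrite -mulrBr normrM; have := LK u v; rewrite mul1r => Kuv.
apply: (@le_trans _ _ (1 * (`|x| * `|K u - K v|))).
  by rewrite ler_wpM2r// mulr_ge0.
by rewrite mul1r ler_wpM2l.
Qed.

(** Uniformity in the real shift [a] makes the bound invariant under modulation by an affine phase;
    [lp_bound] below has the same form. *)
Definition l1_bound (B : R) (f : R -> R[i]) := forall (s : seq int) a, uniq s ->
  \sum_(k <- s) normc (fint f (k%:~R - a)) <= B.

(** The l1 norm of the coefficients is scale invariant: the Lipschitz constant L / l times the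
    length 2 l no longer involves l. *)
Lemma l1_bound_atom (L : R) f r l : room r l -> 0 < L -> clipschitz (L / l) f ->
  supported f (r - l / 2) (r + 3 / 2 * l) -> l1_bound (26 * pi * L) f.
Proof.
move=> [l0 l1 r0 r1] L0 Lf sf s a us.
have Ll : 0 < L / l by rewrite divr_gt0.
apply: (le_trans (@sum_atom_le R s f _ _ (2 * l) _ a us Lf sf _ _ _ _ _ _ Ll)); try lra.
apply: le_of_eq.
by move: (pi : R) => p; field; rewrite gt_eqF.
Qed.

Lemma l1_boundD B1 B2 f g : ccontinuous f -> ccontinuous g ->
  l1_bound B1 f -> l1_bound B2 g -> l1_bound (B1 + B2) (fun t => f t + g t).
Proof.
move=> cf cg bf bg s a us; apply: (le_trans _ (lerD (bf s a us) (bg s a us))).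
by rewrite -big_split; apply: ler_sum => k _; rewrite fintD// normcD.
Qed.

Lemma l1_bound_modulate B f p q : ccontinuous f ->
  l1_bound B f -> l1_bound B (fun t => cis (p * t + q) * f t).
Proof.
move=> cf bf s a us; apply: (le_trans _ (bf s (a + p) us)).
apply: le_of_eq; apply: eq_bigr => k _.
by rewrite normc_fint_modulate//; congr (normc (fint f _)); ring.
Qed.

Lemma lipschitz_comp (L : R) (A g : R -> R) : 0 <= L -> lip_by L A -> lip_by 1 g ->
  lip_by L (A \o g).
Proof.
move=> L0 LA Lg s t; apply: (le_trans (LA _ _)); rewrite ler_wpM2l//.
by have := Lg s t; rewrite mul1r.
Qed.

Lemma lipschitzB (L1 L2 : R) A B : lip_by L1 A -> lip_by L2 B ->
  lip_by (L1 + L2) (fun s => A s - B s).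
Proof.
move=> LA LB s t; rewrite mulrDl.
have -> : A s - B s - (A t - B t) = (A s - A t) - (B s - B t) by ring.
by apply: (le_trans (ler_normB _ _)); apply: lerD.
Qed.

Lemma lipschitz_minr (b : R) : lip_by 1 (fun s => Num.min s b).
Proof.
move=> s t; rewrite mul1r; wlog st : s t / s <= t.
  move=> W; have [/W//|/ltW/W] := leP s t.
  by rewrite distrC (distrC t).
rewrite (ler0_norm (_ : s - t <= 0)) ?subr_le0// ler_norml.
by case: (leP s b); case: (leP t b); lra.
Qed.

Lemma lipschitz_maxr (b : R) : lip_by 1 (fun s => Num.max s b).
Proof.
move=> s t; rewrite mul1r; wlog st : s t / s <= t.
  move=> W; have [/W//|/ltW/W] := leP s t.
  by rewrite distrC (distrC t).
rewrite (ler0_norm (_ : s - t <= 0)) ?subr_le0// ler_norml.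
by case: (leP s b); case: (leP t b); lra.
Qed.

Lemma wave0_clipschitz (L : R) A r l : 0 < l -> lip_by L A ->
  clipschitz (L / l) (fun t => (A ((t - r) / l))%:C).
Proof.
move=> l0 LA s t.
have -> : (A ((s - r) / l))%:C - (A ((t - r) / l))%:C = (A ((s - r) / l) - A ((t - r) / l))%:C.
  by rewrite rmorphB.
rewrite normcC; apply: (le_trans (LA _ _)).
rewrite mulrAC -mulrA; apply: le_of_eq; congr (_ * _).
rewrite -[in RHS](gtr0_norm l0) -normfV -normrM; congr `|_|.
by field; rewrite gt_eqF.
Qed.

(** Where the phase is affine the wave is a modulated bump, so the bound does not depend on the
    slope, however large. *)
Lemma l1_bound_affine_wave (L : R) (A : R -> R) r l p q : room r l -> 0 < L ->
  lip_by L A -> core_supported A ->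
  l1_bound (26 * pi * L) (fun t => cis (p * t + q) * (A ((t - r) / l))%:C).
Proof.
move=> rm L0 LA sA; have [l0 _ _ _] := rm.
have Lw := wave0_clipschitz r l0 LA.
apply: l1_bound_modulate; first exact: clipschitz_ccontinuous Lw.
apply: (l1_bound_atom rm L0 Lw) => t tn.
by rewrite (core_rescale l0 sA tn).
Qed.

Section SelfSimilar.
Variables (alpha xi : R) (C K : R -> R).
Hypothesis cs : cantor_spec alpha xi C K.

Lemma room_left r l : room r l -> room r (xi * l).
Proof.
have x0 := cs_xi_gt0 cs; have x2 := cs_xi_lt cs.
by move=> [h1 h2 h3 h4]; split; [rewrite mulr_gt0|nra|nra|nra].
Qed.

Lemma room_right r l : room r l -> room (r + (1 - xi) * l) (xi * l).
Proof.
have x0 := cs_xi_gt0 cs; have x2 := cs_xi_lt cs.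
by move=> [h1 h2 h3 h4]; split; [rewrite mulr_gt0|nra|nra|nra].
Qed.

(** Half the central gap: cutoffs enlarged by this margin have refined copies that stay disjoint and
    away from the region described by the other branch of [K]. *)
Definition margin := (1 - 2 * xi) / 2.

Lemma margin_gt0 : 0 < margin.
Proof. by have x2 := cs_xi_lt cs; rewrite /margin; lra. Qed.

Lemma margin_lt : margin < 2^-1.
Proof. by have x2 := cs_xi_gt0 cs; rewrite /margin; lra. Qed.

Definition tent_supported (A : R -> R) := forall s, (s <= - margin) || (1 + margin <= s) -> A s = 0.

Lemma tent_core A : tent_supported A -> core_supported A.
Proof.
have m1 := margin_lt; move=> sA s sn; apply: sA.
have [//|s1] := leP s (- margin); have [//|s2] := leP (1 + margin) s.
by exfalso; apply: sn; apply/andP; split; lra.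
Qed.

Lemma refine_tent (A : R -> R) : tent_supported A -> tent_supported (refine xi 1 A).
Proof.
have x0 := cs_xi_gt0 cs; have x2 := cs_xi_lt cs; have m0 := margin_gt0.
move=> sA s hs; rewrite /refine !sA ?addr0 ?mulr0//.
- case/orP: hs => hs; apply/orP; [left|right].
    by rewrite /sig2 ler_pdivrMr//; nra.
  by rewrite /sig2 ler_pdivlMr//; nra.
- case/orP: hs => hs; apply/orP; [left|right].
    by rewrite /sig1 ler_pdivrMr//; nra.
  by rewrite /sig1 ler_pdivlMr//; nra.
Qed.

(** Each refined copy of the cutoff is supported where a single branch describes [K]. On the right
    copy the extra affine term of [K_right] becomes the modulation. *)
Lemma wave_refine (A : R -> R) x r l : 0 < l -> tent_supported A ->
  exists p q, forall t, wave K (refine xi 1 A) x r l t =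
    wave K A (x * (xi / 2)) r (xi * l) t +
    cis (p * t + q) * wave K A (x * (xi / 2)) (r + (1 - xi) * l) (xi * l) t.
Proof.
have x0 := cs_xi_gt0 cs; have x2 := cs_xi_lt cs; have m0 := margin_gt0.
have frK := cs_K_framed cs; have KE := cs_K_refine cs.
move=> l0 sA; exists (x / (2 * l)), (- (x * r / (2 * l)) - x * xi / 4) => t.
rewrite /wave; set s := (t - r) / l.
have e1 : (t - r) / (xi * l) = sig1 xi s.
  by rewrite /sig1 /s; field; rewrite !gt_eqF.
have e2 : (t - (r + (1 - xi) * l)) / (xi * l) = sig2 xi s.
  by rewrite /sig2 /s; field; rewrite !gt_eqF.
rewrite e1 e2 /refine mul1r rmorphD/= mulrDl; congr (_ + _).
  have [s1|s1] := leP s (1 - xi).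
    by congr (_ * cis _); rewrite (K_left x0 x2 frK KE s1)//; ring.
  rewrite sA ?mul0r//; apply/orP; right; rewrite /sig1 ler_pdivlMr// /margin; nra.
have [s1|s1] := leP xi s.
  rewrite mulrCA -cisD; congr (_ * cis _).
  rewrite (K_right x0 frK KE s1)// /sig1 /s; field.
  by rewrite !gt_eqF.
rewrite sA ?mul0r ?mulr0//; apply/orP; left; rewrite /sig2 ler_pdivrMr// /margin; nra.
Qed.

End SelfSimilar.
End Levels.

(** * Nested cutoffs along the generations of the Cantor set *)

Section Cutoffs.
Variable R : realType.
Implicit Types (s t r l x a : R).

Lemma continuous_affine_arg r l : continuous (fun t : R => (t - r) / l).
Proof.
move=> t; apply: cvgM; last exact: cvg_cst.
by apply: cvgB; [exact: cvg_id|exact: cvg_cst].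
Qed.

Lemma wave_ccontinuous (K A : R -> R) x r l : continuous K -> continuous A ->
  ccontinuous (wave K A x r l).
Proof.
move=> cK cA.
have comp (f : R -> R) : continuous f -> continuous (fun t => f ((t - r) / l)).
  move=> cf t; apply: (@continuous_comp _ _ _ (fun t => (t - r) / l) f).
    exact: continuous_affine_arg.
  exact: cf.
apply: ccontinuousM; first exact: ccontinuous_real (comp _ cA).
apply: ccontinuous_cis => t; apply: cvgM; [exact: cvg_cst|exact: comp].
Qed.

Lemma continuous_refine (xi q : R) (A : R -> R) : continuous A -> continuous (refine xi q A).
Proof.
move=> cA t; apply: cvgM; first exact: cvg_cst.
apply: cvgD.
  apply: (@continuous_comp _ _ _ (sig1 xi) A); last exact: cA.
  by apply: cvgM; [exact: cvg_id|exact: cvg_cst].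
apply: (@continuous_comp _ _ _ (sig2 xi) A); last exact: cA.
apply: cvgM; last exact: cvg_cst.
apply: cvgD; last exact: cvg_cst.
by apply: cvgB; [exact: cvg_id|exact: cvg_cst].
Qed.

Definition unit_dist s : R := Num.max (`|s - 2^-1| - 2^-1) 0.

Lemma unit_dist_in s : 0 <= s <= 1 -> unit_dist s = 0.
Proof.
move=> /andP[s0 s1]; apply/eqP; rewrite eq_maxr subr_le0 ler_norml.
by apply/andP; split; lra.
Qed.

Lemma unit_dist_left s : s <= 0 -> unit_dist s = - s.
Proof.
move=> s0; rewrite /unit_dist ler0_norm; last by lra.
by case: (leP (- (s - 2^-1) - 2^-1) 0); lra.
Qed.

Lemma unit_dist_right s : 1 <= s -> unit_dist s = s - 1.
Proof.
move=> s0; rewrite /unit_dist ger0_norm; last by lra.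
by case: (leP (s - 2^-1 - 2^-1) 0); lra.
Qed.

Lemma unit_dist_ge0 s : 0 <= unit_dist s.
Proof. by rewrite le_max lexx orbT. Qed.

Lemma lipschitz_unit_dist : lip_by 1 unit_dist.
Proof.
move=> s t; apply: (le_trans (lipschitz_maxr 0 _ _)); rewrite !mul1r.
have -> : `|s - 2^-1| - 2^-1 - (`|t - 2^-1| - 2^-1) = `|s - 2^-1| - `|t - 2^-1| by ring.
apply: (le_trans (ler_dist_dist _ _)); apply: le_of_eq.
by congr `|_|; ring.
Qed.

Variables (alpha xi : R) (C K : R -> R).
Hypothesis cs : cantor_spec alpha xi C K.

(* [chi m] is 1 on the [2 ^ m] intervals of generation [m] of the Cantor set, and
   [delta m = chi m - chi m.+1] lives around the gaps removed at the next step. *)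
Definition chi0 s : R := Num.max (1 - unit_dist s / margin xi) 0.
Definition chi m : R -> R := iter m (refine xi 1) chi0.
Definition delta0 s : R := chi0 s - chi 1 s.
Definition delta m : R -> R := iter m (refine xi 1) delta0.

Let m0 : 0 < margin xi := margin_gt0 cs.

Lemma chi0_ge0 s : 0 <= chi0 s.
Proof. by rewrite le_max lexx orbT. Qed.

Lemma chi0_le1 s : chi0 s <= 1.
Proof.
rewrite ge_max ler01 andbT gerBl divr_ge0 ?unit_dist_ge0// ltW//.
Qed.

Lemma chi0_tent : tent_supported xi chi0.
Proof.
have mm := m0; move=> s hs; apply/eqP; rewrite eq_maxr subr_le0 ler_pdivlMr// mul1r.
case/orP: hs => hs; first by rewrite unit_dist_left; lra.
by rewrite unit_dist_right; lra.
Qed.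

Lemma chi0_in s : 0 <= s <= 1 -> chi0 s = 1.
Proof.
move=> s01; rewrite /chi0 unit_dist_in// mul0r subr0.
by apply/eqP; rewrite eq_maxl ler01.
Qed.

Lemma chi0_anti s t : unit_dist s <= unit_dist t -> chi0 t <= chi0 s.
Proof.
move=> st; rewrite /chi0 ge_max le_max lerD2l lerN2.
by rewrite ler_pM2r ?st ?invr_gt0 ?le_max ?lexx ?orbT//; exact: m0.
Qed.

Lemma lipschitz_chi0 : lip_by (margin xi)^-1 chi0.
Proof.
move=> s t; apply: (le_trans (lipschitz_maxr 0 _ _)); rewrite mul1r.
have -> : 1 - unit_dist s / margin xi - (1 - unit_dist t / margin xi) =
  - ((margin xi)^-1 * (unit_dist s - unit_dist t)) by ring.
rewrite normrN normrM (ger0_norm (_ : 0 <= (margin xi)^-1)) ?invr_ge0 ?(ltW m0)//.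
rewrite ler_wpM2l ?invr_ge0 ?(ltW m0)//.
by have := lipschitz_unit_dist s t; rewrite mul1r.
Qed.

Lemma chi_tent m : tent_supported xi (chi m).
Proof. by elim: m => [|m IH]; [exact: chi0_tent|exact: (refine_tent cs)]. Qed.

Lemma delta0_tent : tent_supported xi delta0.
Proof. by move=> s hs; rewrite /delta0 chi0_tent// (@chi_tent 1)// subrr. Qed.

Lemma chi_ge0 m s : 0 <= chi m s.
Proof.
elim: m s => [|m IH] s; first exact: chi0_ge0.
by rewrite /chi iterS -/(chi m) /refine mul1r addr_ge0.
Qed.

Lemma deltaE m s : delta m s = chi m s - chi m.+1 s.
Proof.
elim: m s => [|m IH] s //.
rewrite /delta iterS /refine -/(delta m) !IH /chi !iterS /refine; ring.
Qed.

(** On either half of the line only one branch of the refined cutoff is nonzero, and magnification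
    never brings a point closer to the unit interval, so the cutoffs decrease; refinement preserves
    positivity. *)
Lemma delta_ge0 m s : 0 <= delta m s.
Proof.
have x0 := cs_xi_gt0 cs; have x2 := cs_xi_lt cs; have mm := m0.
elim: m s => [|m IH] s; last by rewrite /delta iterS -/(delta m) /refine mul1r addr_ge0.
rewrite subr_ge0 /chi /= /refine mul1r.
have [s2|s2] := leP s 2^-1.
  rewrite [X in _ + X](_ : _ = 0) ?addr0; last first.
    by apply: chi0_tent; apply/orP; left; rewrite /sig2 ler_pdivrMr// /margin; nra.
  apply: chi0_anti; have [s0|s0] := leP s 0.
    rewrite !unit_dist_left ?(sig1_le0 x0)// /sig1 lerN2 ler_pdivrMr//; nra.
  by rewrite (@unit_dist_in s) ?unit_dist_ge0//; apply/andP; split; lra.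
rewrite [X in X + _](_ : _ = 0) ?add0r; last first.
  by apply: chi0_tent; apply/orP; right; rewrite /sig1 ler_pdivlMr// /margin; nra.
apply: chi0_anti; have [s0|s0] := leP 1 s.
  rewrite !unit_dist_right ?(sig2_ge1 x0)// /sig2 lerBrDr ler_pdivlMr//; nra.
by rewrite (@unit_dist_in s) ?unit_dist_ge0//; apply/andP; split; lra.
Qed.

Lemma chi_le1 m s : chi m s <= 1.
Proof.
elim: m => [|m IH]; first exact: chi0_le1.
by apply: (le_trans _ IH); have := delta_ge0 m s; rewrite deltaE subr_ge0.
Qed.

Lemma delta_le_chi m s : delta m s <= chi m s.
Proof. by rewrite deltaE gerBl chi_ge0. Qed.

Lemma lipschitz_refine (L : R) (A : R -> R) : lip_by L A ->
  lip_by (2 * (L / xi)) (refine xi 1 A).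
Proof.
have x0 := cs_xi_gt0 cs.
move=> LA s t; rewrite /refine !mul1r.
have -> : A (sig1 xi s) + A (sig2 xi s) - (A (sig1 xi t) + A (sig2 xi t)) =
  (A (sig1 xi s) - A (sig1 xi t)) + (A (sig2 xi s) - A (sig2 xi t)) by ring.
have -> : 2 * (L / xi) * `|s - t| = L * `|(s - t) / xi| + L * `|(s - t) / xi|.
  by rewrite normrM normfV (gtr0_norm x0); ring.
apply: (le_trans (ler_normD _ _)); apply: lerD; apply: (le_trans (LA _ _)).
  by rewrite sig1B.
by rewrite sig2B.
Qed.

Definition delta_lip := (margin xi)^-1 + 2 * ((margin xi)^-1 / xi).

Lemma delta_lip_gt0 : 0 < delta_lip.
Proof.
have x0 := cs_xi_gt0 cs; have mm := m0.
by rewrite addr_gt0// ?mulr_gt0// ?invr_gt0//.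
Qed.

Lemma lipschitz_delta0 : lip_by delta_lip delta0.
Proof.
exact: lipschitzB lipschitz_chi0 (lipschitz_refine lipschitz_chi0).
Qed.

Lemma continuous_chi m : continuous (chi m).
Proof.
elim: m => [|m IH]; first exact: lipschitz_continuous lipschitz_chi0.
exact: continuous_refine.
Qed.

Lemma continuous_delta m : continuous (delta m).
Proof.
elim: m => [|m IH]; first exact: lipschitz_continuous lipschitz_delta0.
exact: continuous_refine.
Qed.

Lemma continuous_K : continuous K.
Proof.
apply: (@lipschitz_continuous _ 1) => s t; rewrite mul1r; exact: (cs_K_lipschitz cs).
Qed.

(** There are 2^m intervals of length xi^m * l, each enlarged to at most twice its length. *)
Lemma rint_chi_le m r l : room r l ->
  rint (fun t => chi m ((t - r) / l)) <= 2 * (2 * xi) ^+ m * l.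
Proof.
have x0 := cs_xi_gt0 cs.
have comp k c d : continuous (fun t : R => chi k ((t - c) / d)).
  move=> t; apply: (@continuous_comp _ _ _ (fun t => (t - c) / d) (chi k)).
    exact: continuous_affine_arg.
  exact: continuous_chi.
elim: m r l => [|m IH] r l rm; have [l0 l1 r0 r1] := rm.
  have -> : 2 * (2 * xi) ^+ 0 * l = 1 * (r + 3 / 2 * l - (r - l / 2)) by rewrite expr0; field.
  apply: rint_support_le; [exact: comp|lra|lra|lra| |].
    by apply: core_rescale => //; apply: (tent_core cs); exact: (chi_tent 0).
  by move=> t; exact: chi_le1.
rewrite (@eq_rint _ _ (fun t => chi m ((t - r) / (xi * l)) +
    chi m ((t - (r + (1 - xi) * l)) / (xi * l)))); last first.
  move=> t; rewrite /chi iterS -/(chi m) /refine mul1r.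
  congr (chi m _ + chi m _); rewrite /sig1 /sig2; field; by rewrite !gt_eqF.
rewrite rintD; [|exact: comp|exact: comp].
have := IH _ _ (room_left cs rm); have := IH _ _ (room_right cs rm).
by rewrite exprS; lra.
Qed.

(** Bessel's inequality sees only the modulus, so the bound measures the support and ignores the
    phase. *)
Lemma wave_l2 m (A : R -> R) x r l (s : seq int) a : room r l -> continuous A ->
  (forall y, 0 <= A y <= chi m y) -> uniq s ->
  \sum_(k <- s) normc (fint (wave K A x r l) (k%:~R - a)) ^+ 2 <=
  4 * pi * ((2 * xi) ^+ m * l).
Proof.
move=> rm cA Achi us.
have cw := @wave_ccontinuous K A x r l continuous_K cA.
apply: (le_trans (bessel a us cw)).
have -> : 4 * pi * ((2 * xi) ^+ m * l) = 2 * pi * (2 * (2 * xi) ^+ m * l) by ring.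
rewrite ler_pM2l ?twopi_gt0//; apply: le_trans (rint_chi_le m rm).
apply: le_rint; first exact: continuous_normc_sqr cw.
  move=> t; apply: (@continuous_comp _ _ _ (fun t => (t - r) / l) (chi m)).
    exact: continuous_affine_arg.
  exact: continuous_chi.
move=> t _; rewrite /wave normcM normc_cis mulr1 normcC.
have /andP[A0 A1] := Achi ((t - r) / l).
rewrite ger0_norm// expr2; apply: (le_trans _ A1).
by rewrite ler_piMl// (le_trans A1)// chi_le1.
Qed.

(** Each refinement doubles the number of pieces and replaces the frequency x by x * (xi / 2).
    Neither position nor length enters the base bound, so it applies to every piece. *)
Lemma level_l1 (A0 : R -> R) (B : R -> R) : tent_supported xi A0 -> continuous A0 ->
  (forall x r l, room r l -> l1_bound (B x) (wave K A0 x r l)) ->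
  forall m x r l, room r l ->
    l1_bound (2 ^+ m * B (x * (xi / 2) ^+ m)) (wave K (iter m (refine xi 1) A0) x r l).
Proof.
move=> sA cA HB m; have cK := continuous_K.
have it k : tent_supported xi (iter k (refine xi 1) A0) /\ continuous (iter k (refine xi 1) A0).
  elim: k => // k [t1 t2]; split; first exact: (refine_tent cs).
  exact: continuous_refine.
elim: m => [|m IH] x r l rm; first by rewrite !expr0 mul1r mulr1; exact: HB.
have [l0 _ _ _] := rm.
have [p [q pq]] := wave_refine cs x r l0 (it m).1.
rewrite iterS (_ : wave _ _ _ _ _ = fun t => wave K (iter m (refine xi 1) A0) (x * (xi / 2)) r (xi * l) t +
    cis (p * t + q) * wave K (iter m (refine xi 1) A0) (x * (xi / 2)) (r + (1 - xi) * l) (xi * l) t); last first.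
  exact/funext.
have -> : 2 ^+ m.+1 * B (x * (xi / 2) ^+ m.+1) =
  2 ^+ m * B (x * (xi / 2) * (xi / 2) ^+ m) + 2 ^+ m * B (x * (xi / 2) * (xi / 2) ^+ m).
  by rewrite -mulrA -exprS exprS; ring.
have c1 y u v : ccontinuous (wave K (iter m (refine xi 1) A0) y u v).
  exact: wave_ccontinuous (it m).2.
apply: l1_boundD; first exact: c1.
- apply: ccontinuousM (c1 _ _ _); apply: ccontinuous_cis; exact: continuous_linear.
- exact: IH (room_left cs rm).
- apply: l1_bound_modulate; first exact: c1.
  exact: IH (room_right cs rm).
Qed.

(** A crude bound, linear in x, meant for the last generation only, where the rescaled frequency is
    at most 1. *)
Lemma chi0_l1 x r l : room r l ->
  l1_bound (26 * pi * ((margin xi)^-1 + `|x|)) (wave K chi0 x r l).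
Proof.
move=> rm; have [l0 _ _ _] := rm; have mm := m0.
have Lp : 0 < (margin xi)^-1 + `|x| by rewrite ltr_wpDr// invr_gt0.
apply: (l1_bound_atom rm Lp).
  apply: wave_clipschitz => //; last first.
  - by move=> s t; rewrite mul1r; exact: (cs_K_lipschitz cs).
  - exact: lipschitz_chi0.
  - by move=> s; rewrite ger0_norm ?chi0_ge0// chi0_le1.
apply: wave_supported => //; apply: (tent_core cs); exact: chi0_tent.
Qed.

Lemma delta0_flat s : (0 <= s <= xi) || (1 - xi <= s <= 1) -> delta0 s = 0.
Proof.
have x0 := cs_xi_gt0 cs; have x2 := cs_xi_lt cs; have mm := m0.
move=> hs; rewrite /delta0 /chi /= /refine mul1r chi0_in; last first.
  by case/orP: hs => /andP[h1 h2]; apply/andP; split; lra.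
case/orP: hs => /andP[h1 h2].
  rewrite chi0_in ?(sig1_ge0 x0) ?(sig1_le1 x0)// chi0_tent ?addr0 ?subrr//.
  by apply/orP; left; rewrite /sig2 ler_pdivrMr// /margin; nra.
rewrite (@chi0_in (sig2 _ _)) ?(sig2_ge0 x0) ?(sig2_le1 x0)// chi0_tent ?add0r ?subrr//.
by apply/orP; right; rewrite /sig1 ler_pdivlMr// /margin; nra.
Qed.

(* On the three intervals carrying [delta0] the phase [K] is affine. *)
Lemma delta0_l1 x r l : room r l -> l1_bound (78 * pi * delta_lip) (wave K delta0 x r l).
Proof.
have x0 := cs_xi_gt0 cs; have x2 := cs_xi_lt cs; have mm := m0.
have frK := cs_K_framed cs; have KE := cs_K_refine cs.
move=> rm; have [l0 _ _ _] := rm; have L0 := delta_lip_gt0.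
have d0 : delta0 0 = 0 by apply: delta0_flat; rewrite lexx (ltW x0).
have d1 : delta0 1 = 0 by apply: delta0_flat; apply/orP; right; rewrite lexx andbT; lra.
have dx : delta0 xi = 0 by apply: delta0_flat; rewrite lexx (ltW x0).
have dx' : delta0 (1 - xi) = 0 by apply: delta0_flat; apply/orP; right; rewrite lexx/=; lra.
(* Clamping the argument splits [delta0] into its left, middle and right parts without increasing
   the Lipschitz constant; the parts match because [delta0] vanishes at 0, xi, 1 - xi and 1. *)
pose AL s := delta0 (Num.min s 0).
pose AM s := delta0 (Num.min (Num.max s xi) (1 - xi)).
pose AR s := delta0 (Num.max s 1).
have LL : lip_by delta_lip AL.
  exact: lipschitz_comp (ltW L0) lipschitz_delta0 (lipschitz_minr 0).
have LM : lip_by delta_lip AM.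
  apply: (lipschitz_comp (ltW L0) lipschitz_delta0).
  exact: (lipschitz_comp ler01 (lipschitz_minr (1 - xi)) (lipschitz_maxr xi)).
have LR : lip_by delta_lip AR.
  exact: lipschitz_comp (ltW L0) lipschitz_delta0 (lipschitz_maxr 1).
have tL : tent_supported xi AL.
  move=> s hs; rewrite /AL; case: (leP s 0) => s0; last by [].
  by apply: delta0_tent; apply/orP; left; case/orP: hs; lra.
have tR : tent_supported xi AR.
  move=> s hs; rewrite /AR; case: (leP s 1) => s0; first by [].
  by apply: delta0_tent; apply/orP; right; case/orP: hs; lra.
have tM : tent_supported xi AM.
  move=> s hs; rewrite /AM; case: (leP s xi) => s0.
    by case: (leP xi (1 - xi)) => //; lra.
  by case: (leP s (1 - xi)) => s1; [case/orP: hs; lra|].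
have bL := l1_bound_affine_wave 0 0 rm L0 LL (tent_core cs tL).
have bM := l1_bound_affine_wave (x / (2 * l)) (- (x * r / (2 * l)) - x * xi / 4) rm L0 LM (tent_core cs tM).
have bR := l1_bound_affine_wave (x / l) (- (x * r / l) - x / 2) rm L0 LR (tent_core cs tR).
have cc A p q : lip_by delta_lip A ->
    ccontinuous (fun t : R => cis (p * t + q) * (A ((t - r) / l))%:C).
  move=> LA; apply: ccontinuousM; first exact: ccontinuous_cis (@continuous_linear _ _ _).
  exact: clipschitz_ccontinuous (wave0_clipschitz r l0 LA).
have -> : 78 * pi * delta_lip = 26 * pi * delta_lip + 26 * pi * delta_lip + 26 * pi * delta_lip by ring.
rewrite (_ : wave _ _ _ _ _ = fun t =>
   (cis (0 * t + 0) * (AL ((t - r) / l))%:C +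
    cis (x / (2 * l) * t + (- (x * r / (2 * l)) - x * xi / 4)) * (AM ((t - r) / l))%:C) +
    cis (x / l * t + (- (x * r / l) - x / 2)) * (AR ((t - r) / l))%:C); last first.
  apply/funext => t; rewrite /wave; set s := (t - r) / l.
  have e1 : 0 * t + 0 = x * 0 by ring.
  have e2 : x / (2 * l) * t + (- (x * r / (2 * l)) - x * xi / 4) = x * (s / 2 - xi / 4).
    by rewrite /s; field; rewrite gt_eqF.
  have e3 : x / l * t + (- (x * r / l) - x / 2) = x * (s - 2^-1).
    by rewrite /s; field; rewrite gt_eqF.
  rewrite e1 e2 e3 /AL /AM /AR {e1 e2 e3}.
  have [s0|s0] := leP s 0.
    rewrite (_ : Num.max s xi = xi); last by apply/eqP; rewrite eq_maxr; lra.
    rewrite (_ : Num.min xi (1 - xi) = xi); last by apply/eqP; rewrite eq_minl; lra.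
    rewrite (_ : Num.max s 1 = 1); last by apply/eqP; rewrite eq_maxr; lra.
    by rewrite dx d1 !mulr0 !addr0 (frK.1 _ s0) mulrC mulr0.
  have [s1|s1] := leP 1 s.
    rewrite (_ : Num.max s xi = s); last by apply/eqP; rewrite eq_maxl; lra.
    rewrite (_ : Num.min s (1 - xi) = 1 - xi); last by apply/eqP; rewrite eq_minr; lra.
    by rewrite dx' d0 !mulr0 !add0r (frK.2 _ s1) mulrC.
  rewrite d0 d1 !mulr0 addr0 add0r.
  have [s2|s2] := leP s xi.
    rewrite (_ : Num.min xi (1 - xi) = xi); last by apply/eqP; rewrite eq_minl; lra.
    by rewrite dx delta0_flat ?mul0r ?mulr0// (ltW s0) s2.
  have [s3|s3] := leP s (1 - xi); last first.
    rewrite dx' delta0_flat ?mul0r ?mulr0//; apply/orP; right; lra.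
  by rewrite (K_gap x0 x2 frK KE) ?(ltW s2) ?s3// mulrC.
apply: l1_boundD; [apply: ccontinuousD; exact: cc|exact: cc| |exact: bR].
by apply: l1_boundD; [exact: cc|exact: cc|exact: bL|exact: bM].
Qed.

End Cutoffs.

(** * Interpolation between l1 and l2 over geometric scales *)

Section Mixing.
Variable R : realType.
Implicit Types (p xi l u v : R).

(** Uniform in [u]: terms count only after u * xi^m drops below 1, and from then on they decay
    geometrically. *)
Lemma geometric_low_sum xi beta N u : 0 < xi -> xi < 1 -> 0 < beta -> 0 < u ->
  \sum_(m < N) (if u * xi ^+ m < 1 then (u * xi ^+ m) `^ beta else 0) <= (1 - xi `^ beta)^-1.
Proof.
move=> x0 x1 b0; have q1 : xi `^ beta < 1.
  by rewrite -(one_powR beta); apply: gt0_ltr_powR; rewrite ?nnegrE// ltW.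
have powX m := powR_exprn beta m (ltW x0).
elim: N u => [|N IH] u u0; first by rewrite big_ord0 invr_ge0 subr_ge0 ltW.
have [u1|u1] := ltP u 1.
  apply: le_trans (geometric_sum_le N.+1 (powR_ge0 _ _) q1).
  apply: ler_sum => m _; rewrite -powX.
  have xm0 : 0 <= xi ^+ m by rewrite exprn_ge0// ltW.
  case: ifP => _; last exact: powR_ge0.
  apply: (ge0_ler_powR (ltW b0)); rewrite ?nnegrE//; first by rewrite mulr_ge0// ltW.
  by rewrite ler_piMl// ltW.
rewrite big_ord_recl/= expr0 mulr1 (le_gtF u1) add0r.
have ux : 0 < u * xi by rewrite mulr_gt0.
apply: le_trans (IH _ ux); apply: ler_sum => m _ /=.
by rewrite /bump/= add1n exprS mulrA.
Qed.

Lemma geometric_high_sum xi beta N u : 0 < xi -> xi < 1 -> 0 < beta -> 0 < u ->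
  \sum_(m < N) (if 1 <= u * xi ^+ m then (u * xi ^+ m) `^ (- beta) else 0) <= (1 - xi `^ beta)^-1.
Proof.
move=> x0 x1 b0 u0; have q1 : xi `^ beta < 1.
  by rewrite -(one_powR beta); apply: gt0_ltr_powR; rewrite ?nnegrE// ltW.
have powX m := powR_exprn beta m (ltW x0).
elim: N => [|N IH]; first by rewrite big_ord0 invr_ge0 subr_ge0 ltW.
have [u1|u1] := leP 1 (u * xi ^+ N); last first.
  by rewrite big_ord_recr/= (lt_geF u1) addr0.
apply: le_trans (geometric_sum_le N.+1 (powR_ge0 _ _) q1).
(* Read backwards from [N], where u * xi^N >= 1: each step back multiplies u * xi^m by 1 / xi, so
   the terms are dominated by a decaying geometric sequence. *)
rewrite [leRHS](reindex_inj rev_ord_inj)/=; apply: ler_sum => m _.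
have mN : (m <= N)%N by rewrite -ltnS.
rewrite subSS -powX.
have xm0 : 0 < xi ^+ m by rewrite exprn_gt0.
have y0 : 0 < u * xi ^+ m by rewrite mulr_gt0.
case: ifP => _; last exact: powR_ge0.
rewrite powRN -[leLHS]mul1r ler_pdivrMr ?powR_gt0// -powRM ?exprn_ge0 ?(ltW x0) ?(ltW y0)//.
rewrite -[leLHS](one_powR beta); apply: (ge0_ler_powR (ltW b0)); rewrite ?nnegrE//.
  by rewrite mulr_ge0// ?exprn_ge0// ltW.
by rewrite mulrCA -exprD subnK.
Qed.

Lemma powR_sum2 p u v : 0 <= p -> 0 <= u -> 0 <= v ->
  (u + v) `^ p <= 2 `^ p * (u `^ p + v `^ p).
Proof.
move=> p0 u0 v0; wlog uv : u v u0 v0 / u <= v.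
  move=> W; have [/W|/ltW/W] := leP u v; first exact.
  by rewrite addrC [X in 2 `^ p * X]addrC; apply.
apply: (@le_trans _ _ ((2 * v) `^ p)).
  by apply: (ge0_ler_powR p0); rewrite ?nnegrE ?addr_ge0 ?mulr_ge0//; lra.
by rewrite powRM// ler_wpM2l ?powR_ge0// lerDr powR_ge0.
Qed.

Definition mixing_cst p xi : R :=
  ((1 - xi `^ (1 - p / 2))^-1 + (1 - xi `^ (p - 1))^-1) `^ p.

(** Let V^p = W and y = l * xi^m / V. The two parts of the premise give a m <= V * y^(1 - p) and a m
    <= V * y^(1 - p / 2). The first is used for y >= 1, the second for y < 1; both sums are
    geometric, so the total is O(V). *)
Lemma sum_levels_le p xi l (a : nat -> R) N (W : R) : 1 < p -> p < 2 -> 0 < xi -> xi < 1 ->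
  0 < l -> 0 <= W -> (forall m, 0 <= a m) ->
  (forall m, (m < N)%N ->
     (l * xi ^+ m) `^ (p - 1) * a m + (l * xi ^+ m) `^ (p - 2) * a m ^+ 2 <= W) ->
  (\sum_(m < N) a m) `^ p <= mixing_cst p xi * W.
Proof.
move=> p1 p2 x0 x1 l0 W0 a0 aW.
have p0 : 0 < p by lra.
have v0 m : 0 < l * xi ^+ m by rewrite mulr_gt0// exprn_gt0.
have h1 m : (m < N)%N -> (l * xi ^+ m) `^ (p - 1) * a m <= W.
  move=> /aW; apply: le_trans; rewrite lerDl mulr_ge0 ?powR_ge0// sqr_ge0.
  by [].
have h2 m : (m < N)%N -> (l * xi ^+ m) `^ (p - 2) * a m ^+ 2 <= W.
  by move=> /aW; apply: le_trans; rewrite lerDr mulr_ge0 ?powR_ge0.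
move: W0; rewrite le_eqVlt => /orP[/eqP W0|Wp].
  rewrite -W0 mulr0 big1 ?powR0 ?gt_eqF// => m _.
  apply/eqP; rewrite eq_le a0 andbT -(ler_pM2l (powR_gt0 (p - 1) (v0 m))) mulr0 W0.
  exact: h1.
pose V := W `^ p^-1; have V0 : 0 < V by exact: powR_gt0.
have VW : V `^ p = W by rewrite /V -powRrM mulVf ?gt_eqF// powRr1 ?ltW.
pose u := l / V; have u0 : 0 < u by rewrite divr_gt0.
have b1 : 0 < 1 - p / 2 by lra.
have b2 : 0 < p - 1 by lra.
have key m : (m < N)%N -> a m <= V * ((if u * xi ^+ m < 1 then (u * xi ^+ m) `^ (1 - p / 2) else 0) +
    (if 1 <= u * xi ^+ m then (u * xi ^+ m) `^ (- (p - 1)) else 0)).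
  move=> mN; set y := u * xi ^+ m.
  have y0 : 0 < y by rewrite mulr_gt0// exprn_gt0.
  have vE : l * xi ^+ m = V * y by rewrite /y /u; field; rewrite gt_eqF.
  have Vn := gt_eqF V0.
  have VR r1 r2 : V `^ r1 * V `^ r2 = V `^ (r1 + r2).
    by rewrite powRD//; apply/implyP => _; rewrite Vn.
  case: (ltP y 1) => hy; rewrite ?addr0 ?add0r.
    have z0 : 0 <= V * y `^ (1 - p / 2) by rewrite mulr_ge0 ?powR_ge0 ?ltW.
    rewrite -ler_sqr ?nnegrE// -(ler_pM2l (powR_gt0 (p - 2) (v0 m))).
    apply: (le_trans (h2 m mN)); rewrite vE powRM ?(ltW V0) ?(ltW y0)// exprMn.
    have -> : y `^ (1 - p / 2) ^+ 2 = y `^ (2 - p).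
      by rewrite -powR_mulrn ?powR_ge0// -powRrM; congr (_ `^ _); field.
    rewrite mulrACA -powRD; last by apply/implyP => _; rewrite gt_eqF.
    have -> : p - 2 + (2 - p) = 0 by ring.
    rewrite powRr0 mulr1 -VW -powR_mulrn ?(ltW V0)// VR.
    by apply: le_of_eq; congr (_ `^ _); ring.
  rewrite -(ler_pM2l (powR_gt0 (p - 1) (v0 m))).
  apply: (le_trans (h1 m mN)); rewrite vE powRM ?(ltW V0) ?(ltW y0)//.
  rewrite mulrACA -powRD; last by apply/implyP => _; rewrite gt_eqF.
  rewrite subrr powRr0 mulr1 -VW -[X in _ <= _ * X]powRr1 ?(ltW V0)// VR.
  by apply: le_of_eq; congr (_ `^ _); ring.
pose c := (1 - xi `^ (1 - p / 2))^-1 + (1 - xi `^ (p - 1))^-1.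
have S : \sum_(m < N) a m <= V * c.
  apply: (@le_trans _ _ (\sum_(m < N) V * ((if u * xi ^+ m < 1 then (u * xi ^+ m) `^ (1 - p / 2) else 0) +
    (if 1 <= u * xi ^+ m then (u * xi ^+ m) `^ (- (p - 1)) else 0)))).
    by apply: ler_sum => m _; exact: key.
  rewrite -mulr_sumr ler_pM2l// big_split/=; apply: lerD.
    exact: geometric_low_sum.
  exact: geometric_high_sum.
have S0 : 0 <= \sum_(m < N) a m by apply: sumr_ge0.
have Vc : 0 <= V * c by exact: le_trans S0 S.
have c0 : 0 <= c by move: Vc; rewrite pmulr_rge0.
rewrite /mixing_cst -/c mulrC -[X in _ <= X * _]VW -powRM ?(ltW V0)//.
by apply: (ge0_ler_powR (ltW p0)); rewrite ?nnegrE.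
Qed.

(* Interpolation between l1 and l2 across geometric scales: no loss of a
   logarithm at the critical exponent, unlike the triangle inequality in lp. *)
Lemma sum_mixing_le (T : Type) (s : seq T) p xi l (a : nat -> T -> R) (A : nat -> R) N :
  1 < p -> p < 2 -> 0 < xi -> xi < 1 -> 0 < l ->
  (forall m k, 0 <= a m k) ->
  (forall m, (m < N)%N -> \sum_(k <- s) a m k <= A m) ->
  (forall m, (m < N)%N -> \sum_(k <- s) a m k ^+ 2 <= A m * (l * xi ^+ m)) ->
  \sum_(k <- s) (\sum_(m < N) a m k) `^ p <=
  mixing_cst p xi * \sum_(m < N) 2 * A m * (l * xi ^+ m) `^ (p - 1).
Proof.
move=> p1 p2 x0 x1 l0 a0 S1 S2.
have v0 m : 0 < l * xi ^+ m by rewrite mulr_gt0// exprn_gt0.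
pose w (m : nat) k := (l * xi ^+ m) `^ (p - 1) * a m k + (l * xi ^+ m) `^ (p - 2) * a m k ^+ 2.
have w0 m k : 0 <= w m k by rewrite addr_ge0// mulr_ge0 ?powR_ge0// sqr_ge0.
apply: (@le_trans _ _ (\sum_(k <- s) mixing_cst p xi * \sum_(m < N) w m k)).
  apply: ler_sum => k _; apply: (@sum_levels_le p xi l (a ^~ k)) => //.
    by apply: sumr_ge0.
  move=> m mN; rewrite -/(w m k) (bigD1 (Ordinal mN))//= lerDl.
  by apply: sumr_ge0.
rewrite -mulr_sumr ler_wpM2l ?powR_ge0// exchange_big/=; apply: ler_sum => m _.
rewrite /w big_split/= -!mulr_sumr.
have h1 : (l * xi ^+ m) `^ (p - 1) * \sum_(k <- s) a m k <= (l * xi ^+ m) `^ (p - 1) * A m.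
  by rewrite ler_wpM2l ?powR_ge0// S1.
have h2 : (l * xi ^+ m) `^ (p - 2) * \sum_(k <- s) a m k ^+ 2 <= (l * xi ^+ m) `^ (p - 1) * A m.
  apply: (@le_trans _ _ ((l * xi ^+ m) `^ (p - 2) * (A m * (l * xi ^+ m)))).
    by rewrite ler_wpM2l ?powR_ge0// S2.
  have -> : p - 1 = p - 2 + 1 by ring.
  rewrite (@powRD _ _ (p - 2) 1); last by apply/implyP => _; rewrite gt_eqF.
  by rewrite (powRr1 (ltW (v0 m))); apply: le_of_eq; ring.
apply: (le_trans (lerD h1 h2)); apply: le_of_eq; ring.
Qed.

End Mixing.

(** * Bounds for one pulse *)

Section PulseBounds.
Variable R : realType.
Implicit Types (s t r l x a p : R) (f g : R -> R[i]).

Definition lp_bound p (B : R) f := forall (s : seq int) a, uniq s ->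
  \sum_(k <- s) normc (fint f (k%:~R - a)) `^ p <= B.

Lemma lp_boundD p B1 B2 f g : 0 <= p -> ccontinuous f -> ccontinuous g ->
  lp_bound p B1 f -> lp_bound p B2 g ->
  lp_bound p (2 `^ p * (B1 + B2)) (fun t => f t + g t).
Proof.
move=> p0 cf cg bf bg s a us.
apply: (@le_trans _ _ (\sum_(k <- s) 2 `^ p * (normc (fint f (k%:~R - a)) `^ p + normc (fint g (k%:~R - a)) `^ p))).
  apply: ler_sum => k _; rewrite fintD//.
  apply: le_trans (powR_sum2 p0 (normc_ge0 _) (normc_ge0 _)).
  by apply: (ge0_ler_powR p0); rewrite ?nnegrE ?addr_ge0 ?normc_ge0// normcD.
rewrite -mulr_sumr ler_wpM2l ?powR_ge0// big_split/=.
by apply: lerD; [exact: bf|exact: bg].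
Qed.

Lemma lp_bound_modulate p B f c d : ccontinuous f ->
  lp_bound p B f -> lp_bound p B (fun t => cis (c * t + d) * f t).
Proof.
move=> cf bf s a us; apply: le_trans (bf s (a + c) us).
apply: le_of_eq; apply: eq_bigr => k _.
have -> : k%:~R - (a + c) = k%:~R - a - c by ring.
by rewrite normc_fint_modulate.
Qed.

Lemma lp_boundN p B f : ccontinuous f -> lp_bound p B f -> lp_bound p B (fun t => - f t).
Proof.
move=> cf bf s a us; apply: le_trans (bf s a us).
apply: le_of_eq; apply: eq_bigr => k _.
rewrite (_ : (fun t => - f t) = fun t => -1 * f t); last by apply/funext => t; rewrite mulN1r.
by rewrite (fintZ _ _ cf) mulN1r normcN.
Qed.

Lemma lp_bound_le p B1 B2 f : B1 <= B2 -> lp_bound p B1 f -> lp_bound p B2 f.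
Proof. by move=> B12 bf s a us; exact: le_trans (bf s a us) B12. Qed.

Lemma powR_interpolate p y : 1 <= p -> p <= 2 -> 0 <= y -> y `^ p <= y + y ^+ 2.
Proof.
move=> p1 p2; rewrite le_eqVlt => /orP[/eqP <-|y0].
  by rewrite powR0 ?addr_ge0 ?sqr_ge0// gt_eqF//; lra.
have [y1|y1] := leP y 1.
  apply: (@le_trans _ _ y); last by rewrite lerDl sqr_ge0.
  by apply: ge1r_powR => //; rewrite y0.
apply: (@le_trans _ _ (y ^+ 2)); last by rewrite lerDr ltW.
by rewrite -powR_mulrn ?(ltW y0)//; apply: ler_powR => //; exact: ltW.
Qed.

(** The case of one scale: y^p <= y + y^2 is applied to y = u / v, with v the ratio between the l2
    and l1 bounds. *)
Lemma sum_interpolate (T : Type) (s : seq T) (u : T -> R) (A v p : R) : 1 <= p -> p <= 2 -> 0 < v ->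
  (forall k, 0 <= u k) -> \sum_(k <- s) u k <= A -> \sum_(k <- s) u k ^+ 2 <= A * v ->
  \sum_(k <- s) u k `^ p <= 2 * A * v `^ (p - 1).
Proof.
move=> p1 p2 v0 u0 S1 S2.
have vp : v `^ p = v * v `^ (p - 1) by rewrite mulr_powRB1 ?(ltW v0)//; lra.
apply: (@le_trans _ _ (\sum_(k <- s) v `^ (p - 1) * (u k + v^-1 * u k ^+ 2))).
  apply: ler_sum => k _.
  have y0 : 0 <= u k / v by rewrite divr_ge0// ltW.
  have -> : u k = v * (u k / v) by field; rewrite gt_eqF.
  have := powR_interpolate p1 p2 y0; set y := u k / v in y0 * => yp.
  rewrite powRM ?(ltW v0)// vp.
  have -> : v `^ (p - 1) * (v * y + v^-1 * (v * y) ^+ 2) = v * v `^ (p - 1) * (y + y ^+ 2).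
    by field; rewrite gt_eqF.
  by rewrite ler_wpM2l// mulr_ge0 ?powR_ge0// ltW.
rewrite -mulr_sumr mulrC ler_wpM2r ?powR_ge0// big_split/= -mulr_sumr.
have -> : 2 * A = A + v^-1 * (A * v) by field; rewrite gt_eqF.
by apply: lerD => //; rewrite ler_wpM2l// invr_ge0 ltW.
Qed.

Variables (alpha xi : R) (C K : R -> R).
Hypothesis cs : cantor_spec alpha xi C K.

(** What interpolating the l1 bound 2^m and the squared l2 bound (2 * xi)^m gives for the
    generations 0 to n, with the powers of l factored out. *)
Definition levels p n : R := \sum_(m < n.+1) (2 * xi `^ (p - 1)) ^+ m.

Lemma levels_ge1 p n : 1 <= levels p n.
Proof.
rewrite /levels big_ord_recl expr0 lerDl sumr_ge0// => m _.
by rewrite exprn_ge0// mulr_ge0// powR_ge0.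
Qed.

(** Covers the l1 bounds of [delta0] and of [chi0] at frequency at most 1. It also exceeds the
    constant 4 * pi of [wave_l2], so one constant serves both sums in [sum_mixing_le]. *)
Definition core_cst : R := 78 * pi * delta_lip xi + 26 * pi * ((margin xi)^-1 + 1).

Lemma core_cst_ge : 4 * pi <= core_cst.
Proof.
have p0 := pi_gt0 R; have d0 := delta_lip_gt0 cs; have m0 := margin_gt0 cs.
have mi : 0 < (margin xi)^-1 by rewrite invr_gt0.
have -> : core_cst = 78 * (pi * delta_lip xi) + 26 * (pi * (margin xi)^-1) + 26 * pi.
  by rewrite /core_cst; ring.
have u0 : 0 < pi * delta_lip xi :> R by rewrite mulr_gt0.
have v0 : 0 < pi * (margin xi)^-1 :> R by rewrite mulr_gt0.
lra.
Qed.

(** The terms of the telescoping decomposition of [chi0] into [delta 0], ..., [delta n.-1] and the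
    remainder [chi n]. *)
Definition level_wave n x r l (m : nat) : R -> R[i] :=
  if (m < n)%N then wave K (delta xi m) x r l else wave K (chi xi n) x r l.

Lemma fint_levels_le n x r l y :
  normc (fint (wave K (chi0 xi) x r l) y) <=
  \sum_(m < n.+1) normc (fint (level_wave n x r l m) y).
Proof.
have cK := continuous_K cs.
have cc m : ccontinuous (wave K (chi xi m) x r l) by apply: wave_ccontinuous => //; exact: (continuous_chi cs).
have cd m : ccontinuous (wave K (delta xi m) x r l) by apply: wave_ccontinuous => //; exact: (continuous_delta cs).
suff H : normc (fint (wave K (chi0 xi) x r l) y) <=
  \sum_(m < n) normc (fint (wave K (delta xi m) x r l) y) + normc (fint (wave K (chi xi n) x r l) y).
  rewrite big_ord_recr/= /level_wave ltnn; apply: (le_trans H); rewrite lerD2r.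
  by apply: ler_sum => m _; rewrite ltn_ord.
elim: n => [|n IH]; first by rewrite big_ord0 add0r.
apply: (le_trans IH); rewrite big_ord_recr -addrA lerD2l.
have -> : wave K (chi xi n) x r l = fun t => wave K (delta xi n) x r l t + wave K (chi xi n.+1) x r l t.
  apply/funext => t; rewrite /wave -mulrDl; congr (_ * _).
  by rewrite deltaE rmorphB/= subrK.
by rewrite fintD// normcD.
Qed.

(** The [delta] terms need no control of the frequency; the premise on [x] says that the phase no
    longer oscillates at generation n, which controls the remainder. *)
Lemma level_wave_l1 n x r l m : room r l -> `|x| * (xi / 2) ^+ n <= 1 -> (m <= n)%N ->
  l1_bound (core_cst * 2 ^+ m) (level_wave n x r l m).
Proof.
have p0 := pi_gt0 R; have d0 := delta_lip_gt0 cs; have m0 := margin_gt0 cs.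
have x0 := cs_xi_gt0 cs.
move=> rm xn mn s a us; rewrite /level_wave mulrC; case: ifP => [_|/negbT].
  have h := @level_l1 R alpha xi C K cs _ (fun=> 78 * pi * delta_lip xi) (delta0_tent cs) (@continuous_delta R alpha xi C K cs 0)
    (fun x r l => @delta0_l1 R alpha xi C K cs x r l) m x r l rm s a us.
  apply: (le_trans h); rewrite ler_pM2l ?exprn_gt0// /core_cst lerDl.
  have mi : 0 < (margin xi)^-1 by rewrite invr_gt0.
  by apply: mulr_ge0; [rewrite mulr_ge0// ltW|rewrite addr_ge0// ltW].
rewrite -leqNgt => nm; have <- : n = m by apply/eqP; rewrite eqn_leq nm mn.
have h := @level_l1 R alpha xi C K cs _ (fun x => 26 * pi * ((margin xi)^-1 + `|x|)) (chi0_tent cs) (@continuous_chi R alpha xi C K cs 0)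
    (fun x r l => @chi0_l1 R alpha xi C K cs x r l) n x r l rm s a us.
apply: (le_trans h); rewrite ler_pM2l ?exprn_gt0// /core_cst.
apply: (@le_trans _ _ (26 * pi * ((margin xi)^-1 + 1))); last first.
  by rewrite lerDr; apply: mulr_ge0; [rewrite mulr_ge0// ltW|rewrite ltW].
rewrite ler_pM2l ?mulr_gt0// lerD2l normrM (ger0_norm (_ : 0 <= (xi / 2) ^+ n))//.
by rewrite exprn_ge0// divr_ge0// ltW.
Qed.

Lemma level_wave_l2 n x r l m (s : seq int) a : room r l -> (m <= n)%N -> uniq s ->
  \sum_(k <- s) normc (fint (level_wave n x r l m) (k%:~R - a)) ^+ 2 <=
  core_cst * 2 ^+ m * (l * xi ^+ m).
Proof.
have x0 := cs_xi_gt0 cs.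
move=> rm mn us; have [l0 _ _ _] := rm.
apply: (@le_trans _ _ (4 * pi * ((2 * xi) ^+ m * l))); last first.
  have -> : core_cst * 2 ^+ m * (l * xi ^+ m) = core_cst * ((2 * xi) ^+ m * l).
    by rewrite exprMn; ring.
  by rewrite ler_pM2r ?core_cst_ge// mulr_gt0// exprn_gt0// mulr_gt0.
rewrite /level_wave; case: ifP => [_|/negbT].
  apply: (wave_l2 cs) => //; first exact: (continuous_delta cs).
  by move=> y; rewrite (delta_ge0 cs) delta_le_chi.
rewrite -leqNgt => nm; have <- : n = m by apply/eqP; rewrite eqn_leq nm mn.
apply: (wave_l2 cs) => //; first exact: (continuous_chi cs).
by move=> y; rewrite chi_ge0 lexx.
Qed.

Lemma chi0_wave_lp p : 1 <= p -> p < 2 -> exists2 D, 0 < D & forall x r l n, room r l ->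
  `|x| * (xi / 2) ^+ n <= 1 ->
  lp_bound p (D * (l `^ (p - 1) * levels p n)) (wave K (chi0 xi) x r l).
Proof.
have p0 := pi_gt0 R; have x0 := cs_xi_gt0 cs; have x2 := cs_xi_lt cs.
have c0 : 0 < core_cst by apply: lt_le_trans core_cst_ge; rewrite mulr_gt0.
move=> p1 p2; exists (2 * core_cst * (1 + mixing_cst p xi)).
  by rewrite !mulr_gt0// ltr_wpDr// powR_ge0.
move=> x r l n rm xn s a us; have [l0 _ _ _] := rm.
pose u (m : nat) (k : int) := normc (fint (level_wave n x r l m) (k%:~R - a)).
have u0 m k : 0 <= u m k by exact: normc_ge0.
have S1 m : (m < n.+1)%N -> \sum_(k <- s) u m k <= core_cst * 2 ^+ m.
  by move=> mn; exact: level_wave_l1.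
apply: (@le_trans _ _ (\sum_(k <- s) (\sum_(m < n.+1) u m k) `^ p)).
  apply: ler_sum => k _.
  apply: (@ge0_ler_powR _ p); rewrite ?nnegrE ?normc_ge0 ?sumr_ge0//; first by lra.
  exact: fint_levels_le.
have lev0 : 0 <= l `^ (p - 1) * levels p n.
  by rewrite mulr_ge0 ?powR_ge0// (le_trans ler01)// levels_ge1.
(* At p = 1 the triangle inequality suffices; the mixing inequality is for p > 1. The summand 1 in
   the constant covers the first case. *)
move: p1; rewrite le_eqVlt => /orP[/eqP pE|p1].
  rewrite -pE subrr powRr0 mul1r.
  under eq_bigr do rewrite powRr1 ?sumr_ge0//.
  rewrite exchange_big/=; apply: (@le_trans _ _ (core_cst * levels 1 n)).
    rewrite /levels mulr_sumr; apply: ler_sum => m _.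
    by rewrite subrr powRr0 mulr1; exact: S1.
  rewrite ler_wpM2r// ?(le_trans ler01)// ?levels_ge1//.
  have := powR_ge0 ((1 - xi `^ (1 - 1 / 2))^-1 + (1 - xi `^ (1 - 1))^-1) 1.
  rewrite -/(mixing_cst 1 xi) => mx; nra.
have xi1 : xi < 1 by lra.
have S2 m : (m < n.+1)%N -> \sum_(k <- s) u m k ^+ 2 <= core_cst * 2 ^+ m * (l * xi ^+ m).
  by move=> mn; exact: level_wave_l2.
apply: (le_trans (sum_mixing_le p1 p2 x0 xi1 l0 u0 S1 S2)).
have -> : \sum_(m < n.+1) 2 * (core_cst * 2 ^+ m) * (l * xi ^+ m) `^ (p - 1) =
  2 * core_cst * (l `^ (p - 1) * levels p n).
  rewrite /levels !mulr_sumr; apply: eq_bigr => m _.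
  rewrite powRM ?exprn_ge0 ?(ltW x0) ?(ltW l0)// exprMn.
  by rewrite (powR_exprn _ _ (ltW x0)); ring.
have mx : 0 <= mixing_cst p xi by exact: powR_ge0.
rewrite mulrA ler_wpM2r//; nra.
Qed.

(** The cutoff of a bridge between two neighbouring copies: what their [chi0] leave uncovered.
    Clamping to [0, 1] makes it vanish outside the bridge. *)
Definition gap0 s : R := 1 - chi0 xi (Num.min (Num.max s 0) 1 + 1) - chi0 xi (Num.min (Num.max s 0) 1 - 1).

Lemma gap0_out s : ~ (0 < s < 1) -> gap0 s = 0.
Proof.
have m1 := margin_lt cs; have m0 := margin_gt0 cs.
have t (y : R) : 0 <= y <= 1 -> chi0 xi y = 1 by exact: (chi0_in).
have z := chi0_tent cs.
move=> /negP; rewrite negb_and -!leNgt /gap0 => /orP[h|h].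
  rewrite (_ : Num.max s 0 = 0); last by apply/eqP; rewrite eq_maxr.
  rewrite (_ : Num.min 0 1 = 0); last by apply/eqP; rewrite eq_minl.
  rewrite t ?z; [ring|apply/orP; left; lra|apply/andP; split; lra].
rewrite (_ : Num.max s 0 = s); last by apply/eqP; rewrite eq_maxl; lra.
rewrite (_ : Num.min s 1 = 1); last by apply/eqP; rewrite eq_minr.
by rewrite [chi0 xi (1 - 1)]t ?z; [ring|apply/orP; right; lra|apply/andP; split; lra].
Qed.

Lemma gap0_core : core_supported gap0.
Proof.
move=> s hs; apply: gap0_out => /andP[h1 h2]; apply: hs; apply/andP; split; lra.
Qed.

Lemma gap0_lip : lip_by (2 * (margin xi)^-1) gap0.
Proof.
have m0 := margin_gt0 cs; have mi : 0 <= (margin xi)^-1 by rewrite invr_ge0 ltW.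
have Lc : lip_by 1 (fun s => Num.min (Num.max s 0) 1).
  exact: (lipschitz_comp ler01 (lipschitz_minr 1) (lipschitz_maxr 0)).
have L1 b : lip_by 1 (fun s => Num.min (Num.max s 0) 1 + b).
  move=> s t /=; rewrite opprD addrACA subrr addr0; exact: Lc.
have L0 : lip_by 0 (fun _ : R => 1 : R) by move=> s t; rewrite subrr normr0 mul0r.
have L2 b := lipschitz_comp mi (lipschitz_chi0 cs) (L1 b).
have H := lipschitzB (lipschitzB L0 (L2 1)) (L2 (-1)).
rewrite add0r -mulr2n -mulr_natl in H; exact: H.
Qed.

Lemma gap0_le1 s : `|gap0 s| <= 1.
Proof.
rewrite /gap0 ler_norml.
have := chi0_ge0 xi (Num.min (Num.max s 0) 1 + 1); have := chi0_le1 cs (Num.min (Num.max s 0) 1 + 1).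
have := chi0_ge0 xi (Num.min (Num.max s 0) 1 - 1); have := chi0_le1 cs (Num.min (Num.max s 0) 1 - 1).
by lra.
Qed.

Lemma gap0_wave_lp p : 1 <= p -> p < 2 -> exists2 D, 0 < D & forall r l n, room r l ->
  lp_bound p (D * (l `^ (p - 1) * levels p n)) (wave K gap0 0 r l).
Proof.
have p0 := pi_gt0 R; have m0 := margin_gt0 cs; have m1 := margin_lt cs.
have L0 : 0 < 2 * (margin xi)^-1 by rewrite mulr_gt0// invr_gt0.
move=> p1 p2; exists (2 * (26 * pi * (2 * (margin xi)^-1))); first by rewrite !mulr_gt0// invr_gt0.
move=> r l n rm s a us; have [l0 l1 r0 r1] := rm.
have wE : wave K gap0 0 r l = fun t => cis (0 * t + 0) * (gap0 ((t - r) / l))%:C.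
  by apply/funext => t; rewrite /wave !mul0r addr0 mulrC.
have S1 := l1_bound_affine_wave 0 0 rm L0 gap0_lip gap0_core.
rewrite -wE in S1.
have cw : ccontinuous (wave K gap0 0 r l).
  apply: wave_ccontinuous; [exact: (continuous_K cs)|exact: lipschitz_continuous gap0_lip].
have mi2 : 2 <= (margin xi)^-1.
  by rewrite -[2]invrK lef_pV2 ?posrE ?invr_gt0// ltW.
have S2 : \sum_(k <- s) normc (fint (wave K gap0 0 r l) (k%:~R - a)) ^+ 2 <=
    26 * pi * (2 * (margin xi)^-1) * l.
  apply: (le_trans (bessel a us cw)).
  apply: (@le_trans _ _ (2 * pi * (1 ^+ 2 * (r + 3 / 2 * l - (r - l / 2))))).
    rewrite ler_pM2l ?mulr_gt0//; apply: normc_sqr_support_le => //; try lra.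
      exact: wave_supported gap0_core.
    by move=> t; rewrite /wave normcM normc_cis normcC mulr1 gap0_le1.
  have -> : 2 * pi * (1 ^+ 2 * (r + 3 / 2 * l - (r - l / 2))) = 4 * (pi * l) :> R by field.
  have -> : 26 * pi * (2 * (margin xi)^-1) * l = 52 * (margin xi)^-1 * (pi * l) by ring.
  rewrite ler_pM2r ?mulr_gt0//; lra.
apply: (le_trans (sum_interpolate p1 (ltW p2) l0 (fun k => normc_ge0 _) (S1 s a us) S2)).
rewrite [leRHS]mulrA; apply: ler_peMr; last exact: levels_ge1.
apply: mulr_ge0; last exact: powR_ge0.
by apply: ltW; rewrite mulr_gt0// mulr_gt0// mulr_gt0.
Qed.

End PulseBounds.

(** * Splitting a pulse into Cantor copies and affine bridges *)

Section PulsePieces.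
Variable R : realType.
Implicit Types (s t r l x a p : R) (f g : R -> R[i]).
Variables (alpha xi : R) (C K : R -> R).
Hypothesis cs : cantor_spec alpha xi C K.

(** The relative change of the oscillating function when one pulse is added to its phase;
    subtracting 1 confines it to the support of the pulse. *)
Definition flare (psi : R -> R) x r l t : R[i] := cis (x * psi ((t - r) / l)) - 1.

(** On the support of the cutoff the profile is affine plus [c] times a translate of [K]: the
    exponential gives a modulated wave, and the term - 1 a wave of frequency 0. *)
Lemma flare_piece p B1 B2 (A : R -> R) (c d e1 e2 : R) x r l : 0 <= p -> 0 < l ->
  continuous A ->
  (forall s, A (s - d) != 0 -> triple K s = e1 * s + e2 + c * K (s - d)) ->
  lp_bound p B1 (wave K A (x * c) (r + d * l) l) ->
  lp_bound p B2 (wave K A 0 (r + d * l) l) ->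
  lp_bound p (2 `^ p * (B1 + B2))
    (fun t => (A ((t - r) / l - d))%:C * flare (triple K) x r l t).
Proof.
move=> p0 l0 cA KA b1 b2.
have cw y : ccontinuous (wave K A y (r + d * l) l) by exact: wave_ccontinuous (continuous_K cs) cA.
rewrite (_ : (fun t => _) = fun t =>
  cis (x * e1 / l * t + (x * e2 - x * e1 * r / l)) * wave K A (x * c) (r + d * l) l t +
  (-1) * wave K A 0 (r + d * l) l t); last first.
  apply/funext => t; rewrite /wave /flare.
  have -> : (t - (r + d * l)) / l = (t - r) / l - d by field; rewrite gt_eqF.
  set s := (t - r) / l; rewrite mul0r cis0 mulr1.
  have [->|As] := eqVneq (A (s - d)) 0; first by rewrite !mul0r !mulr0 addr0.
  rewrite mulrCA -cisD mulrBr mulr1 mulN1r; congr (_ * cis _ - _).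
  by rewrite (KA _ As) /s; field; rewrite gt_eqF.
apply: lp_boundD.
- exact: p0.
- apply: ccontinuousM (cw _); apply: ccontinuous_cis; exact: continuous_linear.
- exact: ccontinuousM (ccontinuous_cst _) (cw 0).
- exact: lp_bound_modulate (cw _) b1.
- rewrite (_ : (fun t => _) = fun t => - wave K A 0 (r + d * l) l t).
    exact: lp_boundN (cw _) b2.
  by apply/funext => t; rewrite mulN1r.
Qed.

Lemma cutoff_partition s : 0 <= s <= 5 ->
  chi0 xi s + gap0 xi (s - 1) + chi0 xi (s - 2) + gap0 xi (s - 3) + chi0 xi (s - 4) = 1.
Proof.
have m0 := margin_gt0 cs; have m1 := margin_lt cs; have x0 := cs_xi_gt0 cs.
have sm : margin xi < 1 by lra.
move=> /andP[s0 s5].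
have z (y : R) : (y <= -1) || (2 <= y) -> chi0 xi y = 0.
  by move=> h; apply: (chi0_tent cs); case/orP: h => h; apply/orP; [left|right]; lra.
have t (y : R) : 0 <= y <= 1 -> chi0 xi y = 1 by exact: chi0_in.
have o (y : R) : (y <= 0) || (1 <= y) -> gap0 xi y = 0.
  move=> h; apply: (gap0_out cs) => /andP[h1 h2]; case/orP: h => h; lra.
have g (y : R) : 0 <= y <= 1 -> gap0 xi y = 1 - chi0 xi (y + 1) - chi0 xi (y - 1).
  move=> /andP[y0 y1]; rewrite /gap0 (_ : Num.max y 0 = y); last by apply/eqP; rewrite eq_maxl.
  by rewrite (_ : Num.min y 1 = y)//; apply/eqP; rewrite eq_minl.
have [s1|s1] := leP s 1.
  rewrite (t s) ?(o (s - 1)) ?(z (s - 2)) ?(o (s - 3)) ?(z (s - 4)); try (apply/orP; left; lra).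
    by rewrite !addr0.
  by rewrite s0.
have [s2|s2] := leP s 2.
  rewrite (g (s - 1)) ?(o (s - 3)) ?(z (s - 4)); try (apply/orP; left; lra).
    have -> : s - 1 + 1 = s by ring.
    have -> : s - 1 - 1 = s - 2 by ring.
    ring.
  by apply/andP; split; lra.
have [s3|s3] := leP s 3.
  rewrite (z s) ?(o (s - 1)) ?(t (s - 2)) ?(o (s - 3)) ?(z (s - 4)).
  - ring.
  - apply/orP; left; lra.
  - apply/orP; left; lra.
  - apply/andP; split; lra.
  - apply/orP; right; lra.
  - apply/orP; right; lra.
have [s4|s4] := leP s 4.
  rewrite (z s) ?(o (s - 1)) ?(g (s - 3)).
  - have -> : s - 3 + 1 = s - 2 by ring.
    have -> : s - 3 - 1 = s - 4 by ring.
    ring.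
  - apply/andP; split; lra.
  - apply/orP; right; lra.
  - apply/orP; right; lra.
rewrite (z s) ?(o (s - 1)) ?(z (s - 2)) ?(o (s - 3)) ?(t (s - 4)).
- ring.
- apply/andP; split; lra.
- apply/orP; right; lra.
- apply/orP; right; lra.
- apply/orP; right; lra.
- apply/orP; right; lra.
Qed.

Lemma chi0_range s : chi0 xi s != 0 -> - 2^-1 < s < 3 / 2.
Proof.
have m1 := margin_lt cs; move=> h; apply/negPn/negP; rewrite negb_and -!leNgt => hs.
by move/eqP: h; apply; apply: (chi0_tent cs); case/orP: hs => hs; apply/orP; [left|right]; lra.
Qed.

Lemma gap0_range s : gap0 xi s != 0 -> 0 < s < 1.
Proof.
by move=> h; apply/negPn/negP => /negP hs; move/eqP: h; apply; exact: (gap0_out cs).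
Qed.

Lemma triple_supp s : ~ (0 <= s <= 5) -> triple K s = 0.
Proof.
have frK := cs_K_framed cs.
move=> hs; apply: (@triple_framed_support R K 1 (fun t => t - 2^-1)) => //.
  by move=> t; ring.
by move=> /andP[h1 h2]; apply: hs; rewrite !ltW.
Qed.

Definition site r l := [/\ 0 < l, l <= 100^-1, l < r & r + 6 * l < 2 * pi :> R].

Lemma site_room r l d : site r l -> 0 <= d <= 4 -> room (r + d * l) l.
Proof. by move=> [h1 h2 h3 h4] /andP[d0 d4]; split; [|lra|nra|nra]. Qed.

(** Five pieces: near [0, 1], [2, 3] and [4, 5] the profile is affine plus 1, -2 and 1 times a
    translate of [K]; on [1, 2] and [3, 4] it is affine. *)
Lemma flare_lp p : 1 <= p -> p < 2 -> exists2 D, 0 < D & forall x r l n, site r l ->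
  2 * `|x| * (xi / 2) ^+ n <= 1 ->
  lp_bound p (D * (l `^ (p - 1) * levels xi p n)) (flare (triple K) x r l).
Proof.
move=> p1 p2; have p0 : 0 <= p by lra.
have [D1 D10 H1] := chi0_wave_lp cs p1 p2.
have [D2 D20 H2] := gap0_wave_lp cs p1 p2.
have frK := cs_K_framed cs; have x0 := cs_xi_gt0 cs.
pose D := D1 + D2; pose P := 2 `^ p; have P0 : 0 < P by exact: powR_gt0.
pose E := P * (D + D).
exists (P * (P * (P * (E + E) + P * (E + E)) + E)).
  by rewrite /E /D !(mulr_gt0, addr_gt0).
move=> x r l n st xn; have [l0 l1 r0 r1] := st.
set Q := l `^ (p - 1) * levels xi p n.
have Q0 : 0 <= Q by rewrite mulr_ge0 ?powR_ge0// (le_trans ler01)// levels_ge1.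
have cchi : continuous (chi0 xi) by exact: (@continuous_chi R alpha xi C K cs 0).
have cgap : continuous (gap0 xi) by exact: lipschitz_continuous (gap0_lip cs).
have q0 : 0 <= (xi / 2) ^+ n by rewrite exprn_ge0// divr_ge0// ltW.
(* The coefficient -2 of the middle copy accounts for the factor 2 in the premise on [x]. *)
have xB (c : R) : `|c| <= 2 -> `|x * c| * (xi / 2) ^+ n <= 1.
  move=> c2; apply: (le_trans _ xn); rewrite normrM ler_wpM2r// mulrC ler_wpM2r//.
have chiB (c d : R) : `|c| <= 2 -> 0 <= d <= 4 -> lp_bound p (D * Q) (wave K (chi0 xi) (x * c) (r + d * l) l).
  move=> c2 d4; apply: (lp_bound_le _ (H1 _ _ _ n (site_room st d4) (xB c c2))).
  by rewrite ler_wpM2r// lerDl ltW.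
have chiB0 (d : R) : 0 <= d <= 4 -> lp_bound p (D * Q) (wave K (chi0 xi) 0 (r + d * l) l).
  by move=> d4; rewrite -(mulr0 x); apply: chiB; rewrite ?normr0.
have gapB (d : R) : 0 <= d <= 4 -> lp_bound p (D * Q) (wave K (gap0 xi) 0 (r + d * l) l).
  move=> d4; apply: (lp_bound_le _ (H2 _ _ n (site_room st d4))).
  by rewrite ler_wpM2r// lerDr ltW.
have gapBx (d : R) : 0 <= d <= 4 -> lp_bound p (D * Q) (wave K (gap0 xi) (x * 0) (r + d * l) l).
  by rewrite mulr0; exact: gapB.
have d4 (d : R) : d = 0 \/ d = 1 \/ d = 2 \/ d = 3 \/ d = 4 -> 0 <= d <= 4.
  by case=> [|[|[|[|]]]] ->; apply/andP; split; lra.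
have E2 : 2 `^ p * (D * Q + D * Q) = E * Q by rewrite /E /P; ring.
pose piece (A : R -> R) (d t : R) := (A ((t - r) / l - d))%:C * flare (triple K) x r l t.
have b0 : lp_bound p (E * Q) (piece (chi0 xi) 0).
  rewrite -E2; apply: (@flare_piece p _ _ (chi0 xi) 1 0 0 0) => //.
  - move=> s; rewrite subr0 => /chi0_range /andP[_ s2].
    by rewrite /triple (frK.1 (s - 2)) ?(frK.1 (s - 4)); [ring|lra|lra].
  - apply: chiB; [rewrite normr1; lra|by apply: d4; left].
  - by apply: chiB0; apply: d4; left.
have b1 : lp_bound p (E * Q) (piece (gap0 xi) 1).
  rewrite -E2; apply: (@flare_piece p _ _ (gap0 xi) 0 1 1 (- 2^-1)) => //.
  - move=> s /gap0_range /andP[s1 s2].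
    by rewrite /triple (frK.2 s) ?(frK.1 (s - 2)) ?(frK.1 (s - 4)); [ring|lra|lra|lra].
  - by apply: gapBx; apply: d4; right; left.
  - by apply: gapB; apply: d4; right; left.
have b2 : lp_bound p (E * Q) (piece (chi0 xi) 2).
  rewrite -E2; apply: (@flare_piece p _ _ (chi0 xi) (-2) 2 1 (- 2^-1)) => //.
  - move=> s /chi0_range /andP[s1 s2].
    by rewrite /triple (frK.2 s) ?(frK.1 (s - 4)); [ring|lra|lra].
  - apply: chiB; [by rewrite normrN ger0_norm|by apply: d4; right; right; left].
  - by apply: chiB0; apply: d4; right; right; left.
have b3 : lp_bound p (E * Q) (piece (gap0 xi) 3).
  rewrite -E2; apply: (@flare_piece p _ _ (gap0 xi) 0 3 (-1) (9 / 2)) => //.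
  - move=> s /gap0_range /andP[s1 s2].
    rewrite /triple (frK.2 s) ?(frK.2 (s - 2)) ?(frK.1 (s - 4)); [by field|lra|lra|lra].
  - by apply: gapBx; apply: d4; right; right; right; left.
  - by apply: gapB; apply: d4; right; right; right; left.
have b4 : lp_bound p (E * Q) (piece (chi0 xi) 4).
  rewrite -E2; apply: (@flare_piece p _ _ (chi0 xi) 1 4 (-1) (9 / 2)) => //.
  - move=> s /chi0_range /andP[s1 s2].
    rewrite /triple (frK.2 s) ?(frK.2 (s - 2)); [by field|lra|lra].
  - by apply: chiB; [rewrite normr1; lra|apply: d4; right; right; right; right].
  - by apply: chiB0; apply: d4; right; right; right; right.
have cf : ccontinuous (flare (triple K) x r l).
  have cK := continuous_K cs.
  rewrite /flare; apply: ccontinuousD; last exact: ccontinuous_cst.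
  apply: ccontinuous_cis => t; apply: cvgM; first exact: cvg_cst.
  have cT : continuous (triple K).
    have sh b : continuous (fun s : R => K (s - b)).
      move=> s; apply: (@continuous_comp _ _ _ (fun s => s - b) K); last exact: cK.
      by apply: cvgB; [exact: cvg_id|exact: cvg_cst].
    move=> s; apply: cvgD; last exact: sh.
    apply: cvgB; first exact: cK.
    by apply: cvgM; [exact: cvg_cst|exact: sh].
  apply: (@continuous_comp _ _ _ (fun t => (t - r) / l) (triple K)); last exact: cT.
  exact: continuous_affine_arg.
have cp A d : continuous A -> ccontinuous (piece A d).
  move=> cA; apply: ccontinuousM cf; apply: ccontinuous_real => t.
  apply: (@continuous_comp _ _ _ (fun t => (t - r) / l - d) A); last exact: cA.
  by apply: cvgB; [exact: continuous_affine_arg|exact: cvg_cst].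
rewrite (_ : flare _ _ _ _ = fun t => ((piece (chi0 xi) 0 t + piece (gap0 xi) 1 t) +
   (piece (chi0 xi) 2 t + piece (gap0 xi) 3 t)) + piece (chi0 xi) 4 t); last first.
  apply/funext => t; rewrite /piece; set s := (t - r) / l.
  rewrite -!mulrDl -!rmorphD/= addrA subr0.
  have [s5|/negP s5] := boolP (0 <= s <= 5); first by rewrite cutoff_partition// mul1r.
  by rewrite /flare -/s triple_supp// mulr0 cis0 subrr mulr0.
have ->  : P * (P * (P * (E + E) + P * (E + E)) + E) * Q =
  2 `^ p * (2 `^ p * (2 `^ p * (E * Q + E * Q) + 2 `^ p * (E * Q + E * Q)) + E * Q).
  by rewrite /P; ring.
have c0 := cp _ 0 cchi; have c1 := cp _ 1 cgap; have c2 := cp _ 2 cchi.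
have c3 := cp _ 3 cgap; have c4 := cp _ 4 cchi.
have c01 := ccontinuousD c0 c1; have c23 := ccontinuousD c2 c3.
have b01 := lp_boundD p0 c0 c1 b0 b1; have b23 := lp_boundD p0 c2 c3 b2 b3.
exact: (lp_boundD p0 (ccontinuousD c01 c23) c4 (lp_boundD p0 c01 c23 b01 b23) b4).
Qed.

Lemma flare_clipschitz psi x r l : 0 < l -> (forall s t, `|psi s - psi t| <= 4 * `|s - t|) ->
  clipschitz (4 * `|x| / l) (flare psi x r l).
Proof.
move=> l0 Lp s t; rewrite /flare.
have -> : cis (x * psi ((s - r) / l)) - 1 - (cis (x * psi ((t - r) / l)) - 1) =
  cis (x * psi ((s - r) / l)) - cis (x * psi ((t - r) / l)) by ring.
apply: (le_trans (normc_cisB _ _)); rewrite -mulrBr normrM.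
apply: (@le_trans _ _ (`|x| * (4 * `|(s - r) / l - (t - r) / l|))).
  by rewrite ler_wpM2l.
have -> : (s - r) / l - (t - r) / l = (s - t) / l by field; rewrite gt_eqF.
by rewrite normrM normfV (gtr0_norm l0); apply: le_of_eq; ring.
Qed.

Lemma flare_supported psi x r l : 0 < l -> (forall s, ~ (0 <= s <= 5) -> psi s = 0) ->
  supported (flare psi x r l) r (r + 5 * l).
Proof.
move=> l0 sp t tn; rewrite /flare sp ?mulr0 ?cis0 ?subrr// => /andP[h1 h2]; apply: tn.
by move: h1 h2; rewrite ler_pdivlMr// ler_pdivrMr// => h1 h2; apply/andP; split; lra.
Qed.

(** For small [x] the flare is one Lipschitz bump with constant 4 |x| / l. The bound tends to 0 with
    [x], which is needed to sum over the pulses too short to oscillate. *)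
Lemma flare_l1_small x r l : site r l ->
  l1_bound (260 * pi * `|x|) (flare (triple K) x r l).
Proof.
have [H pf] := cantor_profile cs.
move=> [l0 l1 r0 r1] s a us.
have [->|xn] := eqVneq x 0.
  rewrite normr0 mulr0 big1// => k _.
  rewrite (_ : flare _ _ _ _ = fun=> 0 * 0); last first.
    by apply/funext => t; rewrite /flare mul0r cis0 subrr mulr0.
  by rewrite fintZ ?mul0r ?normc0//; exact: ccontinuous_cst.
have x0 : 0 < `|x| by rewrite normr_gt0.
have L0 : 0 < 4 * `|x| / l by rewrite divr_gt0// mulr_gt0.
have Lf := @flare_clipschitz (triple K) x r l l0 (pf_lipschitz pf).
have sf := @flare_supported (triple K) x r l l0 triple_supp.
apply: (le_trans (@sum_atom_le R s _ _ _ (5 * l) _ a us Lf sf _ _ _ _ _ _ L0)); try lra.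
apply: le_of_eq; move: (pi : R) => q.
by field; rewrite gt_eqF.
Qed.

End PulsePieces.

(** * Upper bounds *)

Section Assembly.
Variable R : realType.
Implicit Types (s t r l x a p lam : R) (f g : R -> R[i]).
Variables (alpha xi : R) (C K : R -> R).
Hypothesis cs : cantor_spec alpha xi C K.
Local Notation psi := (triple K).
Variables (rr ll : nat -> R).
Hypothesis pl : placement psi rr ll.
Variables (H : R) (phi dphi : R -> R).
Hypothesis ph : phase_spec alpha H psi rr ll phi dphi.

Let phase n t := partial (pulse psi) rr ll n t.
Let osc lam (u : R -> R) t : R[i] := cis (lam * u t).

Lemma ll_le n : ll n <= (100^-1) ^+ n.+1.
Proof.
elim: n => [|n IH]; first by rewrite expr1; exact: (pl_l0 pl).
by rewrite exprS mulrC; apply: (le_trans (pl_l_step pl n)); rewrite ler_wpM2r// invr_ge0.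
Qed.

Lemma ll_site j : site (rr j) (ll j).
Proof.
split; [exact: (pl_l_gt0 pl)| |exact: (pl_r_gt pl)|exact: (pl_r_lt pl)].
apply: (le_trans (ll_le j)); rewrite exprS ler_piMr ?invr_ge0//.
by rewrite exprn_ile1 ?invr_ge0// invf_le1// ler1n.
Qed.

Lemma ll_sum_powR beta n : 0 < beta ->
  \sum_(j < n) ll j `^ beta <= (1 - (100^-1) `^ beta)^-1.
Proof.
move=> b0; apply: sum_powR_geometric => //.
- by rewrite invf_lt1// ltr1n.
- by move=> j; rewrite ltW// (pl_l_gt0 pl).
- by apply: (le_trans (pl_l0 pl)); rewrite invf_le1// ler1n.
- by move=> j; rewrite mulrC; exact: (pl_l_step pl).
Qed.

Lemma continuous_psi : continuous psi.
Proof.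
have [H0 pf] := cantor_profile cs.
exact: lipschitz_continuous (pf_lipschitz pf).
Qed.

Lemma ccontinuous_flare x r l : ccontinuous (flare psi x r l).
Proof.
apply: ccontinuousD; last exact: ccontinuous_cst.
apply: ccontinuous_cis => t; apply: cvgM; first exact: cvg_cst.
apply: (@continuous_comp _ _ _ (fun t => (t - r) / l) psi); last exact: continuous_psi.
exact: continuous_affine_arg.
Qed.

Lemma continuous_phase n : continuous (phase n).
Proof.
elim: n => [|n IH].
  by rewrite (_ : phase 0 = fun=> 0); [move=> t; exact: cvg_cst|apply/funext => t; rewrite /phase /partial big_ord0].
rewrite (_ : phase n.+1 = fun t => phase n t + pulse psi (rr n) (ll n) t); last first.
  by apply/funext => t; rewrite /phase partialS.
move=> t; apply: cvgD; first exact: IH.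
apply: cvgM; first exact: cvg_cst.
apply: (@continuous_comp _ _ _ (fun t => (t - rr n) / ll n) psi); last exact: continuous_psi.
exact: continuous_affine_arg.
Qed.

Lemma ccontinuous_osc lam (u : R -> R) : continuous u -> ccontinuous (osc lam u).
Proof.
by move=> cu; apply: ccontinuous_cis => t; apply: cvgM; [exact: cvg_cst|exact: cu].
Qed.

Lemma continuous_phi : continuous phi.
Proof.
by apply: (@lipschitz_continuous _ 1) => s t; rewrite mul1r; exact: (ph_lipschitz ph).
Qed.

Lemma osc_step lam j : exists c d, forall t,
  osc lam (phase j.+1) t = osc lam (phase j) t +
    cis (c * t + d) * flare psi (lam * ll j ^+ 2) (rr j) (ll j) t.
Proof.
have [a [b ab]] := pl_affine pl j; exists (lam * a), (lam * b) => t.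
have l0 := pl_l_gt0 pl j.
have sf := @flare_supported R psi (lam * ll j ^+ 2) (rr j) (ll j) l0 (triple_supp cs).
have -> : osc lam (phase j.+1) t = osc lam (phase j) t +
    osc lam (phase j) t * flare psi (lam * ll j ^+ 2) (rr j) (ll j) t.
  rewrite /flare mulrBr mulr1 addrC subrK /osc -cisD; congr cis.
  by rewrite /phase partialS /pulse; ring.
congr (_ + _); have [tI|/negP tI] := boolP (rr j <= t <= rr j + 5 * ll j); last first.
  by rewrite sf// !mulr0.
by congr (_ * _); rewrite /osc /phase ab//; congr cis; ring.
Qed.

(** The shifts are fixed by [lam] alone, before [M] and [y], so the same shifts serve all
    coefficients and all truncations. *)
Lemma osc_phase_dist lam : exists c : nat -> R, forall M y,
  normc (fint (osc lam (phase M)) y - fint (fun=> 1) y) <=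
    \sum_(j < M) normc (fint (flare psi (lam * ll j ^+ 2) (rr j) (ll j)) (y - c j)).
Proof.
have [c cP] := choice (osc_step lam).
exists c => M y; elim: M => [|M IH].
  rewrite big_ord0 (_ : osc lam (phase 0) = fun=> 1) ?subrr ?normc0//.
  by apply/funext => t; rewrite /osc /phase /partial big_ord0 mulr0 cis0.
have [d dP] := cP M.
have cf := ccontinuous_flare (lam * ll M ^+ 2) (rr M) (ll M).
rewrite (_ : osc lam (phase M.+1) = fun t => osc lam (phase M) t +
    cis (c M * t + d) * flare psi (lam * ll M ^+ 2) (rr M) (ll M) t); last exact/funext.
have c1 := ccontinuous_osc lam (@continuous_phase M).
have c2 : ccontinuous (fun t => cis (c M * t + d) * flare psi (lam * ll M ^+ 2) (rr M) (ll M) t).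
  by apply: ccontinuousM cf; apply: ccontinuous_cis; exact: continuous_linear.
rewrite (fintD _ c1 c2) addrAC.
apply: (le_trans (normcD _ _)); rewrite (normc_fint_modulate _ _ _ cf).
by rewrite big_ord_recr lerD2r.
Qed.

Lemma osc_phase_le lam : exists c : nat -> R, forall M y,
  normc (fint (osc lam (phase M)) y) <= normc (fint (fun=> 1) y) +
    \sum_(j < M) normc (fint (flare psi (lam * ll j ^+ 2) (rr j) (ll j)) (y - c j)).
Proof.
have [c cP] := osc_phase_dist lam; exists c => M y.
rewrite -[fint (osc lam _) y](subrK (fint (fun=> 1) y)) addrC.
apply: (le_trans (normcD _ _)); rewrite lerD2l; exact: cP.
Qed.

Lemma fint_one_le (k : int) : normc (fint (fun=> 1 : R[i]) k%:~R) <= (if k == 0 then 2 * pi else 0 : R).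
Proof.
have [->|k0] := eqVneq k 0.
  apply: (@le_trans _ _ (rint (fun=> 1 : R))); last by rewrite rint_cst mul1r.
  apply: normc_fint_le; first exact: ccontinuous_cst.
    by move=> t; exact: cvg_cst.
  by move=> t _; rewrite (_ : 1 = cis 0) ?normc_cis// cis0.
rewrite (_ : fint _ _ = 0) ?normc0// -(@cint_char R (- k)) ?oppr_eq0//.
by apply: eq_cint => t; rewrite mul1r rmorphN/= mulNr.
Qed.

Lemma osc_phi_dist lam M y :
  normc (fint (osc lam phi) y - fint (osc lam (phase M)) y) <=
    `|lam| * (40 * ll M) * (2 * pi).
Proof.
have c1 := ccontinuous_osc lam continuous_phi.
have c2 := ccontinuous_osc lam (@continuous_phase M).
have c3 : ccontinuous (fun t => osc lam phi t - osc lam (phase M) t).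
  have := ccontinuousD c1 (ccontinuousM (ccontinuous_cst (-1)) c2).
  by congr ccontinuous; apply/funext => t; rewrite mulN1r.
rewrite -fintB// -rint_cst.
apply: normc_fint_le => //; first by move=> t; exact: cvg_cst.
move=> t _; apply: (le_trans (normc_cisB _ _)).
by rewrite -mulrBr normrM ler_wpM2l// (ph_approx ph).
Qed.

Lemma osc_phi_le lam M y :
  normc (fint (osc lam phi) y) <= normc (fint (osc lam (phase M)) y) +
    `|lam| * (40 * ll M) * (2 * pi).
Proof.
rewrite -[fint (osc lam phi) y](subrK (fint (osc lam (phase M)) y)) addrC.
apply: (le_trans (normcD _ _)); rewrite lerD2l; exact: osc_phi_dist.
Qed.

Lemma approx_small lam e : 0 < e -> exists M, `|lam| * (40 * ll M) * (2 * pi) <= e.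
Proof.
move=> e0.
have q0 : 0 <= 100^-1 :> R by rewrite invr_ge0.
have q1 : 100^-1 < 1 :> R by rewrite invf_lt1// ltr1n.
have [n hn] := geometric_small (`|lam| * 40 * (2 * pi)) q0 q1 e0.
exists n; apply: ltW; apply: le_lt_trans hn.
have -> : `|lam| * (40 * ll n) * (2 * pi) = `|lam| * 40 * (2 * pi) * ll n by ring.
rewrite ler_wpM2l//; first by rewrite !mulr_ge0// ltW// pi_gt0.
apply: (le_trans (ll_le n)); rewrite exprS ler_piMl ?exprn_ge0//; exact: ltW.
Qed.

(** A substitute for the triangle inequality in lp: each u j is at most c j times the p-th root of
    the weighted sum. Lacunarity pays for the summable weights. *)
Lemma sum_powR_sup (p : R) (M : nat) (u c : nat -> R) : 0 < p ->
  (forall j, 0 <= u j) -> (forall j, 0 < c j) ->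
  (\sum_(j < M) u j) `^ p <= (\sum_(j < M) c j) `^ p * \sum_(j < M) (u j / c j) `^ p.
Proof.
move=> p0 u0 c0; set S := \sum_(j < M) (u j / c j) `^ p.
have S0 : 0 <= S by apply: sumr_ge0 => j _; exact: powR_ge0.
have C0 : 0 <= \sum_(j < M) c j by apply: sumr_ge0 => j _; exact: ltW.
have -> : S = (S `^ p^-1) `^ p by rewrite -powRrM mulVf ?gt_eqF// powRr1.
rewrite -powRM ?powR_ge0//; apply: (ge0_ler_powR (ltW p0)).
- by rewrite nnegrE sumr_ge0.
- by rewrite nnegrE mulr_ge0 ?powR_ge0.
rewrite mulr_suml; apply: ler_sum => j _.
have y0 : 0 <= u j / c j by rewrite divr_ge0// ltW.
rewrite mulrC -ler_pdivrMr//.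
have -> : u j / c j = ((u j / c j) `^ p) `^ p^-1.
  by rewrite -powRrM mulfV ?gt_eqF// powRr1.
apply: (@ge0_ler_powR _ p^-1); rewrite ?nnegrE ?powR_ge0 ?invr_ge0 ?(ltW p0)//.
by rewrite /S (bigD1 j)//= lerDl sumr_ge0// => i _; exact: powR_ge0.
Qed.

Lemma sum_truncate_le (p : R) (s : seq int) lam (B : R) : 0 < p ->
  (forall M, \sum_(k <- s) normc (fint (osc lam (phase M)) k%:~R) `^ p <= B) ->
  \sum_(k <- s) normc (fint (osc lam phi) k%:~R) `^ p <= 2 `^ p * (B + 1).
Proof.
move=> p0 HB.
(* The p-th powers of the truncation errors over all of [s] add up to at most 1; the truncation
   order depends on [s], the final bound does not. *)
pose e : R := ((size s).+1%:R)^-1 `^ p^-1.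
have e0 : 0 < e by rewrite powR_gt0 ?invr_gt0.
have eE : e `^ p = ((size s).+1%:R)^-1 by rewrite -powRrM mulVf ?gt_eqF// powRr1 ?invr_ge0.
have [M HM] := approx_small lam e0.
apply: (@le_trans _ _ (\sum_(k <- s) 2 `^ p * (normc (fint (osc lam (phase M)) k%:~R) `^ p + e `^ p))).
  apply: ler_sum => k _.
  apply: le_trans (powR_sum2 (ltW p0) (normc_ge0 _) (ltW e0)).
  apply: (ge0_ler_powR (ltW p0)); rewrite ?nnegrE ?addr_ge0 ?normc_ge0 ?(ltW e0)//.
  by apply: (le_trans (osc_phi_le lam M _)); rewrite lerD2l.
rewrite -mulr_sumr ler_wpM2l ?powR_ge0// big_split/=; apply: lerD; first exact: HB.
rewrite big_const_seq count_predT iter_addr_0 eE -[X in X <= _]mulr_natl.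
by rewrite ler_pdivrMr// mul1r ler_nat.
Qed.

Lemma sum_one_le (p : R) (s : seq int) : 0 < p -> uniq s ->
  \sum_(k <- s) normc (fint (fun=> 1 : R[i]) k%:~R) `^ p <= (2 * pi) `^ p.
Proof.
move=> p0 us.
apply: (@le_trans _ _ (\sum_(k <- s) if k == 0 then (2 * pi) `^ p else 0)).
  apply: ler_sum => k _; have := fint_one_le k; case: ifP => _ h.
    by apply: (ge0_ler_powR (ltW p0)); rewrite ?nnegrE ?normc_ge0// mulr_ge0// ltW// pi_gt0.
  have -> : normc (fint (fun=> 1 : R[i]) k%:~R) = 0 :> R.
    by apply/eqP; rewrite eq_le h normc_ge0.
  by rewrite powR0// gt_eqF.
rewrite -big_mkcond/= big_const_seq iter_addr_0.
have c1 : (count (pred1 (0 : int)) s <= 1)%N by rewrite count_uniq_mem// leq_b1.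
by move: c1; case: (count _ _) => [|[|//]] _; rewrite ?mulr0n ?mulr1n ?powR_ge0.
Qed.

Lemma lp_sum_bound p : 1 < p -> p < 2 -> exists2 D : R, 0 < D & forall lam n (s : seq int),
  uniq s -> 2 * `|lam| * (xi / 2) ^+ n <= 1 ->
  \sum_(k <- s) normc (fint (osc lam phi) k%:~R) `^ p <= D * levels xi p n.
Proof.
move=> p1 p2; have p0 : 0 < p by lra.
have x0 := cs_xi_gt0 cs.
have [D D0 HD] := flare_lp cs (ltW p1) p2.
(* Splits the factor l^(p - 1) of each pulse in two: l^(g * p) pays for the weights l^g, and l^h
   makes the sum over the pulses converge. *)
pose g := (p - 1) / (2 * p); have g0 : 0 < g by rewrite divr_gt0 ?mulr_gt0//; lra.
pose h := (p - 1) / 2; have h0 : 0 < h by rewrite divr_gt0//; lra.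
pose S b : R := (1 - (100^-1) `^ b)^-1.
have S0 b : 0 < b -> 0 <= S b by move=> b0; have := ll_sum_powR 0 b0; rewrite big_ord0.
pose B := 2 `^ p * ((2 * pi) `^ p + S g `^ p * (D * S h)).
have B0 : 0 <= B by rewrite !(mulr_ge0, addr_ge0, powR_ge0, S0)// ltW.
exists (2 `^ p * (B + 1)); first by rewrite mulr_gt0 ?powR_gt0// ltr_wpDl.
move=> lam n s us ln.
have lev1 := levels_ge1 xi p n.
have lev0 : 0 <= levels xi p n by exact: le_trans lev1.
apply: (@le_trans _ _ (2 `^ p * (B * levels xi p n + 1))); last first.
  by rewrite -[leRHS]mulrA ler_wpM2l ?powR_ge0// mulrDl mul1r lerD2l.
apply: sum_truncate_le => // M.
have [c cP] := osc_phase_le lam.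
pose u j (k : int) := normc (fint (flare psi (lam * ll j ^+ 2) (rr j) (ll j)) (k%:~R - c j)).
have u0 j k : 0 <= u j k by exact: normc_ge0.
apply: (@le_trans _ _ (\sum_(k <- s) 2 `^ p * (normc (fint (fun=> 1 : R[i]) k%:~R) `^ p + (\sum_(j < M) u j k) `^ p))).
  apply: ler_sum => k _.
  apply: le_trans (powR_sum2 (ltW p0) (normc_ge0 _) _); last by apply: sumr_ge0.
  have Su : 0 <= \sum_(j < M) u j k by apply: sumr_ge0.
  apply: (ge0_ler_powR (ltW p0)); rewrite ?nnegrE ?addr_ge0 ?normc_ge0//.
rewrite -mulr_sumr /B -[leRHS]mulrA ler_wpM2l ?powR_ge0// big_split/= mulrDl; apply: lerD.
  by apply: (le_trans (sum_one_le p0 us)); rewrite ler_peMr// powR_ge0.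
have lp j : 0 < ll j := pl_l_gt0 pl j.
apply: (@le_trans _ _ (\sum_(k <- s) S g `^ p * \sum_(j < M) (u j k / ll j `^ g) `^ p)).
  apply: ler_sum => k _.
  apply: (le_trans (@sum_powR_sup p M (u ^~ k) (fun j => ll j `^ g) p0 (u0 ^~ k) (fun j => powR_gt0 _ (lp j)))).
  apply: ler_wpM2r; first by apply: sumr_ge0 => j _; exact: powR_ge0.
  apply: (ge0_ler_powR (ltW p0)); rewrite ?nnegrE ?S0//.
    by apply: sumr_ge0 => j _; exact: powR_ge0.
  exact: ll_sum_powR.
rewrite -mulr_sumr -[leRHS]mulrA ler_wpM2l ?powR_ge0// exchange_big/=.
apply: (@le_trans _ _ (\sum_(j < M) ll j `^ h * (D * levels xi p n))).
  apply: ler_sum => j _.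
  have xj : 2 * `|lam * ll j ^+ 2| * (xi / 2) ^+ n <= 1.
    apply: le_trans ln; rewrite normrM ler_wpM2r ?exprn_ge0 ?divr_ge0 ?(ltW x0)//.
    rewrite ler_wpM2l// (ger0_norm (sqr_ge0 (ll j))) ler_piMr// exprn_ile1 ?(ltW (lp j))//.
    have [_ l1 _ _] := ll_site j; apply: (le_trans l1).
    by rewrite invf_le1// ler1n.
  have := HD _ _ _ n (ll_site j) xj s (c j) us.
  have lh : ll j `^ (p - 1) = ll j `^ h * (ll j `^ g) `^ p.
    rewrite -powRrM -powRD; last by apply/implyP => _; rewrite gt_eqF.
    by congr (_ `^ _); rewrite /h /g; field; rewrite gt_eqF.
  have gp : 0 < (ll j `^ g) `^ p by rewrite powR_gt0// powR_gt0.
  move=> HDj; rewrite (eq_bigr (fun k => ((ll j `^ g) `^ p)^-1 * u j k `^ p)); last first.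
    move=> k _; rewrite powRM ?invr_ge0 ?powR_ge0// mulrC; congr (_ * _).
    by rewrite -powR_inv1 ?powR_ge0// powRAC powR_inv1 ?powR_ge0.
  rewrite -mulr_sumr ler_pdivrMl//; apply: (le_trans HDj).
  by rewrite lh; apply: le_of_eq; ring.
rewrite -mulr_suml (_ : D * S h * _ = S h * (D * levels xi p n)); last by ring.
by rewrite ler_wpM2r ?ll_sum_powR// mulr_ge0// ltW.
Qed.

Lemma half_xi_gt0 : 0 < xi / 2.
Proof. by rewrite divr_gt0// (cs_xi_gt0 cs). Qed.

Lemma half_xi_powR : xi / 2 = xi `^ (1 + alpha).
Proof.
have x0 := cs_xi_gt0 cs; have xia := cs_xi_alpha cs.
rewrite powRD; last by apply/implyP => _; rewrite gt_eqF.
rewrite powRr1 ?(ltW x0)//; congr (_ * _); apply: (mulfI (_ : (2 : R) != 0)) => //.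
by rewrite xia mulfV.
Qed.

Lemma xi_powR_half b : xi `^ b = (xi / 2) `^ (b / (1 + alpha)).
Proof.
have a0 := cs_alpha_gt0 cs.
by rewrite half_xi_powR -powRrM mulrCA divff ?mulr1// gt_eqF// addr_gt0.
Qed.

(** The first generation at which the phase stops oscillating is written n.+1, so that the strict
    inequality at n converts powers of geometric ratios into powers of y. *)
Lemma stopping_index y : 1 < y -> exists n, y * (xi / 2) ^+ n.+1 <= 1 /\ 1 < y * (xi / 2) ^+ n.
Proof.
have z0 := half_xi_gt0; have x2 := cs_xi_lt cs.
move=> y1; have z1 : xi / 2 < 1 by lra.
have ex : exists n, y * (xi / 2) ^+ n <= 1.
  by have [n hn] := geometric_small y (ltW z0) z1 ltr01; exists n; exact: ltW.
pose m := ex_minn ex; have : y * (xi / 2) ^+ m <= 1 by rewrite /m; case: ex_minnP.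
have mmin k : (k < m)%N -> 1 < y * (xi / 2) ^+ k.
  rewrite ltnNge => km; rewrite ltNge; apply: contra km => yk.
  by rewrite /m; case: ex_minnP => i _; apply.
case: m mmin => [|m] mmin hm; last by exists m; split => //; exact: mmin.
by move: hm; rewrite expr0 mulr1 leNgt y1.
Qed.

Lemma stopped_powR y n e : 0 < e -> 0 < y -> 1 < y * (xi / 2) ^+ n ->
  ((xi / 2) `^ (- e)) ^+ n <= y `^ e.
Proof.
have z0 := half_xi_gt0; move=> e0 y0 h.
have zn : 0 < (xi / 2) ^+ n by rewrite exprn_gt0.
have : 1 <= (y * (xi / 2) ^+ n) `^ e.
  by rewrite -[leLHS](one_powR e); apply: (ge0_ler_powR (ltW e0)); rewrite ?nnegrE ?ltW// mulr_gt0.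
move=> h1; rewrite powRM ?(ltW y0) ?(ltW zn)// in h1.
have zE : ((xi / 2) ^+ n) `^ e = ((xi / 2) `^ e) ^+ n.
  by rewrite -(powR_mulrn n (ltW z0)) powRAC powR_mulrn// powR_ge0.
rewrite zE in h1.
by rewrite powRN exprVn -[leLHS]mul1r ler_pdivrMr// exprn_gt0// powR_gt0.
Qed.

(** The exponent with (xi / 2)^(- kappa) = 2: the number 2^n of intervals at the stopping generation
    is then at most y^kappa. *)
Definition kappa := alpha / (1 + alpha).

Lemma kappa_gt0 : 0 < kappa.
Proof. by have a0 := cs_alpha_gt0 cs; rewrite divr_gt0// addr_gt0. Qed.

Lemma kappa_lt1 : kappa < 1.
Proof. by have a0 := cs_alpha_gt0 cs; rewrite ltr_pdivrMr ?addr_gt0//; lra. Qed.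

Lemma half_powR_kappa : (xi / 2) `^ (- kappa) = 2.
Proof.
have x0 := cs_xi_gt0 cs; have xia := cs_xi_alpha cs.
rewrite powRN -xi_powR_half; apply: (mulIf (_ : xi `^ alpha != 0)); first by rewrite gt_eqF ?powR_gt0.
by rewrite mulVf ?xia// gt_eqF ?powR_gt0.
Qed.

(** For 2 |x| > 1 the last term of the geometric sum at the stopping generation decides. For small
    [x] the linear bound is better, because |x| <= |x|^kappa. *)
Lemma flare_l1 : exists2 D : R, 0 < D & forall x r l, site r l ->
  l1_bound (D * `|x| `^ kappa) (flare psi x r l).
Proof.
have k0 := kappa_gt0; have k1 := kappa_lt1; have p0 := pi_gt0 R.
have [D D0 HD] := flare_lp cs (lexx 1) (ltr1n R 2).
exists (260 * pi + D * 8); first by apply: addr_gt0; apply: mulr_gt0.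
move=> x r l st s a us.
have [x1|x1] := leP (2 * `|x|) 1.
  apply: (le_trans (flare_l1_small cs x st a us)).
  apply: (@le_trans _ _ (260 * pi * `|x| `^ kappa)); last first.
    by rewrite ler_wpM2r ?powR_ge0// lerDl mulr_ge0// ltW.
  apply: ler_wpM2l; first by apply: mulr_ge0; [exact: ler0n|exact: ltW].
  have [->|xn] := eqVneq x 0; first by rewrite normr0 powR_ge0.
  have xp : 0 < `|x| by rewrite normr_gt0.
  by apply: ger1_powR; [rewrite xp/=; lra|exact: ltW].
have [n [hn1 hn2]] := stopping_index x1.
have := HD x r l n.+1 st hn1 s a us.
rewrite subrr powRr0 mul1r (eq_bigr (fun k => normc (fint (flare psi x r l) (k%:~R - a)))); last first.
  by move=> k _; rewrite powRr1// normc_ge0.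
move=> /le_trans; apply.
have xp : 0 < `|x| by lra.
have lev : levels xi 1 n.+1 <= 4 * 2 ^+ n.
  suff -> : levels xi 1 n.+1 = 2 ^+ n.+2 - 1 by rewrite !exprS mulrA; lra.
  rewrite /levels subrr powRr0 mulr1; elim: (n.+2) => [|m IH]; first by rewrite big_ord0 expr0 subrr.
  by rewrite big_ord_recr/= IH exprS; ring.
have := stopped_powR k0 (lt_trans ltr01 x1) hn2; rewrite half_powR_kappa => h.
have h2 : (2 * `|x|) `^ kappa <= 2 * `|x| `^ kappa.
  rewrite powRM// ler_wpM2r ?powR_ge0// -[leRHS]powRr1//.
  by apply: ler_powR; [rewrite ler1n|exact: ltW].
apply: (@le_trans _ _ (D * 8 * `|x| `^ kappa)); last first.
  by apply: ler_wpM2r; [exact: powR_ge0|rewrite lerDr; apply: mulr_ge0; [exact: ler0n|exact: ltW]].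
rewrite -mulrA ler_pM2l//; lra.
Qed.

(** The j-th pulse enters with frequency lam * l^2, hence with the factor l^(2 * kappa), summable
    over j uniformly in lam. *)
Lemma l1_sum_bound : exists2 D : R, 0 < D & forall lam (s : seq int), uniq s -> 1 <= `|lam| ->
  \sum_(k <- s) normc (fint (osc lam phi) k%:~R) <= D * `|lam| `^ kappa.
Proof.
have k0 := kappa_gt0; have p0 := pi_gt0 R.
have [D D0 HD] := flare_l1.
have lp j : 0 < ll j := pl_l_gt0 pl j.
pose S : R := (1 - (100^-1) `^ (2 * kappa))^-1.
have S0 : 0 <= S.
  by have := ll_sum_powR 0 (mulr_gt0 (ltr0n R 2) k0); rewrite big_ord0.
have B0 : 0 <= 2 * pi + D * S by rewrite addr_ge0 ?mulr_ge0// ltW.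
exists (2 * (2 * pi + D * S + 1)); first by rewrite mulr_gt0// ltr_wpDl.
move=> lam s us l1.
have y1 : 1 <= `|lam| `^ kappa.
  by rewrite -[leLHS](powRr0 `|lam|); apply: ler_powR => //; exact: ltW.
apply: (@le_trans _ _ (2 `^ 1 * ((2 * pi + D * S) * `|lam| `^ kappa + 1))); last first.
  by rewrite powRr1//; nra.
rewrite (eq_bigr (fun k => normc (fint (osc lam phi) k%:~R) `^ 1)); last first.
  by move=> k _; rewrite powRr1// normc_ge0.
apply: sum_truncate_le => // M.
rewrite (eq_bigr (fun k => normc (fint (osc lam (phase M)) k%:~R))); last first.
  by move=> k _; rewrite powRr1// normc_ge0.
have [c cP] := osc_phase_le lam.
apply: (@le_trans _ _ (\sum_(k <- s) (normc (fint (fun=> 1 : R[i]) k%:~R) +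
    \sum_(j < M) normc (fint (flare psi (lam * ll j ^+ 2) (rr j) (ll j)) (k%:~R - c j))))).
  by apply: ler_sum => k _; exact: cP.
rewrite big_split/= mulrDl; apply: lerD.
  have := sum_one_le ltr01 us; rewrite powRr1; last by rewrite mulr_ge0// ltW.
  rewrite (eq_bigr (fun k => normc (fint (fun=> 1 : R[i]) k%:~R))); last first.
    by move=> k _; rewrite powRr1// normc_ge0.
  by move=> /le_trans; apply; rewrite ler_peMr// mulr_ge0// ltW.
rewrite exchange_big/=.
apply: (@le_trans _ _ (\sum_(j < M) D * `|lam| `^ kappa * ll j `^ (2 * kappa))).
  apply: ler_sum => j _; apply: (le_trans (HD _ _ _ (ll_site j) s (c j) us)).
  rewrite -mulrA ler_pM2l// normrM powRM// ler_wpM2l ?powR_ge0//.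
  rewrite ger0_norm ?sqr_ge0// -powR_mulrn ?(ltW (lp j))// -powRrM.
  by [].
rewrite -mulr_sumr mulrAC ler_wpM2r ?powR_ge0// ler_pM2l//.
by apply: ll_sum_powR; rewrite mulr_gt0.
Qed.

Lemma level_ratio p : 2 * xi `^ (p - 1) = (xi / 2) `^ (- (1 - p / (1 + alpha))).
Proof.
have z0 := half_xi_gt0; have a0 := cs_alpha_gt0 cs.
rewrite -[in X in X * _]half_powR_kappa xi_powR_half -powRD; last first.
  by apply/implyP => _; rewrite gt_eqF.
by congr (_ `^ _); rewrite /kappa; field; rewrite gt_eqF// addr_gt0.
Qed.

(** The ratio exceeds 1, so the sum is comparable to its last term, which [stopped_powR] turns into
    a power of |lam|. *)
Lemma levels_subcritical p : p < 1 + alpha -> exists2 D : R, 0 < D & forall lam, 1 <= `|lam| ->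
  exists2 n, 2 * `|lam| * (xi / 2) ^+ n <= 1 & levels xi p n <= D * `|lam| `^ (1 - p / (1 + alpha)).
Proof.
have z0 := half_xi_gt0; have x0 := cs_xi_gt0 cs; have x2 := cs_xi_lt cs; have a0 := cs_alpha_gt0 cs.
move=> pa; pose e := 1 - p / (1 + alpha).
have e0 : 0 < e by rewrite subr_gt0 ltr_pdivrMr ?mul1r// addr_gt0.
pose q := 2 * xi `^ (p - 1); have qE : q = (xi / 2) `^ (- e) := level_ratio p.
have z1 : xi / 2 < 1 by lra.
have q1 : 1 < q.
  rewrite qE powRN invf_gt1 ?powR_gt0// -[ltRHS](one_powR e).
  by apply: (gt0_ltr_powR e0); rewrite ?nnegrE ?(ltW z0).
have q0 : 0 < q by lra.
have q1' : 0 < q - 1 by lra.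
exists (q ^+ 2 / (q - 1) * 2 `^ e); first by rewrite !mulr_gt0 ?exprn_gt0 ?invr_gt0 ?powR_gt0.
move=> lam l1; have y1 : 1 < 2 * `|lam| by lra.
have [n [hn1 hn2]] := stopping_index y1; exists n.+1 => //.
have := stopped_powR e0 (lt_trans ltr01 y1) hn2; rewrite -qE powRM// => h.
have lev : levels xi p n.+1 <= q ^+ 2 / (q - 1) * q ^+ n.
  rewrite mulrAC ler_pdivlMr// -exprD add2n /levels -/q.
  suff -> : (\sum_(m < n.+2) q ^+ m) * (q - 1) = q ^+ n.+2 - 1 by rewrite gerBl.
  by rewrite mulrC -subrX1.
apply: (le_trans lev); rewrite -[leRHS]mulrA; apply: ler_wpM2l => //.
by apply: ltW; rewrite mulr_gt0 ?exprn_gt0 ?invr_gt0.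
Qed.

Lemma levels_supercritical p : 1 + alpha < p -> exists2 D : R, 0 < D & forall n, levels xi p n <= D.
Proof.
have z0 := half_xi_gt0; have x0 := cs_xi_gt0 cs; have x2 := cs_xi_lt cs; have a0 := cs_alpha_gt0 cs.
move=> pa; pose e := p / (1 + alpha) - 1.
have e0 : 0 < e by rewrite subr_gt0 ltr_pdivlMr ?mul1r// addr_gt0.
have qE : 2 * xi `^ (p - 1) = (xi / 2) `^ e by rewrite level_ratio /e; congr (_ `^ _); ring.
have z1 : xi / 2 < 1 by lra.
have q1 : (xi / 2) `^ e < 1.
  by rewrite -[ltRHS](one_powR e); apply: (gt0_ltr_powR e0); rewrite ?nnegrE ?(ltW z0).
exists (1 - (xi / 2) `^ e)^-1; first by rewrite invr_gt0 subr_gt0.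
by move=> n; rewrite /levels qE; exact: geometric_sum_le (powR_ge0 _ _) q1.
Qed.

Lemma levels_critical : exists D L : R, 0 < D /\ forall lam, L <= `|lam| ->
  exists2 n, 2 * `|lam| * (xi / 2) ^+ n <= 1 & levels xi (1 + alpha) n <= D * ln `|lam|.
Proof.
have z0 := half_xi_gt0; have x0 := cs_xi_gt0 cs; have x2 := cs_xi_lt cs; have a0 := cs_alpha_gt0 cs.
have z1 : xi / 2 < 1 by lra.
have lz : 0 < ln (xi / 2)^-1 by rewrite ln_gt0// invf_gt1.
(* The threshold yields ln |lam| >= 1, absorbing the two generations beyond n, and 2 |lam| <=
   |lam|^2, so that n is at most 2 ln |lam| / ln (2 / xi). *)
exists (2 + 2 / ln (xi / 2)^-1), (expR 1 + 2); split.
  by rewrite addr_gt0// divr_gt0.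
move=> lam hl; have e1 := expR_gt0 (1 : R).
have l0 : 0 < `|lam| by lra.
have ln1 : 1 <= ln `|lam|.
  by rewrite -[leLHS](expRK 1) ler_ln ?posrE//; lra.
have y1 : 1 < 2 * `|lam| by lra.
have [n [hn1 hn2]] := stopping_index y1; exists n.+1 => //.
have -> : levels xi (1 + alpha) n.+1 = n%:R + 2.
  rewrite /levels level_ratio divff ?gt_eqF ?addr_gt0// subrr oppr0 powRr0.
  under eq_bigr do rewrite expr1n.
  by rewrite sumr_const card_ord -natrD addn2.
have h : n%:R * ln (xi / 2)^-1 <= 2 * ln `|lam|.
  have zn : 0 < (xi / 2) ^+ n by rewrite exprn_gt0.
  have hh : (xi / 2)^-1 ^+ n <= `|lam| ^+ 2.
    rewrite exprVn -[leLHS]mul1r ler_pdivrMr//; apply: (le_trans (ltW hn2)).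
    rewrite ler_pM2r// expr2 ler_pM2r//; lra.
  have := hh; rewrite -ler_ln ?posrE ?exprn_gt0 ?invr_gt0//.
  rewrite lnXn ?invr_gt0// lnXn// => h.
  by rewrite mulr_natl (mulr_natl _ 2).
rewrite mulrDl addrC; apply: lerD; first by lra.
by rewrite mulrAC ler_pdivlMr.
Qed.

(** The pulses are too short to cancel the mean of the constant 1: they contribute at most 13 / 9
    and the truncation at most 1, against 2 * pi >= 4. *)
Lemma fint0_lower lam : 1 <= normc (fint (osc lam phi) 0).
Proof.
have p0 := pi_gt0 R; have p4 : 2 <= pi :> R by exact: pi_ge2.
have pi4 : pi <= 4 :> R by have := @pihalf_lt2 R; lra.
have lp j : 0 < ll j := pl_l_gt0 pl j.
have [c cP] := osc_phase_dist lam.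
have [M HM] := approx_small lam (ltr01 : 0 < 1 :> R).
have one : normc (fint (fun=> 1 : R[i]) (0 : R)) = 2 * pi.
  have -> : fint (fun=> 1 : R[i]) (0 : R) = (2 * pi)%:C.
    rewrite /fint /cint; apply/eqP; rewrite eq_complex /=; apply/andP; split; apply/eqP.
      rewrite (@eq_rint _ _ (fun=> 1)) ?rint_cst ?mul1r// => t.
      by rewrite mul0r cosN cos0 sinN sin0 !mul0r mulr1 subr0.
    rewrite (@eq_rint _ _ (fun=> 0)) ?rint_cst ?mul0r// => t.
    by rewrite mul0r cosN cos0 sinN sin0 oppr0 mulr0 mul0r addr0.
  by rewrite normcC gtr0_norm// mulr_gt0.
(* Bessel's inequality for one frequency, modulus at most 2 and length 5 l: the square is at most 40
   * pi * l <= 160 * l, and 160 <= 13^2. *)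
have fl j y : normc (fint (flare psi (lam * ll j ^+ 2) (rr j) (ll j)) y) <= 13 * (10^-1) ^+ j.+1.
  have [l0 l1 r0 r1] := ll_site j.
  have cf := ccontinuous_flare (lam * ll j ^+ 2) (rr j) (ll j).
  have sf := @flare_supported R psi (lam * ll j ^+ 2) (rr j) (ll j) l0 (triple_supp cs).
  have := bessel (- y) (isT : uniq [:: (0 : int)]) cf.
  rewrite big_seq1 sub0r opprK => b.
  have fB t : normc (flare psi (lam * ll j ^+ 2) (rr j) (ll j) t) <= 2.
    apply: (le_trans (normcB _ _)); rewrite normc_cis -cis0 normc_cis; lra.
  have := normc_sqr_support_le cf sf (_ : 0 <= rr j) _ _ fB.
  move=> /(_ (ltW (lt_trans l0 r0)) (_ : rr j <= rr j + 5 * ll j)).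
  have e1 : rr j <= rr j + 5 * ll j by lra.
  have e2 : rr j + 5 * ll j <= 2 * pi by lra.
  move=> /(_ e1 e2) h.
  have n0 := normc_ge0 (fint (flare psi (lam * ll j ^+ 2) (rr j) (ll j)) y).
  rewrite -ler_sqr ?nnegrE ?mulr_ge0 ?exprn_ge0 ?invr_ge0//.
  apply: (le_trans b); apply: (@le_trans _ _ (160 * ll j)).
    apply: (@le_trans _ _ (2 * pi * (2 ^+ 2 * (rr j + 5 * ll j - rr j)))).
      by rewrite ler_pM2l// mulr_gt0.
    have -> : 2 * pi * (2 ^+ 2 * (rr j + 5 * ll j - rr j)) = 40 * pi * ll j :> R by ring.
    rewrite ler_pM2r//; lra.
  rewrite exprMn -exprM mulnC exprM.
  apply: (@le_trans _ _ (160 * (100^-1) ^+ j.+1)); first by rewrite ler_pM2l// ll_le.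
  have -> : (10^-1 : R) ^+ 2 = 100^-1 by rewrite exprVn -natrX.
  by rewrite ler_wpM2r ?exprn_ge0 ?invr_ge0//; lra.
have SM : \sum_(j < M) normc (fint (flare psi (lam * ll j ^+ 2) (rr j) (ll j)) (0 - c j)) <= 13 / 9.
  apply: (@le_trans _ _ (\sum_(j < M) 13 / 10 * (10^-1) ^+ j)).
    by apply: ler_sum => j _; apply: (le_trans (fl _ _)); rewrite exprS mulrA.
  rewrite -mulr_sumr; have := @geometric_sum_le R 10^-1 M.
  rewrite invr_ge0 ler0n => /(_ isT); rewrite invf_lt1// ltr1n => /(_ isT).
  have -> : (1 - 10^-1 : R)^-1 = 10 / 9 by field.
  lra.
have h1 := le_trans (cP M 0) SM.
have h2 := le_trans (osc_phi_dist lam M 0) HM.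
have : normc (fint (fun=> 1 : R[i]) (0 : R)) <= normc (fint (osc lam phi) 0) +
   (normc (fint (osc lam phi) 0 - fint (osc lam (phase M)) 0) +
    normc (fint (osc lam (phase M)) 0 - fint (fun=> 1) 0)).
  set A := fint (fun=> 1) 0; set B := fint _ 0; set E := fint (osc lam (phase M)) 0.
  have e : A = B - ((B - E) + (E - A)) by ring.
  rewrite [X in normc X <= _]e.
  apply: (le_trans (normcB _ _)); rewrite lerD2l.
  exact: normcD.
rewrite one; lra.
Qed.

End Assembly.

(** * The lower bound for small exponents *)

Section Averaging.
Variable R : realType.
Implicit Types (a : int -> R) (p : R).

(* The effect on Fourier coefficients of multiplication by
   [(1 + cos (t - theta)) / 2], up to unimodular factors. *)
Definition avg a (k : int) : R := 2^-1 * a k + 4^-1 * a (k - 1) + 4^-1 * a (k + 1).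

(** The graph of the p-th power lies above its tangent at [m], here by Young's inequality. Taking
    [m] to be a weighted mean gives Jensen's inequality, as in [avg_powR]. *)
Lemma powR_tangent p (y m : R) : 1 < p -> 0 <= y -> 0 <= m ->
  p * y * m `^ (p - 1) <= y `^ p + (p - 1) * m `^ p.
Proof.
move=> p1 y0 m0; have p0 : 0 < p by lra.
pose q := p / (p - 1); have q0 : 0 < q by rewrite divr_gt0//; lra.
have pq : p^-1 + q^-1 = 1 by rewrite /q; field; rewrite !gt_eqF//; lra.
have := conjugate_powR y0 (powR_ge0 m (p - 1)) p0 q0 pq.
rewrite -powRrM (_ : (p - 1) * q = p); last by rewrite /q; field; rewrite gt_eqF//; lra.
move=> /(ler_wpM2l (ltW p0)); rewrite mulrA => /le_trans; apply.
apply: le_of_eq.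
by rewrite /q; field; rewrite !gt_eqF//; lra.
Qed.

Lemma avg_powR p a k : 1 < p -> (forall j, 0 <= a j) ->
  avg a k `^ p <= 2^-1 * a k `^ p + 4^-1 * a (k - 1) `^ p + 4^-1 * a (k + 1) `^ p.
Proof.
move=> p1 a0; have p0 : 0 < p by lra.
have m0 : 0 <= avg a k by rewrite !addr_ge0 ?mulr_ge0 ?invr_ge0.
have h1 := powR_tangent p1 (a0 k) m0.
have h2 := powR_tangent p1 (a0 (k - 1)) m0.
have h3 := powR_tangent p1 (a0 (k + 1)) m0.
have e : p * avg a k * avg a k `^ (p - 1) = p * avg a k `^ p.
  by rewrite -mulrA mulr_powRB1.
have e2 : p * avg a k * avg a k `^ (p - 1) = 2^-1 * (p * a k * avg a k `^ (p - 1)) +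
   4^-1 * (p * a (k - 1) * avg a k `^ (p - 1)) + 4^-1 * (p * a (k + 1) * avg a k `^ (p - 1)).
  by move: (avg a k `^ (p - 1)) => P; rewrite /avg; ring.
move: e e2 h1 h2 h3.
set A := avg a k `^ p; set X := a k `^ p; set Y := a (k - 1) `^ p; set Z := a (k + 1) `^ p.
set U := p * a k * _; set V := p * a (k - 1) * _; set W := p * a (k + 1) * _.
rewrite mulrBl mul1r.
move: (p * A) (p * avg a k * _) => PA T *; lra.
Qed.

Definition lp_family p (B : R) a := forall s : seq int, uniq s -> \sum_(k <- s) a k `^ p <= B.

Lemma lp_family_shift p B a (c : int) : lp_family p B a -> lp_family p B (fun k => a (k + c)).
Proof.
move=> h s us; have := h [seq k + c | k <- s]; rewrite big_map; apply.
by rewrite map_inj_uniq// => i j /addIr.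
Qed.

Lemma avg_lp p B a : 1 < p -> (forall j, 0 <= a j) -> lp_family p B a -> lp_family p B (avg a).
Proof.
move=> p1 a0 h s us.
apply: (@le_trans _ _ (\sum_(k <- s) (2^-1 * a k `^ p + 4^-1 * a (k - 1) `^ p + 4^-1 * a (k + 1) `^ p))).
  by apply: ler_sum => k _; exact: avg_powR.
rewrite !big_split/= -!mulr_sumr.
have := h s us; have := lp_family_shift (-1) h us; have := lp_family_shift 1 h us.
move=> /= h1 h2 h3; lra.
Qed.

Lemma iter_avg_ge0 a n k : (forall j, 0 <= a j) -> 0 <= iter n avg a k.
Proof.
move=> a0; elim: n k => // n IH k; rewrite iterS /avg.
by rewrite !addr_ge0 ?mulr_ge0 ?invr_ge0.
Qed.

Lemma iter_avg_lp p B a n : 1 < p -> (forall j, 0 <= a j) -> lp_family p B a ->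
  lp_family p B (iter n avg a).
Proof.
move=> p1 a0 h; elim: n => // n IH; rewrite iterS; apply: avg_lp => // j.
exact: iter_avg_ge0.
Qed.

Lemma avg_mono a b : (forall k, a k <= b k) -> forall k, avg a k <= avg b k.
Proof. by move=> ab k; rewrite /avg; have := ab k; have := ab (k - 1); have := ab (k + 1); lra. Qed.

End Averaging.

(** * The localizing kernel: mass, second moment, concentration *)

Section Kernel.
Variable R : realType.
Implicit Types (t theta : R) (f g : R -> R[i]).

(** This is cos((t - theta) / 2)^2; its n-th power is a trigonometric polynomial concentrated at
    distance n^(-1/2) from theta. *)
Definition kern theta t : R := (1 + cos (t - theta)) / 2.

Lemma kern_ge0 theta t : 0 <= kern theta t.
Proof. by rewrite divr_ge0//; have := cos_geN1 (t - theta); lra. Qed.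

Lemma continuous_kern theta n : continuous (fun t => kern theta t ^+ n).
Proof.
have ck : continuous (kern theta).
  move=> t; apply: cvgM; last exact: cvg_cst.
  apply: cvgD; first exact: cvg_cst.
  apply: (@continuous_comp _ _ _ (fun t => t - theta) cos); last exact: continuous_cos.
  by apply: cvgB; [exact: cvg_id|exact: cvg_cst].
elim: n => [|n IH]; first by move=> t; rewrite (_ : (fun t => _) = fun=> 1) //; exact: cvg_cst.
rewrite (_ : (fun t => _) = fun t => kern theta t * kern theta t ^+ n); last first.
  by apply/funext => t; rewrite exprS.
by move=> t; apply: cvgM; [exact: ck|exact: IH].
Qed.

Lemma kernE theta t : (kern theta t)%:C =
  2^-1 %:C + 4^-1 %:C * cis (1 * t + - theta) + 4^-1 %:C * cis (- 1 * t + theta).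
Proof.
rewrite mul1r mulN1r (_ : - t + theta = - (t - theta)); last by ring.
rewrite /kern /cis cosN sinN; set c := cos _; set s := sin _.
by apply/eqP; rewrite eq_complex /=; apply/andP; split; apply/eqP; field.
Qed.

Lemma fint_kern_step theta g (k : int) : ccontinuous g ->
  normc (fint (fun t => (kern theta t)%:C * g t) k%:~R) <=
  avg (fun j => normc (fint g j%:~R)) k.
Proof.
move=> cg.
have cm c d : ccontinuous (fun t => cis (c * t + d) * g t).
  by apply: ccontinuousM cg; apply: ccontinuous_cis; exact: continuous_linear.
have cz z h : ccontinuous h -> ccontinuous (fun t : R => z * h t).
  by move=> ch; exact: ccontinuousM (ccontinuous_cst z) ch.
rewrite (_ : (fun t => _) = fun t => 2^-1 %:C * g t +
   4^-1 %:C * (cis (1 * t + - theta) * g t) + 4^-1 %:C * (cis (- 1 * t + theta) * g t)); last first.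
  by apply/funext => t; rewrite kernE; ring.
have c1 := cz (2^-1)%:C _ cg; have c2 := cz (4^-1)%:C _ (cm 1 (- theta)).
have c3 := cz (4^-1)%:C _ (cm (-1) theta).
rewrite (fintD _ (ccontinuousD c1 c2) c3) (fintD _ c1 c2) !fintZ//.
apply: (le_trans (normcD _ _)).
apply: (le_trans (lerD (normcD _ _) (lexx _))).
rewrite !normcM !(normc_fint_modulate _ _ _ cg) !normcC.
rewrite !ger0_norm ?invr_ge0// /avg.
have -> : (k - 1)%:~R = k%:~R - 1 :> R by rewrite rmorphB.
have -> : (k + 1)%:~R = k%:~R - -1 :> R by rewrite rmorphD opprK.
exact: lexx.
Qed.

Lemma fint_kern_iter theta g n (k : int) : ccontinuous g ->
  normc (fint (fun t => (kern theta t ^+ n)%:C * g t) k%:~R) <=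
  iter n (@avg R) (fun j => normc (fint g j%:~R)) k.
Proof.
move=> cg; elim: n k => [|n IH] k.
  rewrite (_ : (fun t => _) = g)//; apply/funext => t; by rewrite expr0 mul1r.
rewrite (_ : (fun t => _) = fun t => (kern theta t)%:C * ((kern theta t ^+ n)%:C * g t)); last first.
  by apply/funext => t; rewrite exprS rmorphM/= mulrA.
have cn : ccontinuous (fun t => (kern theta t ^+ n)%:C * g t).
  by apply: ccontinuousM cg; apply: ccontinuous_real; exact: continuous_kern.
apply: (le_trans (fint_kern_step theta k cn)); rewrite iterS.
exact: avg_mono.
Qed.

Definition kmass theta n : R := rint (fun t => kern theta t ^+ n).

(** The Wallis recursion: the derivative of sin(t - theta) * kern^n integrates to 0 over a
    period. *)
Lemma kmass_rec theta n : 2 * (n%:R + 1) * kmass theta n.+1 = (2 * n%:R + 1) * kmass theta n.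
Proof.
have D (t : R) : is_derive t 1 (fun t => sin (t - theta) * kern theta t ^+ n)
   (2 * (n%:R + 1) * kern theta t ^+ n.+1 - (2 * n%:R + 1) * kern theta t ^+ n).
  have Dk : is_derive t 1 (kern theta) (- sin (t - theta) / 2).
    by rewrite /kern; apply: is_derive_eq; rewrite /GRing.scale/=; field.
  have Ds : is_derive t 1 (fun t => sin (t - theta)) (cos (t - theta)).
    by apply: is_derive_eq; rewrite /GRing.scale/=; ring.
  have ss : sin (t - theta) * sin (t - theta) = 4 * kern theta t * (1 - kern theta t).
    by rewrite -expr2 sin2cos2 /kern; field.
  case: n => [|n].
    have -> : (fun x : R => sin (x - theta) * kern theta x ^+ 0) = fun x => sin (x - theta).
      by apply/funext => x; rewrite expr0 mulr1.
    by apply: is_derive_eq; rewrite /kern expr0 expr1; field.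
  have Dp : is_derive t 1 (fun x => kern theta x ^+ n.+1) (n.+1%:R * kern theta t ^+ n * (- sin (t - theta) / 2)).
    have := is_deriveX n.+1 Dk; congr (is_derive t 1 _ _).
    by apply/funext => x; rewrite exprfctE.
  apply: (is_derive_eq (is_deriveM Ds Dp)); rewrite /GRing.scale/= -[n.+1%:R]natr1 !exprS.
  set k := kern theta t in ss *; set s := sin _ in ss *.
  have -> : cos (t - theta) = 2 * k - 1 by rewrite /k /kern; field.
  have -> : s * ((n%:R + 1) * k ^+ n * (- s / 2)) = - (n%:R + 1) / 2 * k ^+ n * (s * s) by field.
  by rewrite ss; field.
have cD : continuous (fun t => 2 * (n%:R + 1) * kern theta t ^+ n.+1 - (2 * n%:R + 1) * kern theta t ^+ n).
  by move=> t; apply: cvgB; (apply: cvgM; [exact: cvg_cst|exact: continuous_kern]).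
have c1 := @continuous_kern theta n; have c2 := @continuous_kern theta n.+1.
have cz c m : continuous (fun t => c * kern theta t ^+ m).
  by move=> t; apply: cvgM; [exact: cvg_cst|exact: continuous_kern].
have := rint_FTC D cD; rewrite rintB; [|exact: cz|exact: cz].
rewrite !rintZ// -/(kmass _ _) -/(kmass _ _).
have e : 2 * pi - theta = - theta + pi *+ 2 by rewrite mulr_natl addrC.
have -> : kern theta (2 * pi) = kern theta 0 by rewrite /kern e cosD2pi sub0r.
rewrite e sinD2pi sub0r.
by rewrite subrr => /eqP; rewrite subr_eq0 => /eqP.
Qed.

Lemma kmass0 theta : kmass theta 0 = 2 * pi.
Proof. by rewrite /kmass; under eq_fun do rewrite expr0; rewrite rint_cst mul1r. Qed.

Lemma kmass_gt0 theta n : 0 < kmass theta n.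
Proof.
elim: n => [|n IH]; first by rewrite kmass0 mulr_gt0// pi_gt0.
have n0 : 0 <= n%:R :> R by [].
have h : 0 < 2 * (n%:R + 1) :> R by lra.
rewrite -(pmulr_rgt0 _ h) kmass_rec mulr_gt0//; lra.
Qed.

(** The right-hand side is nondecreasing in n, because (2 n + 1)^2 (4 n + 5) exceeds (2 n + 2)^2 (4
    n + 1) by 1, and it starts at (2 * pi)^2 >= 16. *)
Lemma kmass_lower theta n : 16 <= kmass theta n ^+ 2 * (4 * n%:R + 1).
Proof.
elim: n => [|n IH].
  by rewrite kmass0 mulr0 add0r mulr1; have := @pi_ge2 R; move: (pi : R) => q; nra.
have n0 : 0 <= n%:R :> R by [].
have I0 := kmass_gt0 theta n; have r := kmass_rec theta n.
have e : kmass theta n.+1 = (2 * n%:R + 1) / (2 * (n%:R + 1)) * kmass theta n.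
  have d : 2 * (n%:R + 1) != 0 :> R by rewrite gt_eqF//; lra.
  by apply: (mulfI d); rewrite r mulrA mulrCA divff// mulr1.
apply: (le_trans IH); rewrite e exprMn -[leRHS]mulrA [leRHS]mulrCA.
apply: ler_wpM2l; first exact: sqr_ge0.
rewrite expr_div_n mulrAC ler_pdivlMr ?exprn_gt0//; lra.
Qed.

Lemma kmass_ge theta n : (0 < n)%N -> n%:R `^ (- 2^-1) <= kmass theta n.
Proof.
move=> n0; have nR : 1 <= n%:R :> R by rewrite ler1n.
have I0 := kmass_gt0 theta n; have := kmass_lower theta n => h.
rewrite -ler_sqr ?nnegrE ?powR_ge0 ?(ltW I0)// -powR_mulrn ?powR_ge0// -powRrM.
have -> : - 2^-1 * 2%:R = -1 :> R by field.
rewrite powR_inv1// -[leLHS]mul1r ler_pdivrMr ?ltr0n//; nra.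
Qed.

(** The integral is the difference of two consecutive masses. Since 1 - kern dominates (t - theta)^2
    up to a constant, this is the second moment of the kernel, of relative order 1 / n. *)
Lemma kmass_moment theta n :
  rint (fun t => kern theta t ^+ n * (1 - kern theta t)) <= kmass theta n / (2 * n%:R + 2).
Proof.
have n0 : 0 <= n%:R :> R by [].
rewrite (@eq_rint _ _ (fun t => kern theta t ^+ n - kern theta t ^+ n.+1)); last first.
  by move=> t; rewrite exprS; ring.
rewrite rintB; [|exact: continuous_kern|exact: continuous_kern].
rewrite -/(kmass _ _) -/(kmass _ n.+1) ler_pdivlMr; last by lra.
have := kmass_rec theta n; lra.
Qed.

(** 1 - kern = sin((t - theta) / 2)^2 vanishes again at distance 2 * pi; [mu] keeps away from there.
    Small arguments use [sin_lower], the others a positive minimum of the sine. *)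
Lemma sqr_le_kern (mu : R) : 0 < mu -> mu < 2 * pi -> exists2 C0, 0 < C0 & forall theta t,
  `|t - theta| <= 2 * pi - mu -> (t - theta) ^+ 2 <= C0 * (1 - kern theta t).
Proof.
have p0 := pi_gt0 R; move=> mu0 mu2.
have [eta eta0 He] := @sin_lower R.
pose b := pi - mu / 2; have b0 : 0 < b by rewrite /b; lra.
have sq theta t : 1 - kern theta t = sin ((t - theta) / 2) ^+ 2.
  rewrite /kern; set y := t - theta; have -> : cos y = cos (y / 2 + y / 2) by congr cos; field.
  by rewrite cosD -!expr2 cos2sin2; field.
have [m m0 Hm] : exists2 m, 0 < m & forall y, eta <= y <= b -> m <= sin y.
  have [be|eb] := ltP b eta; first by exists 1 => // y /andP[y1 y2]; lra.
  have [c /[!in_itv]/= /andP[c1 c2] Hc] := EVT_min eb (continuous_subspaceT (@continuous_sin R)).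
  exists (sin c); first by apply: sin_gt0_pi; apply/andP; split; rewrite /b in c2 *; lra.
  by move=> y yI; apply: Hc; rewrite in_itv.
have q0 : 0 <= 4 * pi ^+ 2 / m ^+ 2.
  by apply: divr_ge0; [apply: mulr_ge0 => //; exact: sqr_ge0|exact: sqr_ge0].
exists (16 + 4 * pi ^+ 2 / m ^+ 2); first by rewrite ltr_wpDr.
move=> theta t ht; rewrite sq; set y := t - theta in ht *.
have abs : sin (y / 2) ^+ 2 = sin (`|y| / 2) ^+ 2.
  case: (ger0P y) => // _; by rewrite mulNr sinN sqrrN.
rewrite abs -[leLHS]real_normK ?num_real//; move: `|y| (normr_ge0 y) ht => z z0 zb.
have [ze|ze] := leP (z / 2) eta.
  have := He (z / 2); rewrite ger0_norm; last by rewrite divr_ge0.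
  move=> /(_ ze) h; apply: (@le_trans _ _ (16 * sin (z / 2) ^+ 2)).
    rewrite -[X in 16 * X]real_normK ?num_real//.
    have : 0 <= `|sin (z / 2)| by []; nra.
  by apply: ler_wpM2r; [exact: sqr_ge0|rewrite lerDl].
have hm : m <= sin (z / 2) by apply: Hm; rewrite (ltW ze)/= /b; lra.
apply: (@le_trans _ _ (4 * pi ^+ 2 / m ^+ 2 * sin (z / 2) ^+ 2)); last first.
  by rewrite ler_wpM2r ?sqr_ge0// lerDr.
apply: (@le_trans _ _ (4 * pi ^+ 2)).
  by move: (pi : R) p0 zb mu0 => q q1 zb mu1; nra.
rewrite -[leRHS]mulrA; apply: ler_peMr; first by apply: mulr_ge0 => //; exact: sqr_ge0.
rewrite mulrC ler_pdivlMr ?exprn_gt0// mul1r.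
have s0 : 0 < sin (z / 2) := lt_le_trans m0 hm.
by rewrite ler_sqr ?nnegrE ?(ltW m0) ?(ltW s0).
Qed.

End Kernel.

(** * Resonant frequencies and the count of large averages *)

Section Resonance.
Variable R : realType.
Implicit Types (s t theta lam p : R).

(** Adding the remainders taken from the two ends cancels the values of [f] and leaves the
    difference of slopes times s - t. *)
Lemma taylor_holder (alpha H : R) (f df : R -> R) : taylor_bound alpha H f df -> 0 < alpha ->
  forall s t, `|df s - df t| <= 2 * H * `|s - t| `^ alpha.
Proof.
move=> tf a0 s t; have [->|st] := eqVneq s t.
  by rewrite !subrr normr0 powR0 ?mulr0// gt_eqF.
have d0 : 0 < `|s - t| by rewrite normr_gt0 subr_eq0.
rewrite -(ler_pM2r d0).
have -> : 2 * H * `|s - t| `^ alpha * `|s - t| = H * `|t - s| `^ (1 + alpha) + H * `|s - t| `^ (1 + alpha).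
  rewrite distrC powRD; last by apply/implyP => _; rewrite gt_eqF// distrC.
  by rewrite powRr1//; ring.
rewrite -normrM; apply: (le_trans _ (lerD (tf s t) (tf t s))).
have -> : (df s - df t) * (s - t) = (f t - f s - df s * (t - s)) + (f s - f t - df t * (s - t)) by ring.
exact: ler_normD.
Qed.

Lemma holder_continuous (alpha H : R) (g : R -> R) : 0 < alpha -> 0 <= H ->
  (forall s t, `|g s - g t| <= H * `|s - t| `^ alpha) -> continuous g.
Proof.
move=> a0 H0 gH x; apply/cvgrPdist_lt => e e0.
have H1 : 0 < H + 1 by rewrite ltr_wpDl.
exists ((e / (H + 1)) `^ alpha^-1); first by rewrite /= powR_gt0// divr_gt0.
move=> t /= xt; apply: (le_lt_trans (gH _ _)).
have : `|x - t| `^ alpha < e / (H + 1).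
  have -> : e / (H + 1) = ((e / (H + 1)) `^ alpha^-1) `^ alpha.
    by rewrite -powRrM mulVf ?gt_eqF// powRr1// divr_ge0 ?ltW.
  by apply: (gt0_ltr_powR a0); rewrite ?nnegrE ?powR_ge0.
rewrite ltr_pdivlMr// => h; apply: le_lt_trans h.
by rewrite mulrC ler_wpM2l ?powR_ge0// lerDl.
Qed.

Lemma powR_le_one_sqr (y q : R) : 0 <= y -> 0 <= q -> q <= 2 -> y `^ q <= 1 + y ^+ 2.
Proof.
move=> y0 q0 q2; have [y1|y1] := leP y 1.
  apply: (@le_trans _ _ 1); last by rewrite lerDl sqr_ge0.
  by rewrite -[leRHS](one_powR q); apply: (ge0_ler_powR q0); rewrite ?nnegrE.
apply: (@le_trans _ _ (y ^+ 2)); last by rewrite lerDr.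
by rewrite -powR_mulrn//; apply: ler_powR => //; exact: ltW.
Qed.

Variables (alpha H : R) (phi dphi : R -> R).
Hypotheses (al0 : 0 < alpha) (al1 : alpha < 1) (H0 : 0 <= H).
Hypotheses (tphi : taylor_bound alpha H phi dphi) (cphi : continuous phi).

(* Near [theta] the phase [lam * phi] agrees with its tangent up to O(1) on the
   width [n^(-1/2)] of the kernel, so there is no cancellation at the frequency
   [lam * dphi theta]. *)
Lemma resonant_coef (C0 mu lam theta : R) (k : int) (n : nat) : 0 < C0 -> (0 < n)%N ->
  (forall t, `|t - theta| <= 2 * pi - mu -> (t - theta) ^+ 2 <= C0 * (1 - kern theta t)) ->
  mu <= theta -> theta <= 2 * pi - mu -> k%:~R = lam * dphi theta ->
  `|lam| * H * n%:R `^ (- ((1 + alpha) / 2)) * (1 + C0) <= 2^-1 ->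
  kmass theta n / 2 <= normc (fint (fun t => (kern theta t ^+ n)%:C * cis (lam * phi t)) k%:~R).
Proof.
have a0 := al0; have a1 := al1; have h0 := H0.
move=> C00 n0 HC th1 th2 kE small.
set w := n%:R `^ _ in small; set rho := `|lam| * H * w in small.
have nR : 0 < n%:R :> R by rewrite ltr0n.
have w0 : 0 <= w by exact: powR_ge0.
have rho0 : 0 <= rho by rewrite !mulr_ge0.
(* The phase at the resonant point: rotating by it makes the integrand real there, and [E] is the
   remaining deviation. *)
pose ga := lam * phi theta - k%:~R * theta.
pose E t := lam * phi t - k%:~R * t - ga.
have cg : ccontinuous (fun t => (kern theta t ^+ n)%:C * cis (lam * phi t)).
  apply: ccontinuousM; first exact: ccontinuous_real (@continuous_kern R theta n).
  by apply: ccontinuous_cis => t; apply: cvgM; [exact: cvg_cst|exact: cphi].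
have cE : continuous E.
  move=> t; apply: cvgB; last exact: cvg_cst.
  apply: cvgB; first by apply: cvgM; [exact: cvg_cst|exact: cphi].
  exact: continuous_scale.
have ReE : complex.Re (cis (- ga) * fint (fun t => (kern theta t ^+ n)%:C * cis (lam * phi t)) k%:~R) =
    rint (fun t => kern theta t ^+ n * cos (E t)).
  rewrite /fint -cintZ; last exact: ccontinuousM cg (ccontinuous_char _).
  apply: eq_rint => t.
  have -> : cis (- ga) * ((kern theta t ^+ n)%:C * cis (lam * phi t) * cis (- (k%:~R * t))) =
     (kern theta t ^+ n)%:C * cis (E t).
    have -> : E t = - ga + (lam * phi t + - (k%:~R * t)) by rewrite /E; ring.
    by rewrite !cisD; ring.
  by rewrite /= mul0r subr0.
have : complex.Re (cis (- ga) * fint (fun t => (kern theta t ^+ n)%:C * cis (lam * phi t)) k%:~R) <=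
   normc (fint (fun t => (kern theta t ^+ n)%:C * cis (lam * phi t)) k%:~R).
  by apply: (le_trans (Re_le_normc _)); rewrite normcM normc_cis mul1r.
apply: le_trans; rewrite ReE.
pose B := rho * n%:R * C0.
have B0 : 0 <= B by rewrite !mulr_ge0// ltW.
have ck := @continuous_kern R theta n.
have ck2 : continuous (fun t => kern theta t ^+ n * (1 - kern theta t)).
  rewrite (_ : (fun t => _) = fun t => kern theta t ^+ n - kern theta t ^+ n.+1); last first.
    by apply/funext => t; rewrite exprS; ring.
  by move=> t; apply: cvgB; exact: continuous_kern.
have cz (c : R) (h : R -> R) : continuous h -> continuous (fun t => c * h t).
  by move=> ch t; apply: cvgM; [exact: cvg_cst|exact: ch].
have c1 := cz (1 - rho) _ ck; have c2 := cz B _ ck2.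
(* Pointwise, cos E >= 1 - |E| and |E| <= rho * (1 + n * C0 * (1 - kern)); averaged against the
   kernel, the deviation is then at most rho * (1 + C0). *)
have low : rint (fun t => (1 - rho) * kern theta t ^+ n - B * (kern theta t ^+ n * (1 - kern theta t))) <=
    rint (fun t => kern theta t ^+ n * cos (E t)).
  apply: le_rint.
  - by move=> t; apply: cvgB; [exact: c1|exact: c2].
  - move=> t; apply: cvgM; first exact: ck.
    by apply: (@continuous_comp _ _ _ E cos); [exact: cE|exact: continuous_cos].
  move=> t /andP[t0 t2].
  have k0 : 0 <= kern theta t ^+ n by rewrite exprn_ge0// kern_ge0.
  have -> : (1 - rho) * kern theta t ^+ n - B * (kern theta t ^+ n * (1 - kern theta t)) =
    kern theta t ^+ n * (1 - rho * (1 + n%:R * (C0 * (1 - kern theta t)))) by rewrite /B; ring.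
  rewrite ler_wpM2l//; apply: le_trans (one_sub_le_cos _).
  rewrite lerD2l lerN2.
  have tI : `|t - theta| <= 2 * pi - mu by rewrite ler_norml; apply/andP; split; lra.
  have EE : E t = lam * (phi t - phi theta - dphi theta * (t - theta)).
    by rewrite /E /ga kE; ring.
  rewrite EE normrM; apply: (le_trans (ler_wpM2l (normr_ge0 _) (tphi theta t))).
  rewrite /rho -!mulrA ler_wpM2l// ler_wpM2l//.
  set y := `|t - theta|.
  have y0 : 0 <= y by exact: normr_ge0.
  (* Distance measured in kernel widths: z^(1 + alpha) <= 1 + z^2 replaces the fractional power by a
     second moment. *)
  pose z := y * n%:R `^ 2^-1.
  have z0 : 0 <= z by rewrite mulr_ge0 ?powR_ge0.
  have q2 : 1 + alpha <= 2 by lra.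
  have q0 : 0 <= 1 + alpha by lra.
  have := powR_le_one_sqr z0 q0 q2.
  have -> : z `^ (1 + alpha) = y `^ (1 + alpha) * w^-1.
    by rewrite powRM ?powR_ge0// -powRrM /w powRN invrK; congr (_ * _ `^ _); field.
  have -> : z ^+ 2 = n%:R * y ^+ 2.
    rewrite exprMn -[X in _ * X]powR_mulrn ?powR_ge0// -powRrM mulVf// powRr1 ?ltW//; ring.
  have wp : 0 < w by rewrite powR_gt0.
  rewrite ler_pdivrMr// mulrC => /le_trans; apply.
  rewrite ler_wpM2l// lerD2l (ler_wpM2l (ltW nR))//.
  by have := HC t tI; rewrite -(real_normK (num_real (t - theta))).
apply: le_trans low; rewrite (rintB c1 c2) !rintZ//.
rewrite -/(kmass theta n).
have mom := kmass_moment theta n; have I0 := kmass_gt0 theta n.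
have h1 : B * rint (fun t => kern theta t ^+ n * (1 - kern theta t)) <= rho * C0 * kmass theta n.
  apply: (@le_trans _ _ (B * (kmass theta n / (2 * n%:R + 2)))); first by rewrite ler_wpM2l.
  have d0 : 0 < 2 * n%:R + 2 :> R by lra.
  rewrite mulrA ler_pdivrMr// /B.
  have -> : rho * n%:R * C0 * kmass theta n = rho * C0 * kmass theta n * n%:R by ring.
  rewrite ler_wpM2l; last by lra.
    by [].
  by rewrite !mulr_ge0// ltW.
apply: (@le_trans _ _ ((1 - rho) * kmass theta n - rho * C0 * kmass theta n)); last first.
  by rewrite lerD2l lerN2.
have -> : (1 - rho) * kmass theta n - rho * C0 * kmass theta n = kmass theta n * (1 - rho * (1 + C0)) by ring.
rewrite ler_pM2l//; lra.
Qed.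

(** About s0 * |lam| integers are resonant, and each gives an average of order n^(-1/2), that is
    |lam|^(-1 / (1 + alpha)); their p-th powers sum to |lam|^(1 - p / (1 + alpha)). *)
Lemma lp_lower_bound p (s0 u v : R) : 1 < p -> 0 < s0 -> 0 < u -> u < v -> v < 2 * pi ->
  s0 <= dphi u -> dphi v <= - s0 ->
  exists c L : R, 0 < c /\ forall lam (B : R), L <= `|lam| ->
    (forall s : seq int, uniq s ->
       \sum_(k <- s) normc (fint (fun t => cis (lam * phi t)) k%:~R) `^ p <= B) ->
    c * `|lam| `^ (1 - p / (1 + alpha)) <= B.
Proof.
have a0 := al0; have a1 := al1; have h0 := H0.
move=> p1 s00 u0 uv v2 dsu dsv; have p0 : 0 < p by lra.
have a10 : 0 < 1 + alpha by lra.
pose mu := Num.min u (2 * pi - v).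
have mu0 : 0 < mu by rewrite lt_min u0; lra.
have muu : mu <= u by rewrite ge_min lexx.
have muv : mu <= 2 * pi - v by rewrite ge_min lexx orbT.
have mu2 : mu < 2 * pi by lra.
have [C0 C00 HC] := sqr_le_kern mu0 mu2.
(* Makes the smallness condition of [resonant_coef] hold for n >= (k0 * |lam|)^(2 / (1 + alpha));
   the added 1 keeps k0 >= 1. *)
pose k0 := 2 * H * (1 + C0) + 1.
have k01 : 1 <= k0 by rewrite lerDr !mulr_ge0// addr_ge0// ltW.
have k00 : 0 < k0 by lra.
have cdphi : continuous dphi.
  by apply: (@holder_continuous alpha (2 * H)) => //; [rewrite mulr_ge0|exact: taylor_holder].
have ivt w : - s0 <= w <= s0 -> exists2 th, u <= th <= v & dphi th = w.
  move=> /andP[w1 w2]; have wI : Num.min (dphi u) (dphi v) <= w <= Num.max (dphi u) (dphi v).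
    by rewrite ge_min le_max; apply/andP; split; apply/orP; [right|left]; lra.
  have [th thI <-] := IVT (ltW uv) (continuous_subspaceT cdphi) wI.
  by exists th; move: thI; rewrite // in_itv.
pose c := s0 / 2 * (2^-1 * (2 * k0 `^ (2 / (1 + alpha))) `^ (- 2^-1)) `^ p.
(* The threshold gives |lam| * s0 >= 2, so rounding down the number of frequencies loses at most a
   factor 2. *)
exists c, (2 / s0 + 1); split.
  by rewrite mulr_gt0 ?divr_gt0// powR_gt0// mulr_gt0// powR_gt0// mulr_gt0// powR_gt0.
move=> lam B lamL HB.
have s2 : 0 < 2 / s0 by rewrite divr_gt0.
have l1 : 1 <= `|lam| by lra.
have l0 : 0 < `|lam| by lra.
have ls : 2 <= `|lam| * s0 by rewrite -ler_pdivrMr//; lra.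
pose Y := (k0 * `|lam|) `^ (2 / (1 + alpha)).
have e0 : 0 < 2 / (1 + alpha) by rewrite divr_gt0.
have kl1 : 1 <= k0 * `|lam| by nra.
have Y1 : 1 <= Y by rewrite -[leLHS](one_powR (2 / (1 + alpha))); apply: (ge0_ler_powR (ltW e0)); rewrite ?nnegrE; lra.
pose n := (Num.truncn Y).+1.
have Y0 : 0 <= Y by lra.
have /andP[tY1 tY2] := truncn_itv Y0.
have nY : Y <= n%:R by exact: ltW.
have n2Y : n%:R <= 2 * Y by rewrite /n -natr1; lra.
have nR : 0 < n%:R :> R by rewrite ltr0n.
have small : `|lam| * H * n%:R `^ (- ((1 + alpha) / 2)) * (1 + C0) <= 2^-1.
  have : n%:R `^ (- ((1 + alpha) / 2)) <= (k0 * `|lam|)^-1.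
    rewrite powRN lef_pV2 ?posrE ?powR_gt0//; last by rewrite mulr_gt0.
    have -> : k0 * `|lam| = Y `^ ((1 + alpha) / 2).
      rewrite /Y -powRrM (_ : 2 / (1 + alpha) * ((1 + alpha) / 2) = 1); last by field; rewrite gt_eqF.
      by rewrite powRr1// mulr_ge0 ?ltW.
    by apply: ge0_ler_powR; rewrite ?nnegrE//; lra.
  set w := n%:R `^ _ => hw.
  have w1 : k0 * `|lam| * w <= 1 by rewrite mulrC -ler_pdivlMr ?mulr_gt0// mul1r.
  have w0 : 0 <= w by exact: powR_ge0.
  have lw : 0 <= `|lam| * w by rewrite mulr_ge0.
  rewrite /k0 in w1; nra.
pose g t : R[i] := cis (lam * phi t).
have cg : ccontinuous g.
  by apply: ccontinuous_cis => t; apply: cvgM; [exact: cvg_cst|exact: cphi].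
pose a (j : int) := normc (fint g j%:~R).
have av := iter_avg_lp n p1 (fun j => normc_ge0 (fint g j%:~R)) HB.
pose N := Num.truncn (`|lam| * s0).
have ls0 : 0 <= `|lam| * s0 by lra.
have /andP[N1 N2] := truncn_itv ls0.
have Nlow : `|lam| * (s0 / 2) <= N%:R by rewrite -/N -natr1 in N2; lra.
pose I0 : R := n%:R `^ (- 2^-1).
have term (j : nat) : (j < N)%N -> (2^-1 * I0) <= iter n (@avg R) a (j.+1)%:Z.
  move=> jN.
  have jR : j.+1%:R <= `|lam| * s0 by apply: le_trans N1; rewrite ler_nat.
  have lamn : lam != 0 by rewrite -normr_gt0.
  (* The slopes fill an interval symmetric about 0, so positive integers are resonant for either
     sign of [lam]. *)
  have [th /andP[th1 th2] dth] : exists2 th, u <= th <= v & dphi th = j.+1%:R / lam.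
    apply: ivt; rewrite -ler_norml normrM normfV ler_pdivrMr// mulrC.
    by rewrite (le_trans _ jR)// ger0_norm.
  have kE : (j.+1%:Z)%:~R = lam * dphi th by rewrite dth mulrCA divff// mulr1.
  have h1 := resonant_coef C00 (isT : (0 < n)%N) (HC th) (le_trans muu th1) _ kE small.
  have := h1 _; have th3 : th <= 2 * pi - mu by lra.
  move=> /(_ th3) h2; apply: (le_trans _ (fint_kern_iter th n _ cg)).
  apply: le_trans h2; rewrite mulrC ler_wpM2r// .
  exact: kmass_ge.
have us : uniq [seq (j.+1)%:Z | j <- iota 0 N] by rewrite map_inj_uniq ?iota_uniq// => i j [].
apply: le_trans (av _ us); rewrite big_map.
apply: (@le_trans _ _ (\sum_(j <- iota 0 N) (2^-1 * I0) `^ p)); last first.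
  rewrite big_seq [leRHS]big_seq; apply: ler_sum => j; rewrite mem_iota add0n => jN.
  have i0 : 0 <= 2^-1 * I0 by rewrite mulr_ge0 ?powR_ge0.
  have t1 := term j jN.
  by apply: (ge0_ler_powR (ltW p0)); rewrite ?nnegrE// (le_trans i0).
rewrite big_const_seq count_predT size_iota iter_addr_0 -[leRHS]mulr_natl.
have I0low : (2 * k0 `^ (2 / (1 + alpha))) `^ (- 2^-1) * `|lam| `^ (- (1 + alpha)^-1) <= I0.
  have -> : (2 * k0 `^ (2 / (1 + alpha))) `^ (- 2^-1) * `|lam| `^ (- (1 + alpha)^-1) = (2 * Y) `^ (- 2^-1).
    rewrite /Y (powRM _ (ltW k00) (ltW l0)) mulrA [RHS]powRM ?mulr_ge0 ?powR_ge0//.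
    by congr (_ * _); rewrite -powRrM; congr (_ `^ _); field; rewrite gt_eqF.
  rewrite /I0 !powRN lef_pV2 ?posrE ?powR_gt0//; last by lra.
  by apply: ge0_ler_powR; rewrite ?nnegrE//; lra.
have i0 : 0 <= I0 by exact: powR_ge0.
apply: (@le_trans _ _ (`|lam| * (s0 / 2) * (2^-1 * I0) `^ p)); last by rewrite ler_wpM2r ?powR_ge0.
rewrite /c; set X := _ `^ (- 2^-1) in I0low *.
have X0 : 0 <= X by exact: powR_ge0.
pose Z := `|lam| `^ (- (1 + alpha)^-1); have Z0 : 0 <= Z by exact: powR_ge0.
have XZ : (2^-1 * (X * Z)) `^ p <= (2^-1 * I0) `^ p.
  have m0 : 0 <= 2^-1 * (X * Z) by rewrite !mulr_ge0.
  have m1 : 2^-1 * (X * Z) <= 2^-1 * I0 by rewrite /Z; lra.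
  by apply: (ge0_ler_powR (ltW p0)); rewrite ?nnegrE// (le_trans m0).
have ls2 : 0 <= `|lam| * (s0 / 2) by lra.
apply: (le_trans _ (ler_wpM2l ls2 XZ)).
have X20 : 0 <= 2^-1 * X by apply: mulr_ge0 X0; rewrite invr_ge0 ler0n.
have -> : (2^-1 * (X * Z)) `^ p = (2^-1 * X) `^ p * `|lam| `^ (- (p / (1 + alpha))).
  by rewrite (mulrA 2^-1 X) (powRM p X20 Z0) -(powRrM `|lam|) mulNr (mulrC _ p).
rewrite (@powRD _ `|lam| 1); last by apply/implyP => _; rewrite gt_eqF.
rewrite (powRr1 (ltW l0)); set y1 := (_ * X) `^ p; set y2 := `|lam| `^ _.
by apply: le_of_eq; ring.
Qed.

End Resonance.

(** * Periodization *)

Section Periodization.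
Variable R : realType.
Implicit Types (s t : R) (f df : R -> R).

Local Notation tau := (2 * pi : R).

Definition winding t : int := Num.floor (t / tau).

Definition periodize f t : R := f (t - tau * (winding t)%:~R).

Lemma winding_itv t : tau * (winding t)%:~R <= t < tau * (winding t)%:~R + tau.
Proof.
have t0 := twopi_gt0 R.
have := floor_itv (t / tau); rewrite -/(winding t) intrD ler_pdivlMr// ltr_pdivrMr//.
by move=> /andP[h1 h2]; apply/andP; split; lra.
Qed.

Lemma winding_def t (m : int) : tau * m%:~R <= t -> t < tau * m%:~R + tau -> winding t = m.
Proof.
have t0 := twopi_gt0 R => h1 h2.
apply: floor_def; rewrite intrD ler_pdivlMr// ltr_pdivrMr//.
by apply/andP; split; lra.
Qed.

Lemma periodize_periodic f : periodic (periodize f) tau.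
Proof.
move=> t; have /andP[h1 h2] := winding_itv t; rewrite /periodize.
rewrite (@winding_def (t + tau) (winding t + 1)) ?intrD; [|lra|lra].
by congr f; ring.
Qed.

Lemma periodize_id f t : 0 <= t -> t < tau -> periodize f t = f t.
Proof.
move=> h1 h2; rewrite /periodize (@winding_def t 0) ?mulr0 ?add0r//.
by rewrite subr0.
Qed.

(* On the open window of two periods around [2 * pi * m] the periodization is a
   sum of two translates, hence as smooth as [f] also at [2 * pi * m]. *)
Definition unwind f (m : int) t : R := f (t - tau * m%:~R) + f (t - tau * (m%:~R - 1)).

Definition vanishes_off_period f := forall t, (t <= 0) || (tau <= t) -> f t = 0.

Lemma periodize_unwind f (m : int) t : vanishes_off_period f ->
  tau * (m%:~R - 1) < t -> t < tau * (m%:~R + 1) -> periodize f t = unwind f m t.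
Proof.
move=> f0 h1 h2; rewrite /periodize /unwind; have [tm|tm] := leP (tau * m%:~R) t.
  rewrite (@winding_def t m)//; last by lra.
  rewrite (f0 (t - tau * (m%:~R - 1))) ?addr0//; apply/orP; right; lra.
rewrite (@winding_def t (m - 1)) ?intrD ?mulrN1z; [|lra|lra].
by rewrite (f0 (t - tau * m%:~R)) ?add0r//; apply/orP; left; lra.
Qed.

Lemma taylor_bound_unwind (alpha H : R) f df m : taylor_bound alpha H f df ->
  taylor_bound alpha (2 * H) (unwind f m) (unwind df m).
Proof.
move=> tf s t; rewrite /unwind.
have := tf (s - tau * m%:~R) (t - tau * m%:~R).
have := tf (s - tau * (m%:~R - 1)) (t - tau * (m%:~R - 1)).
rewrite !(_ : forall x, t - x - (s - x) = t - s); try by move=> x; ring.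
move=> h1 h2; apply: le_trans (_ : _ <= H * `|t - s| `^ (1 + alpha) + H * `|t - s| `^ (1 + alpha)) _; last by lra.
apply: le_trans (lerD h1 h2); apply: le_trans (ler_normD _ _); apply: le_of_eq.
by congr `|_|; ring.
Qed.

Lemma taylor_bound_is_derive (alpha H : R) f df t : 0 < alpha -> 0 <= H ->
  taylor_bound alpha H f df -> is_derive t 1 f (df t).
Proof.
move=> a0 H0 tf.
have H1 : 0 < H + 1 by rewrite ltr_wpDl.
have C : h^-1 *: ((f \o shift t) (h *: (1 : R)) - f t) @[h --> 0^'] --> df t.
  apply/cvgrPdist_le => e e0; near=> h.
  have hn : h != 0 by near: h; exact: nbhs_dnbhs_neq.
  have h0 : 0 < `|h| by rewrite normr_gt0.
  rewrite /= [h *: 1]mulr1 [_ *: _]/(_ * _) -(ler_pM2r h0) -normrM mulrBl mulrAC mulVf// mul1r distrC.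
  have := tf t (h + t); rewrite addrK => /le_trans; apply.
  rewrite powRD; last by apply/implyP => _; rewrite gt_eqF.
  rewrite powRr1 ?normr_ge0// mulrCA mulrC ler_wpM2r//.
  have : `|h| `^ alpha <= e / (H + 1).
    have -> : e / (H + 1) = ((e / (H + 1)) `^ alpha^-1) `^ alpha.
      by rewrite -powRrM mulVf ?gt_eqF// powRr1// divr_ge0 ?ltW.
    apply: (ge0_ler_powR (ltW a0)); rewrite ?nnegrE ?powR_ge0//.
    near: h; apply: dnbhs0_le; exact: powR_gt0 (divr_gt0 e0 H1).
  rewrite ler_pdivlMr// => /(le_trans _); apply.
  by rewrite mulrC ler_wpM2l ?powR_ge0// lerDl.
by apply: DeriveDef; [apply/cvg_ex; exists (df t)|exact: cvg_lim C].
Unshelve. all: by end_near. Qed.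

Variables (alpha H : R) (f df : R -> R).
Hypotheses (al0 : 0 < alpha) (H0 : 0 <= H).
Hypotheses (tf : taylor_bound alpha H f df) (f0 : vanishes_off_period f).

Lemma periodize_is_derive (m : int) t : tau * (m%:~R - 1) < t -> t < tau * (m%:~R + 1) ->
  is_derive t 1 (periodize f) (unwind df m t).
Proof.
move=> h1 h2.
apply: (@near_eq_is_derive _ _ _ (unwind f m)).
  have : t \in `](tau * (m%:~R - 1)), (tau * (m%:~R + 1))[%R by rewrite in_itv/= h1.
  move=> /near_in_itvoo; apply: filterS => z /=; rewrite ?inE/= ?in_itv/= => /andP[z1 z2].
  exact/esym/periodize_unwind.
by apply: (taylor_bound_is_derive _ al0 _ (taylor_bound_unwind _ tf)); rewrite mulr_ge0.
Qed.

Lemma periodize_C1_alpha : C1_alpha alpha (periodize f).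
Proof.
have t0 := twopi_gt0 R; have a0 := al0; have h0 := H0.
have dE m t : tau * (m%:~R - 1) < t -> t < tau * (m%:~R + 1) ->
    derive1 (periodize f) t = unwind df m t.
  by move=> h1 h2; rewrite derive1E; have := periodize_is_derive h1 h2 => dD; rewrite derive_val.
split; first exact: periodize_periodic.
  move=> t; have /andP[h1 h2] := winding_itv t.
  by apply: (@ex_derive _ _ _ _ _ _ _ (@periodize_is_derive (winding t) t _ _)); lra.
exists (2 * (2 * H)); near=> d.
have d1 : d <= 1 by near: d; exact: nbhs_right_le.
have d0 : 0 < d by near: d; exact: nbhs_right_gt.
have holder t1 t2 : `|t1 - t2| <= d -> t1 <= t2 ->
    `|derive1 (periodize f) t1 - derive1 (periodize f) t2| <= 2 * (2 * H) * d `^ alpha.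
  rewrite distrC ler_norml => /andP[_ t12] le12.
  have /andP[h1 h2] := winding_itv t1; have tau2 := @pi_ge2 R.
  (* Points at distance at most 1 lie in a common window of two periods, centred at the boundary
     between them when there is one. *)
  have [m [k1 k2 k3 k4]] : exists m : int, [/\ tau * (m%:~R - 1) < t1, t1 < tau * (m%:~R + 1),
      tau * (m%:~R - 1) < t2 & t2 < tau * (m%:~R + 1)].
    have [t2m|t2m] := ltP t2 (tau * (winding t1)%:~R + tau).
      by exists (winding t1); split; lra.
    by exists (winding t1 + 1); rewrite intrD; split; lra.
  rewrite !(dE m)//; apply: (le_trans (taylor_holder (taylor_bound_unwind m tf) al0 t1 t2)).
  rewrite ler_wpM2l ?mulr_ge0//; apply: (ge0_ler_powR (ltW al0)); rewrite ?nnegrE// ?(ltW d0)//.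
  by rewrite distrC ger0_norm; lra.
apply: ge_ereal_sup => _ [t1 [t2 [t12 ->]]]; rewrite lee_fin.
have [le12|/ltW le21] := leP t1 t2; first exact: holder.
by rewrite distrC; apply: holder; rewrite // distrC.
Unshelve. all: by end_near. Qed.

Lemma periodize_nowhere_linear :
  (forall c d, 0 <= c -> c < d -> d <= tau -> ~ exists a b, forall t, c < t < d -> f t = a * t + b) ->
  nowhere_linear (periodize f).
Proof.
move=> na c d cd [a [b ab]]; have /andP[h1 h2] := winding_itv c.
set k := (winding c)%:~R in h1 h2; have t0 := twopi_gt0 R.
(* Cuts the interval at the end of the period containing [c], so that a single translate of [f] is
   involved. *)
pose d' := Num.min d (tau * k + tau).
have d'1 : d' <= d by rewrite ge_min lexx.
have d'2 : d' <= tau * k + tau by rewrite ge_min lexx orbT.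
have cd' : c < d' by rewrite lt_min cd.
apply: (na (c - tau * k) (d' - tau * k)); [lra|lra|lra|].
exists a, (a * (tau * k) + b) => t /andP[t1 t2].
have tI : c < t + tau * k < d by apply/andP; split; lra.
have := ab (t + tau * k); rewrite in_itv/= => /(_ tI).
rewrite /periodize (@winding_def _ (winding c)) -/k; [|lra|lra].
by rewrite addrK => ->; ring.
Qed.

End Periodization.

(** * From finite sums of coefficients to the norms of A_p *)

Section WienerNorms.
Variable R : realType.
Implicit Types (t lam p b B : R) (f : R -> R).

Lemma fourier_sum_le p B (g : R -> R[i]) :
  (forall s : seq int, uniq s -> \sum_(k <- s) normc (fourier_coef g k) `^ p <= B) ->
  (fourier_sum p g <= B%:E)%E.
Proof.
move=> h; apply: ge_ereal_sup => _ [A [finA _] <-].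
by rewrite fsbig_finite// sumEFin lee_fin; apply: h; exact: finmap.fset_uniq.
Qed.

Lemma fourier_sum_ge p (g : R -> R[i]) (s : seq int) : uniq s ->
  ((\sum_(k <- s) normc (fourier_coef g k) `^ p)%:E <= fourier_sum p g)%E.
Proof.
move=> us; apply: esum_ge; exists [set` s]; first by split; [exact: finite_seq|].
by rewrite -fsbig_seq// sumEFin.
Qed.

Variables (f : R -> R).
Hypotheses (cp : continuous (periodize f)) (f0 : vanishes_off_period f).

Local Notation g lam := (fun t => cis (lam * periodize f t)).
Local Notation coef lam k := (normc (fint (fun t => cis (lam * f t)) k%:~R)).

Lemma normc_fourier_coef lam (k : int) : normc (fourier_coef (g lam) k) = (2 * pi)^-1 * coef lam k.
Proof.
have t0 := twopi_gt0 R.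
have per t : t \in `[0, (2 * pi : R)] -> periodize f t = f t.
  rewrite inE/= in_itv/= => /andP[a0]; rewrite le_eqVlt => /orP[/eqP ->|a1]; last exact: periodize_id.
  rewrite -[X in periodize f X]add0r periodize_periodic periodize_id// !f0 ?lexx ?orbT//.
rewrite /fourier_coef normcM normcC gtr0_norm ?invr_gt0//; congr (_ * normc _).
by rewrite /fint /cint /cintegral; congr (_ +i* _); apply: eq_Rintegral => t /per ->.
Qed.

Lemma in_A_periodize lam p : (fourier_sum p (g lam) < +oo)%E -> in_A p (g lam).
Proof.
move=> fin.
have cg : ccontinuous (g lam) by apply: ccontinuous_cis => t; apply: cvgM; [exact: cvg_cst|exact: cp].
split => //; first by move=> t; rewrite periodize_periodic.
case: ifP => // _; case: cg => c1 c2; split; exact: continuous_integrableI.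
Qed.

Lemma A_norm_le p lam B : 1 <= p ->
  (forall s : seq int, uniq s -> \sum_(k <- s) coef lam k `^ p <= B) ->
  (A_norm p (g lam) <= (B `^ p^-1)%:E)%E.
Proof.
move=> p1 h; have p0 : 0 < p by lra.
have B0 : 0 <= B by have := h [::] isT; rewrite big_nil.
have t0 := twopi_gt0 R.
have ti : (2 * pi)^-1 <= 1 :> R by rewrite invf_le1//; have := @pi_ge2 R; lra.
have sB : (fourier_sum p (g lam) <= B%:E)%E.
  apply: fourier_sum_le => s us; apply: le_trans (h s us); apply: ler_sum => k _.
  rewrite normc_fourier_coef; apply: (ge0_ler_powR (ltW p0)); rewrite ?nnegrE ?mulr_ge0 ?invr_ge0 ?normc_ge0 ?(ltW t0)//.
  by rewrite ler_piMl ?normc_ge0.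
rewrite /A_norm asboolT; last by apply: in_A_periodize; apply: le_lt_trans sB _; rewrite ltry.
rewrite -poweR_EFin; apply: gt0_ler_poweR => //; rewrite ?invr_ge0 ?(ltW p0)// in_itv/= ?leey ?andbT.
  by apply: esum_ge0 => k _; rewrite lee_fin powR_ge0.
by rewrite lee_fin.
Qed.

(** The lower estimate enters as a bound below every common bound of the finite sums. The factor 1 /
    (2 * pi) is the normalization of the coefficients, and an infinite norm needs no estimate. *)
Lemma A_norm_ge p lam b : 1 <= p -> 0 <= b ->
  (forall B, (forall s : seq int, uniq s -> \sum_(k <- s) coef lam k `^ p <= B) -> b <= B) ->
  (((2 * pi)^-1 * b `^ p^-1)%:E <= A_norm p (g lam))%E.
Proof.
move=> p1 b0 h; have p0 : 0 < p by lra.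
have t0 := twopi_gt0 R.
rewrite /A_norm; case: asboolP => [[_ _ fin]|_]; last by rewrite leey.
have F0 : (0 <= fourier_sum p (g lam))%E by apply: esum_ge0 => k _; rewrite lee_fin powR_ge0.
have [F FE] : exists F : R, fourier_sum p (g lam) = F%:E.
  by exists (fine (fourier_sum p (g lam))); rewrite fineK// ge0_fin_numE.
rewrite FE lee_fin in F0; rewrite FE poweR_EFin lee_fin.
have bF : b <= (2 * pi) `^ p * F.
  apply: h => s us.
  have := @fourier_sum_ge p (g lam) s us; rewrite FE lee_fin.
  rewrite (eq_bigr (fun k => ((2 * pi)^-1) `^ p * coef lam k `^ p)); last first.
    by move=> k _; rewrite normc_fourier_coef powRM ?invr_ge0 ?normc_ge0 ?ltW.
  rewrite -mulr_sumr => hF.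
  rewrite -ler_pdivrMl ?powR_gt0//; apply: le_trans hF.
  rewrite (_ : ((2 * pi) `^ p)^-1 = ((2 * pi)^-1) `^ p)//.
  have tp : (2 * pi) `^ p != 0 :> R by rewrite gt_eqF// powR_gt0.
  by apply: (mulIf tp); rewrite mulVf// -powRM ?invr_ge0 ?ltW// mulVf ?gt_eqF// one_powR.
rewrite ler_pdivrMl//.
have -> : 2 * pi * F `^ p^-1 = ((2 * pi) `^ p * F) `^ p^-1.
  by rewrite powRM ?powR_ge0// -powRrM mulfV ?gt_eqF// powRr1// ltW.
by apply: ge0_ler_powR; rewrite ?nnegrE ?invr_ge0 ?(ltW p0)// (le_trans b0).
Qed.

End WienerNorms.

Theorem corollary2 (R : realType) (alpha : R) (h0 : 0 < alpha) (h1 : alpha < 1) :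
  exists phi : R -> R,
    [/\ C1_alpha alpha phi,
        nowhere_linear phi,
        bigO_infty
          (fun lam => A_norm 1 (fun t => cis (lam * phi t)))
          (fun lam => `|lam| `^ (alpha / (1 + alpha)) *
                      (ln `|lam|) `^ ((1 - alpha) / (1 + alpha)))
      & [/\ (forall p : R, 1 < p -> p < 1 + alpha ->
              same_order_infty
                (fun lam => A_norm p (fun t => cis (lam * phi t)))
                (fun lam => `|lam| `^ (p^-1 - (1 + alpha)^-1))),
            (forall p : R, 1 + alpha < p -> p < 2 ->
              same_order_infty
                (fun lam => A_norm p (fun t => cis (lam * phi t)))
                (fun lam => 1))
          & (forall p : R, p = 1 + alpha ->
              bigO_infty
                (fun lam => A_norm p (fun t => cis (lam * phi t)))
                (fun lam => (ln `|lam|) `^ p^-1))]].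
Proof.
have [xi [C [K cs]]] := exists_cantor_spec h0 h1.
have [H0 profile] := cantor_profile cs.
have [r [l pl]] := exists_placement profile.
have [H [f [df ph]]] := exists_phase h0 h1 profile pl.
have cf : continuous f := @continuous_phi _ _ _ _ _ _ _ _ ph.
have f0 : vanishes_off_period f := ph_zero ph.
have smooth := periodize_C1_alpha h0 (ph_H_ge0 ph) (ph_taylor ph) f0.
have cp : continuous (periodize f).
  case: smooth => _ dp _ t; apply: differentiable_continuous; exact/derivable1_diffP.
have a1 : 0 < 1 + alpha by lra.
exists (periodize f); split.
- exact: smooth.
- exact: periodize_nowhere_linear (ph_not_affine ph).
- have [D D0 HD] := l1_sum_bound cs pl ph.
  exists D, (expR 1) => lam lamL.
  have e1 : 1 <= expR 1 :> R by rewrite -[leLHS]expR0 ler_expR.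
  have l1 : 1 <= `|lam| by lra.
  apply: (@le_trans _ _ ((D * `|lam| `^ kappa alpha) `^ 1^-1)%:E).
    apply: (A_norm_le cp f0) => // s us; apply: le_trans (HD lam s us l1).
    by apply: ler_sum => k _; rewrite powRr1 ?normc_ge0.
  rewrite lee_fin invr1 powRr1 ?mulr_ge0 ?powR_ge0 ?(ltW D0)// ler_wpM2l ?(ltW D0)//.
  (* The l1 estimate carries no logarithm; from |lam| >= e on the logarithmic factor is at least 1
     and can be inserted. *)
  rewrite ler_peMr ?powR_ge0//.
  have ln1 : 1 <= ln `|lam| by rewrite -[leLHS]expRK ler_ln ?posrE ?expR_gt0; lra.
  rewrite -[leLHS](one_powR ((1 - alpha) / (1 + alpha))).
  by apply: ge0_ler_powR; rewrite ?nnegrE ?divr_ge0//; lra.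
split.
- move=> p p1 pa; have p0 : 0 < p by lra.
  have p2 : p < 2 by lra.
  have [D1 D10 HD1] := lp_sum_bound cs pl ph p1 p2.
  have [D2 D20 HD2] := levels_subcritical cs pa.
  have [s0 [u [v [s00 /andP[u0 uv] v2 su sv]]]] := ph_slopes ph.
  have [c [L [c0 HL]]] := lp_lower_bound h0 h1 (ph_H_ge0 ph) (ph_taylor ph) cf p1 s00 u0 uv v2 su sv.
  have powE (E : R) lam : 0 <= E -> (E * `|lam| `^ (1 - p / (1 + alpha))) `^ p^-1 =
      E `^ p^-1 * `|lam| `^ (p^-1 - (1 + alpha)^-1).
    move=> E0; rewrite powRM ?powR_ge0// -(powRrM `|lam|); congr (_ * _ `^ _).
    by field; rewrite !gt_eqF.
  exists ((2 * pi)^-1 * c `^ p^-1), ((D1 * D2) `^ p^-1), (Num.max 1 L); split.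
  + by rewrite mulr_gt0 ?powR_gt0// invr_gt0 twopi_gt0.
  + by rewrite powR_gt0// mulr_gt0.
  move=> lam; rewrite ge_max => /andP[l1 lL]; split.
    rewrite -mulrA -powE ?(ltW c0)//.
    have b0 : 0 <= c * `|lam| `^ (1 - p / (1 + alpha)) by rewrite mulr_ge0 ?powR_ge0 ?(ltW c0).
    by apply: (@A_norm_ge _ f f0 p lam _ (ltW p1) b0) => B HB; exact: HL.
  rewrite -powE; last by rewrite mulr_ge0 ?ltW.
  apply: (A_norm_le cp f0) => [|s us]; first exact: ltW.
  have [n n1 n2] := HD2 lam l1.
  apply: (le_trans (HD1 lam n s us n1)); rewrite -mulrA.
  exact: ler_wpM2l (ltW D10) _ _ n2.
- move=> p pa p2; have p1 : 1 < p by lra.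
  have p0 : 0 < p by lra.
  have [D1 D10 HD1] := lp_sum_bound cs pl ph p1 p2.
  have [D2 D20 HD2] := levels_supercritical cs pa.
  (* The threshold is 0: the generations add up to a bound independent of n, so any large n serves,
     and both inequalities hold for every lam. *)
  exists (2 * pi)^-1, ((D1 * D2) `^ p^-1), 0; split.
  + by rewrite invr_gt0 twopi_gt0.
  + by rewrite powR_gt0// mulr_gt0.
  move=> lam _; rewrite !mulr1; split.
    have := @A_norm_ge _ _ f0 p lam 1 (ltW p1) ler01; rewrite one_powR mulr1; apply => B /(_ [:: 0] isT).
    rewrite big_seq1; apply: le_trans.
    rewrite -[leLHS](one_powR p); apply: (ge0_ler_powR (ltW p0)); rewrite ?nnegrE ?normc_ge0//.
    exact: fint0_lower cs _ _ pl _ _ _ ph lam.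
  apply: (A_norm_le cp f0) => [|s us]; first exact: ltW.
  have xi0 := cs_xi_gt0 cs; have xi1 := cs_xi_lt cs.
  have [n n1] : exists n : nat, 2 * `|lam| * (xi / 2) ^+ n < 1.
    by apply: geometric_small; lra.
  apply: (le_trans (HD1 lam n s us (ltW n1))).
  exact: ler_wpM2l (ltW D10) _ _ (HD2 n).
- move=> p pE; have p1 : 1 < p by lra.
  have p0 : 0 < p by lra.
  have p2 : p < 2 by lra.
  have [D1 D10 HD1] := lp_sum_bound cs pl ph p1 p2.
  have [D2 [L [D20 HD2]]] := levels_critical cs.
  exists ((D1 * D2) `^ p^-1), (Num.max 1 L) => lam; rewrite ge_max => /andP[l1 lL].
  rewrite -powRM ?ln_ge0//; last by rewrite mulr_ge0 ?ltW.
  apply: (A_norm_le cp f0) => [|s us]; first exact: ltW.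
  have [n n1 n2] := HD2 lam lL.
  apply: (le_trans (HD1 lam n s us n1)); rewrite -mulrA pE.
  exact: ler_wpM2l (ltW D10) _ _ n2.
Qed.
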